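(* Let $n\ge1$ and let $D$ be a type $D$ diagram with $n+1$ strands and an even number of dots. Let $I^{\bullet}(D)=\{1\}$ if there is a dotted inner-most cap at position $1$ and $I^\bullet(D)=\emptyset$ otherwise, let $I^{\circ}(D)\subseteq[1,n+1]$ be the set of positions of the inner-most caps without a dot, and let $I(D)=I^\bullet(D)\cup I^\circ(D)$. For $i\in I(D)$ let $D_i$ be the $n$-strand diagram obtained from $D$ by removing the inner-most cap at position $i$; further, if $i=1\in I^\bullet(D)$, a dot is added on the cap or vertical strand of $D_1$ containing the left-most bottom point (if this strand then carries two dots, both are deleted). Then $$\mathrm{coef}_n(D)=\sum_{i\in I(D)}\mathrm{coef}(g_{n,i})\,\mathrm{coef}_{n-1}(D_i).$$ Each $D_i$ again has an even number of dots, so the relation can be applied recursively.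
   Context: **Algebra.** Work over $\mathbb{C}(q)$ with $[m]=(q^m-q^{-m})/(q-q^{-1})$. $\mathrm{TL}^D_{n+1}$ is the unital algebra generated by $E_0,\dots,E_n$ with relations $E_i^2=-[2]E_i$; $E_iE_jE_i=E_i$ if $i,j$ are adjacent; $E_iE_j=E_jE_i$ if $i\neq j$ are not adjacent, where adjacency is in the graph on $\{0,\dots,n\}$ with edges $\{0,2\},\{1,2\}$ and $\{i,i+1\}$ for $2\le i\le n-1$. For $m\le n$, $\mathrm{TL}^D_{m+1}$ is the subalgebra generated by $E_0,\dots,E_m$. $Q_n\in\mathrm{TL}^D_{n+1}$ is the unique element with $Q_n\ne0$, $Q_nQ_i=Q_iQ_n=Q_n$ for $0\le i\le n$, and $E_iQ_n=Q_nE_i=0$ for $0\le i\le n$. A word (product of generators) is reduced if it is not a scalar multiple of a shorter word; the distinct elements given by reduced words form a basis. **Diagrams.** An $N$-strand connectivity is a non-crossing pairing by $N$ strands of $N$ bottom and $N$ top marked points of a rectangle. Label the bottom points $1,\dots,N$ from left to right and the top points $N+1,\dots,2N$ from right to left; the strands become non-crossing chords on $\{1,\dots,2N\}$. The identity connectivity $\mathbf 1$ has chords $\{k,2N+1-k\}$. A chord is outer if it is not nested inside another chord. A type $D$ diagram is a connectivity with some chords dotted (at most one dot per chord) such that either the number of dots is even (possibly zero) and all dotted chords are outer, or there is exactly one dot, it is on the chord containing the point $1$, and the connectivity is not $\mathbf 1$. For $i\ge1$, $E_i$ is the undotted diagram with a cap joining the $i$-th and $(i+1)$-th bottom points, a cup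 joining the $i$-th and $(i+1)$-th top points, and vertical strands elsewhere; $E_0$ has the connectivity of $E_1$ with both its cap and its cup dotted. The diagram of a reduced word is obtained by stacking (left factor on top), deleting loops carrying a single dot, and, if the resulting number of dots is odd, moving the unique dot to the chord containing the point $1$. For $n\ge1$ this identifies the basis of reduced words of $\mathrm{TL}^D_{n+1}$ with the $(n+1)$-strand type $D$ diagrams. $\mathrm{coef}_n(D)$ is the coefficient in $Q_n$ of the basis element with diagram $D$; the only $1$-strand diagram is $\mathbf 1$, with $\mathrm{coef}_0(\mathbf 1)=1$. **Inner-most caps.** For an $(n+1)$-strand diagram, there is an inner-most cap at position $i\in[1,n+1]$ if $\{i,i+1\}$ is a chord (for $i=n+1$ this is the vertical strand joining the right-most bottom and top points). Removing it means deleting this chord (with its dot, if any) and relabelling the remaining $2n$ points increasingly by $1,\dots,2n$, all other chords keeping their dots, giving an $n$-strand diagram. **Coefficients.** $\mathrm{coef}(g_{n,1})=\frac{[n]}{[2n]}$ and $\mathrm{coef}(g_{n,i})=\frac{[n][2i-2]}{[2n][i-1]}$ for $2\le i\le n+1$. *)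

(* Defs.v *)
From HB Require Import structures.
From mathcomp Require Import all_boot all_order all_algebra.
From mathcomp Require Import fraction generic_quotient.
From mathcomp Require Import boolp classical_sets reals.
From mathcomp Require Import complex finset.

Set Implicit Arguments.
Unset Strict Implicit.
Unset Printing Implicit Defensive.

Import GRing.Theory.

Local Open Scope ring_scope.
Local Open Scope quotient_scope.

(* C(q), with C = R[i] for a model R of the real numbers. *)
Definition Cq (R : realType) : fieldType := {fraction {poly R[i]}}.

Definition Cq_q (R : realType) : Cq R := FracField.tofrac ('X : {poly R[i]}).

Definition qint (K : fieldType) (q : K) (m : nat) : K :=
  (q ^+ m - q ^- m) / (q - q^-1).

Definition edgeD (n : nat) (i j : 'I_n.+1) : bool :=
  [|| (i == 0%N :> nat) && (j == 2%N :> nat),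
      (i == 1%N :> nat) && (j == 2%N :> nat) |
      (2 <= i)%N && (j == i.+1 :> nat)].

Definition adjD (n : nat) (i j : 'I_n.+1) : bool := edgeD i j || edgeD j i.

(* Unital algebra expressions in the generators E_0, ..., E_n. *)
Inductive tld_term (K : Type) (n : nat) : Type :=
| TScal of K
| TGen of 'I_n.+1
| TAdd of tld_term K n & tld_term K n
| TMul of tld_term K n & tld_term K n.

Arguments TScal {K n}.
Arguments TGen {K n}.
Arguments TAdd {K n}.
Arguments TMul {K n}.

(* Least congruence on terms containing the axioms of unital associative
   K-algebras and the defining relations of TL^D_{n+1}. *)
Inductive tld_eqv (K : fieldType) (q : K) (n : nat) :
  tld_term K n -> tld_term K n -> Prop :=
| tld_refl t : tld_eqv q t t
| tld_sym t u : tld_eqv q t u -> tld_eqv q u t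
| tld_trans t u v : tld_eqv q t u -> tld_eqv q u v -> tld_eqv q t v
| tld_addl t t' u : tld_eqv q t t' -> tld_eqv q (TAdd t u) (TAdd t' u)
| tld_mull t t' u : tld_eqv q t t' -> tld_eqv q (TMul t u) (TMul t' u)
| tld_mulr t u u' : tld_eqv q u u' -> tld_eqv q (TMul t u) (TMul t u')
| tld_addC t u : tld_eqv q (TAdd t u) (TAdd u t)
| tld_addA t u v : tld_eqv q (TAdd t (TAdd u v)) (TAdd (TAdd t u) v)
| tld_add0 t : tld_eqv q (TAdd (TScal 0) t) t
| tld_mulA t u v : tld_eqv q (TMul t (TMul u v)) (TMul (TMul t u) v)
| tld_mul1 t : tld_eqv q (TMul (TScal 1) t) t
| tld_mul0 t : tld_eqv q (TMul (TScal 0) t) (TScal 0)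
| tld_mulDl t u v :
    tld_eqv q (TMul (TAdd t u) v) (TAdd (TMul t v) (TMul u v))
| tld_mulDr t u v :
    tld_eqv q (TMul t (TAdd u v)) (TAdd (TMul t u) (TMul t v))
| tld_scalD a b : tld_eqv q (TScal (a + b)) (TAdd (TScal a) (TScal b))
| tld_scalM a b : tld_eqv q (TScal (a * b)) (TMul (TScal a) (TScal b))
| tld_scalC a t : tld_eqv q (TMul (TScal a) t) (TMul t (TScal a))
| tld_sqr i :
    tld_eqv q (TMul (TGen i) (TGen i)) (TMul (TScal (- qint q 2)) (TGen i))
| tld_braid i j : adjD i j ->
    tld_eqv q (TMul (TGen i) (TMul (TGen j) (TGen i))) (TGen i)
| tld_comm i j : i != j -> ~~ adjD i j ->
    tld_eqv q (TMul (TGen i) (TGen j)) (TMul (TGen j) (TGen i)).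

HB.instance Definition _ (K : Type) (n : nat) := gen_eqMixin (tld_term K n).
HB.instance Definition _ (K : Type) (n : nat) := gen_choiceMixin (tld_term K n).

Section TLDAlgebra.
Variables (K : fieldType) (q : K) (n : nat).
Implicit Types (t u v : tld_term K n) (a b : K).

Definition tld_eqb t u : bool := `[< tld_eqv q t u >].

Lemma tld_eqb_refl : reflexive tld_eqb.
Proof. by move=> t; apply/asboolP; exact: tld_refl. Qed.

Lemma tld_eqb_sym : symmetric tld_eqb.
Proof. by move=> t u; apply/asboolP/asboolP; exact: tld_sym. Qed.

Lemma tld_eqb_trans : transitive tld_eqb.
Proof.
move=> u t v /asboolP tu /asboolP uv; apply/asboolP; exact: tld_trans uv.
Qed.

Canonical tld_equiv := EquivRel tld_eqb tld_eqb_refl tld_eqb_sym tld_eqb_trans.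

Definition TLD : Type := {eq_quot tld_equiv}.
HB.instance Definition _ := Choice.on TLD.
HB.instance Definition _ := Quotient.on TLD.
HB.instance Definition _ := EqQuotient.on TLD.

Lemma tld_piP t u : reflect (tld_eqv q t u) (\pi_TLD t == \pi_TLD u).
Proof. by rewrite eqmodE; exact: asboolP. Qed.

Lemma tld_pi_eq t u : tld_eqv q t u -> \pi_TLD t = \pi_TLD u.
Proof. by move=> /tld_piP/eqP. Qed.

Lemma tld_repr_pi t : tld_eqv q (repr (\pi_TLD t)) t.
Proof. by apply/tld_piP; rewrite reprK. Qed.

Definition tld_add (x y : TLD) : TLD := \pi_TLD (TAdd (repr x) (repr y)).
Definition tld_mul (x y : TLD) : TLD := \pi_TLD (TMul (repr x) (repr y)).
Definition tld_scal (a : K) : TLD := \pi_TLD (TScal a).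
Definition tld_opp (x : TLD) : TLD := tld_mul (tld_scal (- 1)) x.

Lemma tld_addr t u u' : tld_eqv q u u' -> tld_eqv q (TAdd t u) (TAdd t u').
Proof.
move=> uu'; apply: tld_trans (tld_addC _ _ _) _.
by apply: tld_trans (tld_addl _ uu') _; exact: tld_addC.
Qed.

Lemma tld_piD t u : tld_add (\pi_TLD t) (\pi_TLD u) = \pi_TLD (TAdd t u).
Proof.
apply: tld_pi_eq; apply: tld_trans (tld_addl _ (tld_repr_pi _)) _.
exact/tld_addr/tld_repr_pi.
Qed.

Lemma tld_piM t u : tld_mul (\pi_TLD t) (\pi_TLD u) = \pi_TLD (TMul t u).
Proof.
apply: tld_pi_eq; apply: tld_trans (tld_mull _ (tld_repr_pi _)) _.
exact/tld_mulr/tld_repr_pi.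
Qed.

Lemma tld_ind (P : TLD -> Prop) : (forall t, P (\pi_TLD t)) -> forall x, P x.
Proof. by move=> Pt x; rewrite -[x]reprK. Qed.

Lemma tldDA : associative tld_add.
Proof.
elim/tld_ind=> t; elim/tld_ind=> u; elim/tld_ind=> v.
by rewrite !tld_piD; exact/tld_pi_eq/tld_addA.
Qed.

Lemma tldDC : commutative tld_add.
Proof.
elim/tld_ind=> t; elim/tld_ind=> u.
by rewrite !tld_piD; exact/tld_pi_eq/tld_addC.
Qed.

Lemma tld0D : left_id (tld_scal 0) tld_add.
Proof. by elim/tld_ind=> t; rewrite !tld_piD; exact/tld_pi_eq/tld_add0. Qed.

Lemma tldMA : associative tld_mul.
Proof.
elim/tld_ind=> t; elim/tld_ind=> u; elim/tld_ind=> v.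
by rewrite !tld_piM; exact/tld_pi_eq/tld_mulA.
Qed.

Lemma tldMDl : left_distributive tld_mul tld_add.
Proof.
elim/tld_ind=> t; elim/tld_ind=> u; elim/tld_ind=> v.
by rewrite !(tld_piM, tld_piD); exact/tld_pi_eq/tld_mulDl.
Qed.

Lemma tldMDr : right_distributive tld_mul tld_add.
Proof.
elim/tld_ind=> t; elim/tld_ind=> u; elim/tld_ind=> v.
by rewrite !(tld_piM, tld_piD); exact/tld_pi_eq/tld_mulDr.
Qed.

Lemma tld1M : left_id (tld_scal 1) tld_mul.
Proof. by elim/tld_ind=> t; rewrite tld_piM; exact/tld_pi_eq/tld_mul1. Qed.

Lemma tld_scalMC a x : tld_mul (tld_scal a) x = tld_mul x (tld_scal a).
Proof.
by elim/tld_ind: x => t; rewrite !tld_piM; exact/tld_pi_eq/tld_scalC.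
Qed.

Lemma tldM1 : right_id (tld_scal 1) tld_mul.
Proof. by move=> x; rewrite -tld_scalMC tld1M. Qed.

Lemma tld_scal_add a b : tld_scal (a + b) = tld_add (tld_scal a) (tld_scal b).
Proof. by rewrite tld_piD; exact/tld_pi_eq/tld_scalD. Qed.

Lemma tld_scal_mul a b : tld_scal (a * b) = tld_mul (tld_scal a) (tld_scal b).
Proof. by rewrite tld_piM; exact/tld_pi_eq/tld_scalM. Qed.

Fixpoint tld_aug t : K :=
  match t with
  | TScal a => a
  | TGen _ => 0
  | TAdd t u => tld_aug t + tld_aug u
  | TMul t u => tld_aug t * tld_aug u
  end.

Lemma tld_augP t u : tld_eqv q t u -> tld_aug t = tld_aug u.
Proof.
elim=> //=; try by move=> *; congruence.
all: by move=> *; first [by rewrite addrC | by rewrite addrA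
  | by rewrite add0r | by rewrite mulrA | by rewrite mul1r
  | by rewrite mulrDl | by rewrite mulrDr | by rewrite mulrC
  | by rewrite !mulr0 | by rewrite !mul0r].
Qed.

Lemma tld0M x : tld_mul (tld_scal 0) x = tld_scal 0.
Proof. by elim/tld_ind: x => t; rewrite tld_piM; exact/tld_pi_eq/tld_mul0. Qed.

Lemma tldND : left_inverse (tld_scal 0) tld_opp tld_add.
Proof.
move=> x; rewrite /tld_opp -{2}[x]tld1M -tldMDl -tld_scal_add addNr.
exact: tld0M.
Qed.

Lemma tld1_neq0 : tld_scal 1 != tld_scal 0.
Proof. by apply/tld_piP => /tld_augP/eqP /=; rewrite oner_eq0. Qed.

HB.instance Definition _ :=
  GRing.isZmodule.Build TLD tldDA tldDC tld0D tldND.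
HB.instance Definition _ := GRing.Zmodule_isNzRing.Build TLD
  tldMA tld1M tldM1 tldMDl tldMDr tld1_neq0.

Definition tld_scale a (x : TLD) : TLD := tld_mul (tld_scal a) x.

Lemma tld_scaleA a b x : tld_scale a (tld_scale b x) = tld_scale (a * b) x.
Proof. by rewrite /tld_scale tldMA -tld_scal_mul. Qed.

Lemma tld_scale1 : left_id 1 tld_scale.
Proof. exact: tld1M. Qed.

Lemma tld_scaleDr : right_distributive tld_scale +%R.
Proof. by move=> a x y; exact: tldMDr. Qed.

Lemma tld_scaleDl x : {morph tld_scale^~ x : a b / a + b}.
Proof. by move=> a b; rewrite /tld_scale tld_scal_add; exact: tldMDl. Qed.

HB.instance Definition _ := GRing.Zmodule_isLmodule.Build K TLD
  tld_scaleA tld_scale1 tld_scaleDr tld_scaleDl.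

Lemma tld_scaleAl a (x y : TLD) : a *: (x * y) = a *: x * y.
Proof. exact: tldMA. Qed.
HB.instance Definition _ := GRing.Lmodule_isLalgebra.Build K TLD tld_scaleAl.

Lemma tld_scaleAr a (x y : TLD) : a *: (x * y) = x * (a *: y).
Proof.
by rewrite scalerAl [RHS]mulrA; congr (_ * _); exact: tld_scalMC.
Qed.
HB.instance Definition _ := GRing.Lalgebra_isAlgebra.Build K TLD tld_scaleAr.

Definition genE (i : 'I_n.+1) : TLD := \pi_TLD (TGen i).


Definition tld_relations (A : algType K) (F : 'I_n.+1 -> A) : Prop :=
  [/\ forall i, F i * F i = - qint q 2 *: F i,
      forall i j, adjD i j -> F i * F j * F i = F i
    & forall i j, i != j -> ~~ adjD i j -> F i * F j = F j * F i].

Lemma TLD_relations : tld_relations genE.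
Proof.
split=> [i|i j ij|i j ij nij].
- rewrite -[LHS]/(tld_mul _ _) -[RHS]/(tld_mul _ _) !tld_piM.
  exact/tld_pi_eq/tld_sqr.
- rewrite -mulrA -[LHS]/(tld_mul (genE i) (tld_mul (genE j) (genE i))).
  rewrite (tld_piM (TGen j)) (tld_piM (TGen i)).
  by apply: tld_pi_eq; apply: tld_braid.
- rewrite -[LHS]/(tld_mul _ _) -[RHS]/(tld_mul _ _) !tld_piM.
  by apply: tld_pi_eq; apply: tld_comm.
Qed.

Fixpoint tld_eval (A : algType K) (F : 'I_n.+1 -> A) t : A :=
  match t with
  | TScal a => a%:A
  | TGen i => F i
  | TAdd t u => tld_eval F t + tld_eval F u
  | TMul t u => tld_eval F t * tld_eval F u
  end.

Lemma tld_evalP (A : algType K) (F : 'I_n.+1 -> A) t u :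
  tld_relations F -> tld_eqv q t u -> tld_eval F t = tld_eval F u.
Proof.
case=> Fsqr Fbraid Fcomm; elim=> /=; try by move=> *; congruence.
- by move=> *; rewrite addrC.
- by move=> *; rewrite addrA.
- by move=> *; rewrite scale0r add0r.
- by move=> *; rewrite mulrA.
- by move=> *; rewrite scale1r mul1r.
- by move=> *; rewrite scale0r mul0r.
- by move=> *; rewrite mulrDl.
- by move=> *; rewrite mulrDr.
- by move=> *; rewrite scalerDl.
- by move=> *; rewrite -scalerAl mul1r scalerA.
- by move=> *; rewrite -scalerAl -scalerAr mul1r mulr1.
- by move=> *; rewrite Fsqr -scalerAl mul1r.
- by move=> *; rewrite mulrA Fbraid.
- by move=> *; exact: Fcomm.
Qed.

Lemma TLD_universal (A : algType K) (F : 'I_n.+1 -> A) : tld_relations F ->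
  exists f : {lrmorphism TLD -> A}, (forall i, f (genE i) = F i) /\
    forall g : {lrmorphism TLD -> A}, (forall i, g (genE i) = F i) -> g =1 f.
Proof.
move=> relF.
pose f (x : TLD) : A := tld_eval F (repr x).
have fE t : f (\pi_TLD t) = tld_eval F t.
  exact: tld_evalP relF (tld_repr_pi t).
have fD (x y : TLD) : f (x + y) = f x + f y by rewrite [LHS]fE.
have fM : {morph f : x y / x * y} by move=> x y; rewrite [LHS]fE.
have f1 : f 1 = 1 by rewrite [LHS]fE /= scale1r.
have fZ a (x : TLD) : f (a *: x) = a *: f x.
  by rewrite [LHS](fM (tld_scal a) x) fE /= -scalerAl mul1r.
have flin : linear f by move=> a x y; rewrite fD fZ.
pose fL := GRing.isLinear.Build K TLD A *:%R f flin.
pose fMM := GRing.isMonoidMorphism.Build TLD A f (conj f1 fM).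
pose g : {lrmorphism TLD -> A} := HB.pack f fL fMM.
exists g; split=> [i|h hE]; first exact: fE.
elim/tld_ind=> t; rewrite -[RHS]/(f _) fE.
elim: t => [a|i|t IHt u IHu|t IHt u IHu] /=.
- suff -> : \pi_TLD (TScal a) = a%:A by rewrite linearZ rmorph1.
  by rewrite -[RHS]/(tld_mul (tld_scal a) (tld_scal 1)) tldM1.
- exact: hE.
- by rewrite -tld_piD -IHt -IHu; exact: raddfD.
- by rewrite -tld_piM -IHt -IHu; exact: rmorphM.
Qed.

End TLDAlgebra.

Section Diagrams.
Variable N : nat.
Local Notation point := 'I_(2 * N).

(* The marked point labelled k is the ordinal of value k - 1: bottom points
   are 0, ..., N - 1 from left to right, top points N, ..., 2 N - 1 from right
   to left, so that rev_ord exchanges a bottom point and the top point above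
   it. A chord is a pair {x, partner x}, and a dotted chord is recorded in
   [dots] by its smaller end. *)
Record diagram := Diagram {
  partner : {ffun point -> point};
  dots : {set point}
}.

Definition diagram_pair (D : diagram) := (partner D, dots D).
Definition pair_diagram (d : {ffun point -> point} * {set point}) :=
  Diagram d.1 d.2.
Lemma diagram_pairK : cancel diagram_pair pair_diagram.
Proof. by case. Qed.
HB.instance Definition _ :=
  Finite.copy diagram (can_type diagram_pairK).

Definition connectivity (p : {ffun point -> point}) : bool :=
  [&& [forall x, p x != x], [forall x, p (p x) == x]
    & [forall x : point, forall y : point,
        ~~ [&& (x < y)%N, (y < p x)%N & (p x < p y)%N]]].

Definition id_conn : {ffun point -> point} := [ffun x => rev_ord x].
Definition id_diagram : diagram := Diagram id_conn set0.

(* x is the smaller end of its chord *)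
Definition outer (p : {ffun point -> point}) (x : point) : bool :=
  [forall y : point, ~~ ((y < x)%N && (p x < p y)%N)].

Definition typeD (D : diagram) : bool :=
  let p := partner D in
  [&& connectivity p, [forall x in dots D, (x < p x)%N]
    & (~~ odd #|dots D| && [forall x in dots D, outer p x])
      || [&& #|dots D| == 1%N, [forall x in dots D, x == 0%N :> nat]
           & p != id_conn]].

(* Stacking U on top of L. A vertex (true, x) is the point x of U and (false, x)
   the point x of L; vertices are linked by the chords of U and L and by the
   gluing of the bottom of U to the top of L. *)
Definition stack_rel (U L : diagram) : rel (bool * point) :=
  fun u v =>
    if u.1 == v.1 then partner (if u.1 then U else L) u.2 == v.2
    else (v.2 == rev_ord u.2) && (if u.1 then (u.2 < N)%N else (N <= u.2)%N).

(* the vertex carrying the point x of the stacked diagram *)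
Definition outer_vertex (x : point) : bool * point := ((N <= x)%N, x).

Definition stack_partner (U L : diagram) : {ffun point -> point} :=
  [ffun x => odflt x [pick y | (y != x) &&
     connect (stack_rel U L) (outer_vertex x) (outer_vertex y)]].

Definition strand_dots (U L : diagram) (x : point) : nat :=
  #|[set v | connect (stack_rel U L) (outer_vertex x) v
             & v.2 \in dots (if v.1 then U else L)]|.

(* Loops contain no outer vertex, so they are dropped together with their dots.
   Dots are counted modulo 2 on each strand; no strand of a reduced word
   receives more than one. *)
Definition stack (U L : diagram) : diagram :=
  Diagram (stack_partner U L)
    [set x : point | (x < stack_partner U L x)%N & odd (strand_dots U L x)].

Definition move_dot (D : diagram) : diagram :=
  if odd #|dots D| then Diagram (partner D) [set x : point | x == 0%N :> nat]
  else D.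

(* For i >= 1, the cap of E_i joins the points i - 1 and i and its cup joins
   2 N - i and 2 N - i - 1; E_0 has the chords of E_1. *)
Definition gen_partner (i x : nat) : nat :=
  (if x == i.-1 then i.-1.+1
   else if x == i.-1.+1 then i.-1
   else if x == (2 * N).-1 - i.-1 then (2 * N).-2 - i.-1
   else if x == (2 * N).-2 - i.-1 then (2 * N).-1 - i.-1
   else (2 * N).-1 - x)%N.

Definition gen_diagram (i : nat) : diagram :=
  Diagram [ffun x : point => insubd x (gen_partner i x)]
    (if i == 0%N then [set x : point | (x == 0%N :> nat)
                                     || (x == (2 * N).-2 :> nat)]
     else set0).

Definition word_diagram (w : seq nat) : diagram :=
  move_dot (foldr (fun i D => stack (gen_diagram i) D) id_diagram w).

End Diagrams.

Arguments id_diagram {N}.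

Section Projector.
Variables (K : fieldType) (q : K) (n : nat).
Local Notation A := (TLD q n).

(* the subalgebra TL^D_{m+1} of TL^D_{n+1} *)
Definition TLD_sub (m : nat) (x : A) : Prop :=
  forall S : {pred A}, GRing.subalg_closed S ->
    (forall i : 'I_n.+1, (i <= m)%N -> genE q i \in S) -> x \in S.

Definition projector_family (Q : nat -> A) : Prop :=
  forall m, (m <= n)%N ->
    [/\ TLD_sub m (Q m), Q m != 0,
        forall k, (k <= m)%N -> Q m * Q k = Q m /\ Q k * Q m = Q m
      & forall i : 'I_n.+1, (i <= m)%N ->
          genE q i * Q m = 0 /\ Q m * genE q i = 0].

Definition projector : A :=
  xget 0 (fun x => exists2 Q, projector_family Q & x = Q n).

Definition word (w : seq 'I_n.+1) : A := \prod_(i <- w) genE q i.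

Definition reduced (w : seq 'I_n.+1) : Prop :=
  ~ exists (v : seq 'I_n.+1) (c : K),
      (size v < size w)%N /\ word w = c *: word v.

Definition has_diagram (b : A) (D : diagram n.+1) : Prop :=
  exists w, [/\ reduced w, b = word w
              & word_diagram n.+1 (map val w) = D].

(* c is the coefficient of b in an expansion of x in the basis of elements
   given by reduced words *)
Definition is_coefficient (x b : A) (c : K) : Prop :=
  exists (s : seq A) (f : A -> K),
    [/\ uniq s, forall y, y \in s -> exists2 w, reduced w & y = word w,
        x = \sum_(y <- s) f y *: y & c = if b \in s then f b else 0].

Definition projector_coef (D : diagram n.+1) : K :=
  xget 0 (fun c => exists2 b, has_diagram b D & is_coefficient projector b c).

End Projector.

(* coef_n, on the diagrams with N = n + 1 strands. The case n = 0 is a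
   convention: the diagrams with one strand do not span TL^D_1. *)
Definition coef (K : fieldType) (q : K) (N : nat) : diagram N -> K :=
  match N with
  | 0 => fun _ => 0
  | 1 => fun D => (D == id_diagram)%:R
  | _.+2 => fun D => projector_coef q D
  end.

(* coef(g_{n,i}) *)
Definition coef_g (K : fieldType) (q : K) (n i : nat) : K :=
  if i == 1%N then qint q n / qint q (2 * n)
  else qint q n * qint q (2 * i - 2) / (qint q (2 * n) * qint q i.-1).

Section Caps.
Variables (n : nat) (D : diagram n.+1).
Implicit Types j : 'I_n.+1.

(* Position i in [1, n + 1] is the ordinal j = i - 1, whose bottom point is the
   point of value j. *)
Definition bottom_point j : 'I_(2 * n.+1) :=
  widen_ord (leq_pmull n.+1 (isT : 0 < 2)%N) j.

Definition innermost_cap j : bool :=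
  partner D (bottom_point j) == j.+1 :> nat.

Definition dotted_caps : {set 'I_n.+1} :=
  [set j | [&& j == ord0, innermost_cap j & bottom_point j \in dots D]].

Definition undotted_caps : {set 'I_n.+1} :=
  [set j | innermost_cap j & bottom_point j \notin dots D].

Definition caps : {set 'I_n.+1} := dotted_caps :|: undotted_caps.

Definition skip_cap j (x : nat) : nat := if (x < j)%N then x else x.+2.
Definition unskip_cap j (y : nat) : nat := if (y < j)%N then y else y.-2.

Lemma skip_cap_subproof j (x : 'I_(2 * n)) : (skip_cap j x < 2 * n.+1)%N.
Proof.
rewrite /skip_cap mulnS; case: ifP => _; last by rewrite !ltnS.
exact: ltn_addl.
Qed.

Definition old_point j (x : 'I_(2 * n)) : 'I_(2 * n.+1) :=
  Ordinal (skip_cap_subproof j x).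

Definition remove_cap j : diagram n :=
  Diagram [ffun x : 'I_(2 * n) => insubd x (unskip_cap j (partner D (old_point j x)))]
    [set x : 'I_(2 * n) | old_point j x \in dots D].

(* The left-most bottom point 0 is the smaller end of its chord. *)
Definition toggle_first_dot (N : nat) (C : diagram N) : diagram N :=
  Diagram (partner C)
    [set x : 'I_(2 * N) | (x \in dots C) (+) (x == 0%N :> nat)].

(* the diagram D_i for i = j + 1 *)
Definition cap_removed j : diagram n :=
  if j \in dotted_caps then toggle_first_dot (remove_cap j)
  else remove_cap j.

End Caps.

(* Main.v *)
Require Import Defs.
From mathcomp Require Import all_boot all_order all_algebra.
From mathcomp Require Import reals.
From mathcomp Require Import generic_quotient fraction boolp zify ring.
From mathcomp Require classical_sets.

Set Implicit Arguments.
Unset Strict Implicit.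
Unset Printing Implicit Defensive.

Import GRing.Theory.

Local Open Scope quotient_scope.

(** Why the recursion holds.

    The algebra acts on functions of a dotted pairing, a generator contracting
    two adjacent bottom points: a loop contributes - [2] if it carries no dot
    and 0 if it carries one ([fun_act], well defined by [term_actP]). Evaluated
    at the identity pairing, a reduced word sends the indicator function of an
    even diagram E to 1 if its diagram is E and to 0 otherwise
    ([reducedN_coef]). The action kills the two-sided ideal generated by E_0
    E_1, and this ideal contains the basis elements whose diagrams were odd
    before the dot was moved. Hence, for even E, the coefficient of E in Q_n is
    the value of Q_n on the indicator of E at the identity ([expansion_coefE],
    [projector_coefE]).

    This needs a dictionary between reduced words and even diagrams. A cap at
    position i is inserted under n strands by the word g_{n,i} = E_n E_{n-1}
    ... E_i, and a dotted cap at position 1 by g_{n,0} = E_n ... E_2 E_0. An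
    even type D diagram has an inner-most cap that is undotted or at position 1
    ([caps_ex]), so it is reached from the identity by such insertions; the
    products of the words used are the normal words. Two insertions can be
    exchanged ([capword_exchange]), so normal words with the same diagram are
    equal ([normal_uniq]); a generator multiplies a normal word into a scalar
    multiple of a normal word, or into the ideal when a dotted loop is formed
    ([normal_step]). Conversely a reduced word equals a normal word with even
    diagram, or lies in the ideal and has an odd number of dots
    ([reducedN_dichotomy]). The parity of the dots changes exactly at a dotted
    loop, and this happens at most once because E_0 and E_1 multiply the ideal
    in the same way ([agree01_ideal]): on the ideal a second loop, dotted or
    not, only contributes a scalar, so the word would not be reduced.

    For the recursion, let S be the sum of coef(g_{n,i}) g_{n,i} over 0 <= i <=
    n + 1, where g_{n,0} has the coefficient of g_{n,1}. The coefficients solve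
    the linear relations expressing that the terms of S E_j with i equal or
    adjacent to j cancel ([cap_weight_step_sum]); the remaining g_{n,i} move
    E_j to the left, where Q_{n-1} kills it, or produce E_0 E_1. So Q_{n-1} S
    E_j is in the ideal for all j, and therefore Q_n - Q_{n-1} S is too
    ([proj_rec]). Evaluating Q_{n-1} S instead of Q_n, the word g_{n,i} inserts
    a cap at position i into the pairing produced by Q_{n-1}: this is the sum
    over the caps of the diagram.

    The projector itself comes from the same congruence. The ideal has a unit f
    ([ideal01_unit]): if P is the type A projector on E_1, ..., E_n, then P
    kills the ideal and 1 - P acts on it as an element f of the ideal. Then (1
    - f) Q_{n-1} S is killed on the right by all E_j, and by the
    anti-involution fixing the generators on the left as well ([proj_ex]). *)

(** * Dotted pairings and contraction of adjacent points *)

Local Open Scope nat_scope.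

(** Connectivities with dots, as involutions of all of nat, so that pairings on
    different numbers of strands have the same type and contraction needs no
    bounds on k. The dot of a chord is recorded at both of its ends. *)
Record dpairing := DPairing {
  mate : nat -> nat; dotted : nat -> bool;
  mate_neq : forall x, mate x <> x; mateK : forall x, mate (mate x) = x;
  dotted_mate : forall x, dotted (mate x) = dotted x }.

Arguments mate_neq : clear implicits.
Arguments mateK : clear implicits.
Arguments dotted_mate : clear implicits.

Lemma dpairing_ext D D' : mate D =1 mate D' -> dotted D =1 dotted D' -> D = D'.
Proof.
case: D D' => [p d H1 H2 H3] [p' d' H1' H2' H3'] /= /funext Ep /funext Ed.
subst p' d'.
by congr DPairing; apply: Prop_irrelevance.
Qed.

(* Equalities between points are decided one at a time; branches that
   contradict the axioms of the pairing or the injectivity of its involution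
   are discarded by congruence. *)
Ltac pfacts D x := have := dotted_mate D x; have := mateK D x; have := mate_neq D x; intros.
Ltac pcase1 := match goal with |- context [?a == ?b] =>
  lazymatch constr:((a, b)) with context [_ == _] => fail | _ => case: (@eqP _ a b) => [?|?]
    //= end end.
Ltac pcases := repeat (pcase1; try (exfalso; congruence)); try congruence.

Ltac dtsolve D :=
  try match goal with H : ?x = _.+1 |- _ => is_var x; subst x
    | H : ?x = ?y |- _ => is_var x; is_var y; subst x end;
  repeat match goal with H : ?x = mate D ?y |- context [dotted D ?x] =>
    let E := fresh in
    assert (E : dotted D x = dotted D y); [rewrite H; exact (dotted_mate D y) | rewrite E;
      clear E H]
  | H : mate D ?y = ?x |- context [dotted D ?x] =>
    lazymatch y with mate _ _ => fail | _ => idtac end;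
    let E := fresh in
    assert (E : dotted D x = dotted D y); [rewrite <- H; exact (dotted_mate D y) | rewrite E;
      clear E H] end;
  repeat match goal with |- context [dotted D ?a] => destruct (dotted D a) end;
  repeat match goal with s : bool |- _ => destruct s end; reflexivity.

(** Composition with a generator from below or from above: one of its two arcs
    joins k and k + 1, and the other, with dot s, takes their place. The two
    strands that ended there are merged, with the sum of their dots and of s,
    because the cap and the cup of a generator are dotted together. If the two
    points were already joined this closes a loop. *)
Section Contract.
Variables (s : bool) (k : nat) (D : dpairing).
Notation p := (mate D).
Definition contract_mate x := if x == k then k.+1 else if x == k.+1 then k
  else if x == p k then p k.+1 else if x == p k.+1 then p k else p x.
Definition contract_dotted x := if (x == k) || (x == k.+1) then s
  else if (x == p k) || (x == p k.+1) then dotted D k (+) dotted D k.+1 (+) s else dotted D x.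

Lemma mate_neq2 x y : x <> y -> p x <> p y.
Proof. by move=> xy E; apply: xy; rewrite -(mateK D x) E mateK. Qed.

Lemma mate_eq x y : (p x == y) = (x == p y).
Proof. by apply/eqP/eqP => [<-|->]; rewrite mateK. Qed.

Lemma mate_inj x y : p x = p y -> x = y.
Proof. by move=> E; rewrite -(mateK D x) E mateK. Qed.

Lemma contract_mate_neq x : contract_mate x <> x.
Proof.
have kk : k <> k.+1 by lia.
have I1 := mate_neq2 kk; pfacts D k; pfacts D k.+1; pfacts D x.
by rewrite /contract_mate; pcases.
Qed.
Lemma contract_mateK x : contract_mate (contract_mate x) = x.
Proof.
have kk : k <> k.+1 by lia.
have I1 := mate_neq2 kk; pfacts D k; pfacts D k.+1; pfacts D x.
by rewrite /contract_mate; pcases.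
Qed.
Lemma contract_dotted_mate x : contract_dotted (contract_mate x) = contract_dotted x.
Proof.
have kk : k <> k.+1 by lia.
have I1 := mate_neq2 kk; pfacts D k; pfacts D k.+1; pfacts D x.
by rewrite /contract_dotted /contract_mate; pcases.
Qed.
Definition contract := DPairing contract_mate_neq contract_mateK contract_dotted_mate.
End Contract.

Definition looped k D := mate D k == k.+1.

Lemma contract_idem s k D : contract s k (contract s k D) = contract s k D.
Proof.
have kk : k <> k.+1 by lia.
have I1 := mate_neq2 (D := D) kk; pfacts D k; pfacts D k.+1.
apply: dpairing_ext => x; pfacts D x.
 rewrite /= /contract_mate /= /contract_mate !eqxx.
 by pcases.
rewrite /= /contract_dotted /= /contract_mate /contract_dotted !eqxx.
by pcases.
Qed.
Lemma looped_contract s k D : looped k (contract s k D).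
Proof. by rewrite /looped /= /contract_mate eqxx. Qed.
Lemma dotted_contract s k D : dotted (contract s k D) k = s.
Proof. by rewrite /= /contract_dotted eqxx. Qed.
(** A loop is closed, and the cap that replaces it is the one that was there;
    this is the geometric content of the quadratic relation. *)
Lemma contract_looped k D : looped k D -> contract (dotted D k) k D = D.
Proof.
rewrite /looped => /eqP E.
have E' : mate D k.+1 = k by rewrite -E mateK.
have Ed : dotted D k.+1 = dotted D k by rewrite -{1}E dotted_mate.
apply: dpairing_ext => x; rewrite /= /contract_mate /contract_dotted.
  by rewrite E E'; pcases.
by rewrite E E'; pcases.
Qed.

Ltac pne D n := have := mate_neq2 (D := D) n; intros.
Lemma contract_comm s t k l D : k.+1 < l ->
  contract s k (contract t l D) = contract t l (contract s k D).
Proof.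
move=> kl.
have n1 : k <> k.+1 by lia.
have n2 : k <> l by lia.
have n3 : k <> l.+1 by lia.
have n4 : k.+1 <> l by lia.
have n5 : k.+1 <> l.+1 by lia.
have n6 : l <> l.+1 by lia.
pne D n1; pne D n2; pne D n3; pne D n4; pne D n5; pne D n6.
pfacts D k; pfacts D k.+1; pfacts D l; pfacts D l.+1.
apply: dpairing_ext => x; pfacts D x; rewrite /= /contract_mate /contract_dotted /=
  /contract_mate /contract_dotted /=.
  by pcases.
by pcases; dtsolve D.
Qed.
(** The zigzag identity, responsible for the braid relation. The dot t of the
    intermediate contraction enters twice and cancels. *)
Lemma contract_zigl s k D : looped k D -> dotted D k = s ->
  forall t, contract s k (contract t k.+1 D) = D.
Proof.
rewrite /looped => /eqP E <- t.
have E' : mate D k.+1 = k by rewrite -E mateK.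
have Ed : dotted D k.+1 = dotted D k by rewrite -{1}E dotted_mate.
have n1 : k <> k.+1 by lia.
have n2 : k <> k.+2 by lia.
have n3 : k.+1 <> k.+2 by lia.
pne D n1; pne D n2; pne D n3.
pfacts D k; pfacts D k.+1; pfacts D k.+2.
apply: dpairing_ext => x; pfacts D x; rewrite /= /contract_mate /contract_dotted /=
  /contract_mate /contract_dotted /= ?E ?E' ?Ed.
  by pcases.
by pcases; dtsolve D.
Qed.
Lemma contract_zigr s k D : looped k.+1 D -> dotted D k.+1 = s ->
  forall t, contract s k.+1 (contract t k D) = D.
Proof.
rewrite /looped => /eqP E <- t.
have E' : mate D k.+2 = k.+1 by rewrite -E mateK.
have Ed : dotted D k.+2 = dotted D k.+1 by rewrite -{1}E dotted_mate.
have n1 : k <> k.+1 by lia.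
have n2 : k <> k.+2 by lia.
have n3 : k.+1 <> k.+2 by lia.
pne D n1; pne D n2; pne D n3.
pfacts D k; pfacts D k.+1; pfacts D k.+2.
apply: dpairing_ext => x; pfacts D x; rewrite /= /contract_mate /contract_dotted /=
  /contract_mate /contract_dotted /= ?E ?E' ?Ed.
  by pcases.
by pcases; dtsolve D.
Qed.

(** * The action of the algebra on functions of a pairing *)

Local Open Scope ring_scope.

(** The letter j contracts the bottom points j - 1 and j counted from zero; the
    letter 0 has the points of 1, with dots. *)
Definition act j D := contract (j == 0%N) j.-1 D.
Definition loop_at j D := looped j.-1 D.
(** The loop consists of the chord of D and of the cup of the letter, so that
    it is dotted when exactly one of them is. *)
Definition dotted_loop_at j D := loop_at j D && (dotted D j.-1 (+) (j == 0%N)).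

Section FunAct.
Variables (K : fieldType) (q : K).

Definition contract_weight (s : bool) k D : K :=
  if looped k D then if dotted D k (+) s then 0 else - qint q 2 else 1.
Definition act_weight j D : K := contract_weight (j == 0%N) j.-1 D.

Lemma contract_weight_comm s t k l D : (k.+1 < l)%N ->
  contract_weight s k D * contract_weight t l (contract s k D) = contract_weight t l D *
    contract_weight s k (contract t l D).
Proof.
move=> kl.
have n1 : k <> k.+1 by lia.
have n2 : k <> l by lia.
have n3 : k <> l.+1 by lia.
have n4 : k.+1 <> l by lia.
have n5 : k.+1 <> l.+1 by lia.
have n6 : l <> l.+1 by lia.
pne D n1; pne D n2; pne D n3; pne D n4; pne D n5; pne D n6.
pfacts D k; pfacts D k.+1; pfacts D l; pfacts D l.+1.
rewrite /contract_weight /looped /= /contract_mate /contract_dotted /=.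
pcases; rewrite ?mul1r ?mulr1 // 1?mulrC //.
all: by congr (if _ then _ else _); dtsolve D.
Qed.

(** In a product E_i E_j E_i with i and j adjacent, only the first factor can
    close a loop. *)
Lemma contract_weight_zig s t k l D : l = k.+1 \/ k = l.+1 ->
  contract_weight t l (contract s k D) * contract_weight s k (contract t l (contract s k D)) =
    1.
Proof.
move=> kl; set D1 := contract s k D.
have E : mate D1 k = k.+1 by apply/eqP; exact: looped_contract.
have E' : mate D1 k.+1 = k by rewrite -E mateK.
clearbody D1. suff [E1 E2] : looped l D1 = false /\ looped k (contract t l D1) = false.
  by rewrite /contract_weight E1 E2 mul1r.
have n1 : k <> l by lia.
have n2 : k.+1 <> l.+1 by lia.
have n3 : k <> k.+1 by lia.
have n4 : l <> l.+1 by lia.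
pne D1 n1; pne D1 n2; pne D1 n3; pne D1 n4; pfacts D1 l; pfacts D1 l.+1.
move: E E'; rewrite /looped [mate (contract t l D1) k]/= /contract_mate; case: kl => ?; subst;
  move=> E E'; split; rewrite ?E ?E'.
- by apply/eqP; lia.
- have n5 : k <> k.+2 by lia.
  by pcases.
- have n5 : l.+2 <> l by lia.
  have n6 : l <> l.+2 by lia.
  by apply/eqP; congruence.
- have n5 : l.+2 <> l by lia.
  have n6 : l <> l.+2 by lia.
  by pcases.
Qed.

Section Terms.
Variable n : nat.
Notation A := (TLD q n).
Fixpoint term_act (t : tld_term K n) (f : dpairing -> K) (D : dpairing) : K :=
  match t with
  | TScal a => a * f D
  | TGen i => act_weight i D * f (act i D)
  | TAdd t u => term_act t f D + term_act u f D
  | TMul t u => term_act t (term_act u f) D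
  end.

Lemma term_act_lin t a b f f' D :
  term_act t (fun D => a * f D + b * f' D) D = a * term_act t f D + b * term_act t f' D.
Proof.
elim: t f f' D => [c|i|t IHt u IHu|t IHt u IHu] f f' D /=; try by ring.
- by rewrite IHt IHu; ring.
- have -> : term_act u (fun D0 => a * f D0 + b * f' D0) = (fun D0 => a * term_act u f D0 + b *
  term_act u f' D0).
    by apply: funext => D0; exact: IHu.
  exact: IHt.
Qed.

Lemma adjD_positions (i j : 'I_n.+1) : adjD i j -> j.-1 = i.-1.+1 \/ i.-1 = j.-1.+1.
Proof. by rewrite /adjD /edgeD; lia. Qed.
(** The letters 0 and 1 commute although they contract the same points; the
    other commuting pairs are disjoint. *)
Lemma nadjD_positions (i j : 'I_n.+1) : i != j -> ~~ adjD i j ->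
  [\/ (i.-1.+1 < j.-1)%N, (j.-1.+1 < i.-1)%N | i + j = 1]%N.
Proof.
rewrite /adjD /edgeD -(inj_eq val_inj) /= => ij h.
have [?|[?|?]] : (i.-1.+1 < j.-1)%N \/ (j.-1.+1 < i.-1)%N \/ (i + j = 1)%N by lia.
- by constructor 1. - by constructor 2. - by constructor 3.
Qed.

(** The action respects the relations. The pair 0, 1 commutes because both
    products vanish: they close a loop with one dot. *)
Lemma term_actP t u : tld_eqv q t u -> forall f D, term_act t f D = term_act u f D.
Proof.
elim=> {t u} /=; try by move=> *; congruence.
- by move=> t u u' _ IH f D; congr (term_act t _ D); apply: funext => D'.
- by move=> *; rewrite addrC.
- by move=> *; rewrite addrA.
- by move=> *; rewrite mul0r add0r.
- by [].
- by move=> *; rewrite mul1r.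
- by move=> *; rewrite !mul0r.
- move=> t u v f D.
  have := term_act_lin t 1 1 (term_act u f) (term_act v f) D; rewrite !mul1r => <-.
  by congr (term_act t _ D); apply: funext => D'; rewrite !mul1r.
- by move=> *; rewrite mulrDl.
- by move=> *; rewrite mulrA.
- move=> a t f D; have := term_act_lin t a 0 f f D; rewrite mul0r addr0 => <-.
  by congr (term_act t _ D); apply: funext => D'; rewrite mul0r addr0.
- move=> i f D; rewrite /act /act_weight contract_idem /contract_weight looped_contract
  dotted_contract addbb.
  by rewrite mulrCA.
- move=> i j /adjD_positions ij f D; rewrite /act_weight /act.
  rewrite [X in contract_weight _ i.-1 D * X]mulrA contract_weight_zig // mul1r.
  congr (_ * f _); case: ij => E; rewrite E.
    by rewrite contract_zigl ?looped_contract ?dotted_contract.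
  by rewrite contract_zigr ?looped_contract ?dotted_contract // -E ?looped_contract
    ?dotted_contract.
- move=> i j ij nij f D; rewrite /act_weight /act !mulrA.
  case: (nadjD_positions ij nij) => h.
  + by rewrite contract_weight_comm // (contract_comm _ _ _ h).
  + by rewrite -contract_weight_comm // (contract_comm _ _ _ h).
  + have [[-> ->]|[-> ->]] : (nat_of_ord i = 0 /\ nat_of_ord j = 1
                              \/ nat_of_ord i = 1 /\ nat_of_ord j = 0)%N by lia.
      by rewrite /contract_weight !looped_contract !dotted_contract /= !mulr0 !mul0r.
    by rewrite /contract_weight !looped_contract !dotted_contract /= !mulr0 !mul0r.
Qed.

(** Functions, rather than combinations of pairings, carry the action, as there
    are infinitely many pairings; the value of x on f at D is the pairing of f
    with the combination obtained from D by composing with x from below. *)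
Definition fun_act (x : A) f D := term_act (repr x) f D.
Lemma fun_act_pi t f D : fun_act (\pi_(TLD q n) t) f D = term_act t f D.
Proof. exact: (term_actP (tld_repr_pi q t)). Qed.
Lemma fun_act_gen i f D : fun_act (genE q i) f D = act_weight i D * f (act i D).
Proof. exact: fun_act_pi. Qed.
Lemma fun_actD x y f D : fun_act (x + y) f D = fun_act x f D + fun_act y f D.
Proof. exact: fun_act_pi. Qed.
Lemma fun_actM x y f D : fun_act (x * y) f D = fun_act x (fun_act y f) D.
Proof. exact: fun_act_pi. Qed.
Lemma fun_actZ a x f D : fun_act (a *: x) f D = a * fun_act x f D.
Proof.
rewrite /fun_act -[a *: x]/(tld_mul (tld_scal q n a) x) -/(fun_act _ _ _) fun_act_pi /=.
by rewrite [LHS]fun_act_pi.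
Qed.
Lemma fun_act0 f D : fun_act 0 f D = 0.
Proof. by rewrite -(scale0r 0) fun_actZ mul0r. Qed.
Lemma fun_act1 f D : fun_act 1 f D = f D.
Proof. by rewrite [LHS]fun_act_pi /= mul1r. Qed.
Lemma fun_act_sum I r (P : pred I) F f D :
  fun_act (\sum_(i <- r | P i) F i) f D = \sum_(i <- r | P i) fun_act (F i) f D.
Proof.
by apply: (big_morph (fun x => fun_act x f D)) => [x y|]; rewrite ?fun_actD ?fun_act0.
Qed.

Definition genN (j : nat) : A := genE q (inord j).
Definition wordN (w : seq nat) : A := \prod_(j <- w) genN j.
Lemma wordN_nil : wordN [::] = 1. Proof. exact: big_nil. Qed.
Lemma wordN_cons j w : wordN (j :: w) = genN j * wordN w. Proof. exact: big_cons. Qed.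
Lemma wordN_cat w w' : wordN (w ++ w') = wordN w * wordN w'. Proof. exact: big_cat. Qed.
Lemma wordN_1 j : wordN [:: j] = genN j. Proof. exact: big_seq1. Qed.
Lemma wordN_rcons w j : wordN (rcons w j) = wordN w * genN j.
Proof. by rewrite -cats1 wordN_cat wordN_1. Qed.

Definition run (w : seq nat) D := foldl (fun D j => act j D) D w.
Fixpoint run_weight (w : seq nat) D : K :=
  if w is j :: w' then act_weight j D * run_weight w' (act j D) else 1.

Lemma fun_act_genN j f D : (j <= n)%N -> fun_act (genN j) f D = act_weight j D * f (act j D).
Proof. by move=> jn; rewrite fun_act_gen inordK. Qed.
Lemma fun_act_wordN w f D : all (leq^~ n) w -> fun_act (wordN w) f D = run_weight w D * f (run
  w D).
Proof.
elim: w D => [|j w IH] D /=; first by rewrite wordN_nil fun_act1 mul1r.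
by case/andP=> jn wn; rewrite wordN_cons fun_actM fun_act_genN // IH // mulrA.
Qed.
Lemma run_weight_cat w w' D : run_weight (w ++ w') D = run_weight w D * run_weight w' (run w D).
Proof. by elim: w D => [|j w IH] D /=; rewrite ?mul1r // IH mulrA. Qed.
End Terms.
End FunAct.

(** * Inserting an inner-most cap *)

Local Open Scope nat_scope.

(** The order-preserving embedding of the points that avoids k and k + 1. *)
Definition skip k x := if x < k then x else x.+2.
Definition unskip k x := if x < k then x else x.-2.

Ltac slia := rewrite /skip /unskip;
  repeat match goal with |- context [if ?c then _ else _] =>
    lazymatch c with context [if _ then _ else _] => fail | _ => case: (boolP c) => ? end end;
      lia.

Lemma skipK k x : unskip k (skip k x) = x.
Proof. by slia. Qed.
Lemma skip_neq k x : (skip k x == k) || (skip k x == k.+1) = false.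
Proof. by slia. Qed.
Lemma skip_inj k x y : skip k x = skip k y -> x = y.
Proof. by move=> E; rewrite -(skipK k x) E skipK. Qed.

Variant skip_spec k : nat -> Type :=
| SkipL : skip_spec k k
| SkipR : skip_spec k k.+1
| SkipS x : skip_spec k (skip k x).

Lemma skipP k y : skip_spec k y.
Proof.
case: (y =P k) => [->|n1]; first by constructor.
case: (y =P k.+1) => [->|n2]; first by constructor.
have -> : y = skip k (unskip k y) by slia.
exact: SkipS.
Qed.

Section insert_cap.
Variables (k : nat) (D : dpairing).
Definition insert_mate y := if y == k then k.+1 else if y == k.+1 then k
  else skip k (mate D (unskip k y)).
Definition insert_dotted y := if (y == k) || (y == k.+1) then false else dotted D (unskip k y).
Lemma insert_mate_skip x : insert_mate (skip k x) = skip k (mate D x).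
Proof. by rewrite /insert_mate skipK; case/norP: (negbT (skip_neq k x)) => /negPf-> /negPf->.
  Qed.
Lemma insert_dotted_skip x : insert_dotted (skip k x) = dotted D x.
Proof. by rewrite /insert_dotted skipK skip_neq. Qed.
Lemma insert_mateL : insert_mate k = k.+1. Proof. by rewrite /insert_mate eqxx. Qed.
Lemma insert_mateR : insert_mate k.+1 = k. Proof. by rewrite /insert_mate eqxx;
  case: ifP => //; lia. Qed.
Lemma insert_dottedL : insert_dotted k = false. Proof. by rewrite /insert_dotted eqxx. Qed.
Lemma insert_dottedR : insert_dotted k.+1 = false. Proof. by rewrite /insert_dotted eqxx orbT.
  Qed.
Lemma insert_mate_neq y : insert_mate y <> y.
Proof.
case: (skipP k y) => [||x]; rewrite ?insert_mateL ?insert_mateR ?insert_mate_skip; try lia.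
by move/skip_inj; apply: mate_neq.
Qed.
Lemma insert_mateK y : insert_mate (insert_mate y) = y.
Proof.
by case: (skipP k y) => [||x]; rewrite ?(insert_mateL, insert_mateR,
  insert_mate_skip) ?(insert_mateL, insert_mateR, mateK).
Qed.
Lemma insert_dotted_mate y : insert_dotted (insert_mate y) = insert_dotted y.
Proof.
by case: (skipP k y) => [||x]; rewrite ?(insert_mateL, insert_mateR,
  insert_mate_skip) ?(insert_dottedL, insert_dottedR, insert_dotted_skip) // dotted_mate.
Qed.
Definition insert_cap := DPairing insert_mate_neq insert_mateK insert_dotted_mate.
End insert_cap.

Definition insert_capE := (insert_mateL, insert_mateR, insert_mate_skip, insert_dottedL,
  insert_dottedR, insert_dotted_skip).

Lemma insert_cap_inj k D D' : insert_cap k D = insert_cap k D' -> D = D'.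
Proof.
move=> E; apply: dpairing_ext => x.
  by apply: (@skip_inj k); rewrite -!insert_mate_skip; exact: (congr1 (fun D => mate D _) E).
by rewrite -!(insert_dotted_skip k); exact: (congr1 (fun D => dotted D _) E).
Qed.

Lemma insert_cap_ex k D : mate D k = k.+1 -> dotted D k = false -> exists D',
  D = insert_cap k D'.
Proof.
move=> E d.
have E' : mate D k.+1 = k by rewrite -E mateK.
have pk x : skip k (unskip k (mate D (skip k x))) = mate D (skip k x).
  have := skip_neq k x; case: (skipP k (mate D (skip k x))) (mateK D (skip k x)) => [||y].
  - by rewrite E => <-; rewrite eqxx orbT.
  - by rewrite E' => <-; rewrite eqxx.
  - by rewrite skipK.
have h1 x : unskip k (mate D (skip k x)) <> x.
  by move=> F; apply: (mate_neq D (skip k x)); rewrite -{2}F pk.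
have h2 x : unskip k (mate D (skip k (unskip k (mate D (skip k x))))) = x.
  by rewrite pk mateK skipK.
have h3 x : dotted D (skip k (unskip k (mate D (skip k x)))) = dotted D (skip k x).
  by rewrite pk dotted_mate.
exists (DPairing h1 h2 h3); apply: dpairing_ext => y; case: (skipP k y) => [||x];
  rewrite /= ?insert_capE //=.
by rewrite -{1}E dotted_mate.
Qed.

Lemma insert_cap_comm a b D : a <= b -> insert_cap b.+2 (insert_cap a D) = insert_cap a
  (insert_cap b D).
Proof.
move=> ab.
have sk x : skip b.+2 (skip a x) = skip a (skip b x) by slia.
have skl : skip b.+2 a = a /\ skip b.+2 a.+1 = a.+1 by slia.
have skr : skip a b = b.+2 /\ skip a b.+1 = b.+3 by slia.
case: skl skr => s1 s2 [s3 s4].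
have q1 : insert_mate a (insert_cap b D) b.+2 = b.+3 by rewrite -{1}s3 insert_mate_skip /=
  insert_mateL s4.
have q2 : insert_mate a (insert_cap b D) b.+3 = b.+2 by rewrite -{1}s4 insert_mate_skip /=
  insert_mateR s3.
have q3 : insert_dotted a (insert_cap b D) b.+2 = false by rewrite -s3 insert_dotted_skip /=
  insert_dottedL.
have q4 : insert_dotted a (insert_cap b D) b.+3 = false by rewrite -s4 insert_dotted_skip /=
  insert_dottedR.
apply: dpairing_ext => y; case: (skipP b.+2 y) => [||x];
  rewrite /= ?insert_capE ?q1 ?q2 ?q3 ?q4 //=.
  case: (skipP a x) => [||z]; rewrite ?insert_capE ?s1 ?s2 ?insert_capE ?s1 ?s2 //.
  by rewrite !sk insert_capE /= insert_capE.
case: (skipP a x) => [||z]; rewrite ?insert_capE ?s1 ?s2 ?insert_capE //.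
by rewrite !sk insert_capE /= insert_capE.
Qed.

(** Two distinct inner-most caps of a pairing are disjoint, so they can be
    removed in either order. *)
Lemma insert_cap_conf a b D1 D2 : a < b -> insert_cap a D1 = insert_cap b D2 ->
  a.+1 < b /\ exists2 D3, D1 = insert_cap b.-2 D3 & D2 = insert_cap a D3.
Proof.
move=> ab E.
have Ep y : insert_mate a D1 y = insert_mate b D2 y by exact: (congr1 (fun D => mate D y) E).
have Ed y : insert_dotted a D1 y = insert_dotted b D2 y by exact: (congr1 (fun D => dotted D y)
  E).
have ab1 : a.+1 < b.
  rewrite ltn_neqAle ab andbT; apply/eqP => h; subst b.
  by have := Ep a.+1; rewrite !insert_capE; lia.
split=> //; case: b ab ab1 E Ep Ed => [|[|b]] // _ ab1 E Ep Ed.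
have s3 : skip a b = b.+2 /\ skip a b.+1 = b.+3 by slia.
case: s3 => s3 s4.
have e1 : mate D1 b = b.+1.
  by apply: (@skip_inj a); rewrite -insert_mate_skip s3 s4 Ep insert_capE.
have e2 : dotted D1 b = false by rewrite -(insert_dotted_skip a) s3 Ed insert_capE.
have [D3 E3] := insert_cap_ex e1 e2.
exists D3 => //; apply: (@insert_cap_inj b.+2); rewrite -E E3 insert_cap_comm //; lia.
Qed.

Lemma contract_insert s l l' k D : (l' = l /\ l.+1 < k) \/ (l' = l.+2 /\ k <= l) ->
  contract s l' (insert_cap k D) = insert_cap k (contract s l D).
Proof.
move=> h.
have e1 : l' = skip k l by slia.
have e2 : l'.+1 = skip k l.+1 by slia.
have kl : (skip k l == k = false) * (skip k l == k.+1 = false)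
  * (skip k l.+1 == k = false) * (skip k l.+1 == k.+1 = false).
  by do ?split; slia.
have sE x y : (skip k x == skip k y) = (x == y).
  by apply/eqP/eqP => [/skip_inj|->].
have sN x : ((k == skip k x) = false) * ((k.+1 == skip k x) = false).
  by split; have := skip_neq k x; lia.
apply: dpairing_ext => y; rewrite /= /contract_mate /contract_dotted /= e2 e1 !insert_capE;
  case: (skipP k y) => [||x].
- by rewrite !insert_capE !sN.
- by rewrite !insert_capE !sN.
- by rewrite !insert_capE !sE /= /contract_mate; do !case: ifP => // _.
- by rewrite !insert_capE !sN.
- by rewrite !insert_capE !sN.
- by rewrite !insert_capE !sE /= /contract_dotted; do !case: ifP => // _.
Qed.

Lemma looped_insert l l' k D : (l' = l /\ l.+1 < k) \/ (l' = l.+2 /\ k <= l) ->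
  looped l' (insert_cap k D) = looped l D /\ dotted (insert_cap k D) l' = dotted D l.
Proof.
move=> h.
have e1 : l' = skip k l by slia.
have e2 : l'.+1 = skip k l.+1 by slia.
rewrite /looped /= e2 e1 !insert_capE; split=> //.
by apply/eqP/eqP => [/skip_inj|->].
Qed.

(** An inserted cap slides one step to the left when the generator next to it
    is applied; [contract_insertP] is the step to the right. *)
Lemma contract_insertS k D : contract false k (insert_cap k.+1 D) = insert_cap k D.
Proof.
have pk := mate_neq D k.
have sk : skip k k = k.+2 by slia.
have sne x : x <> k -> skip k.+1 x = skip k x by move=> ?; slia.
have e1 : skip k.+1 k = k by slia.
have f1 : insert_mate k.+1 D k = skip k (mate D k) by rewrite -{2}e1 insert_mate_skip sne.
have f2 : insert_dotted k.+1 D k = dotted D k by rewrite -{2}e1 insert_dotted_skip.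
have sE x y : (skip k x == skip k y) = (x == y).
  by apply/eqP/eqP => [/skip_inj|->].
apply: dpairing_ext => y; rewrite /= /contract_mate /contract_dotted /= f1 ?f2 !insert_capE;
  case: (skipP k y) => [||x]; rewrite ?insert_capE ?eqxx ?orbT //.
- by rewrite ifF //; apply/eqP; lia.
- have [-> ->] : (skip k x == k = false) /\ (skip k x == k.+1 = false).
    by split; slia.
  rewrite -{2}sk !sE; case: (x =P mate D k) => [->|xp]; first by rewrite mateK.
  case: (x =P k) => [->|xk] //.
  by rewrite -sne // insert_mate_skip sne // => E; apply: xp; rewrite -E mateK.
- rewrite skip_neq -sk !sE addbF addbF.
  case: (x =P mate D k) => [->|xp]; first by rewrite dotted_mate.
  case: (x =P k) => [->|xk] //=.
  by rewrite -sne // insert_dotted_skip.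
Qed.

Lemma looped_insert_same k D : looped k (insert_cap k D).
Proof. by rewrite /looped /= insert_mateL. Qed.

Lemma looped_insertS k D : looped k (insert_cap k.+1 D) = false.
Proof.
have e1 : skip k.+1 k = k by slia.
by apply/eqP; rewrite /= -{2}e1 insert_capE; slia.
Qed.

Lemma looped_insertP k D : looped k.+1 (insert_cap k D) = false.
Proof. by apply/eqP; rewrite /= insert_capE; lia. Qed.

Lemma contract_insertP k D : contract false k.+1 (insert_cap k D) = insert_cap k.+1 D.
Proof.
by rewrite -contract_insertS contract_zigr // ?looped_insert_same //= insert_dottedL.
Qed.

Section Toggle.
Variable D : dpairing.
Definition toggle_dotted x := dotted D x (+) ((x == 0) || (x == mate D 0)).
Lemma toggle_dotted_mate x : toggle_dotted (mate D x) = toggle_dotted x.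
Proof.
by rewrite /toggle_dotted dotted_mate !mate_eq mateK orbC.
Qed.
Definition toggle0 := DPairing (mate_neq D) (mateK D) toggle_dotted_mate.
End Toggle.

Lemma toggle0K D : toggle0 (toggle0 D) = D.
Proof. by apply: dpairing_ext => x //=; rewrite /toggle_dotted /= /toggle_dotted addbK. Qed.
Lemma toggle0_inj D D' : toggle0 D = toggle0 D' -> D = D'.
Proof. by move=> E; rewrite -(toggle0K D) E toggle0K. Qed.

(** Moving a dot to the left-most strand turns E_0 into E_1 and back. *)
Lemma toggle0_contract0 s D : toggle0 (contract s 0 (toggle0 D)) = contract (~~ s) 0 D.
Proof.
apply: dpairing_ext => x; pfacts D 0; pfacts D 1; pfacts D x;
  rewrite //= /toggle_dotted /= /contract_dotted /= /toggle_dotted /contract_mate /=.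
have n1 : 0 <> 1 by []. pne D n1.
by pcases; dtsolve D.
Qed.
Lemma toggle0_contractS s k D : toggle0 (contract s k.+1 (toggle0 D)) = contract s k.+1 D.
Proof.
have n1 : 0 <> k.+1 by []. pne D n1.
have n2 : 0 <> k.+2 by []. pne D n2.
have n3 : k.+1 <> k.+2 by lia. pne D n3.
apply: dpairing_ext => x; pfacts D 0; pfacts D k.+1; pfacts D k.+2; pfacts D x;
  rewrite //= /toggle_dotted /= /contract_dotted /= /toggle_dotted /contract_mate /=.
by pcases; dtsolve D.
Qed.
Lemma toggle0_insert_toggle0 k D : toggle0 (insert_cap k.+1 (toggle0 D)) = insert_cap k.+1 D.
Proof.
have e0 : skip k.+1 0 = 0 by [].
have sE x y : (skip k.+1 x == skip k.+1 y) = (x == y).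
  by apply/eqP/eqP => [/skip_inj|->].
have p0 E : insert_mate k.+1 E 0 = skip k.+1 (mate E 0) by rewrite -{1}e0 insert_mate_skip.
have z0 x : (skip k.+1 x == 0) = (x == 0) by rewrite -(sE x 0) e0.
apply: dpairing_ext => y //; rewrite /= /toggle_dotted /= p0.
case: (skipP k.+1 y) => [||x]; rewrite !insert_capE //=.
- by apply/eqP; slia.
- by apply/eqP; slia.
- by rewrite /toggle_dotted z0 !sE addbK.
Qed.

(** The index 0 stands for a dotted cap at position 1. Removing such a cap
    toggles the dot of the next left-most chord; hence the toggle before the
    insertion, while the one after it dots the new cap. *)
Definition add_cap i D := if i == 0 then toggle0 (insert_cap 0 (toggle0 D)) else insert_cap
  i.-1 D.

Lemma add_cap_inj i D D' : add_cap i D = add_cap i D' -> D = D'.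
Proof.
rewrite /add_cap; case: ifP => _; last exact: insert_cap_inj.
by move=> /toggle0_inj /insert_cap_inj /toggle0_inj.
Qed.

Lemma add_cap_dotted i D : dotted (add_cap i D) i.-1 = (i == 0).
Proof. by case: i => [|i]; rewrite /add_cap /= ?insert_capE ?/toggle_dotted /= ?insert_capE.
  Qed.
Lemma loop_at_add_cap i D : loop_at i (add_cap i D).
Proof. by case: i => [|i]; rewrite /loop_at /add_cap /looped /= ?insert_capE. Qed.

Lemma act_add_cap_same i D : act i (add_cap i D) = add_cap i D.
Proof. by rewrite /act -{1}(add_cap_dotted i D) contract_looped //; exact: loop_at_add_cap. Qed.

Lemma act0_toggle0 D : act 0 D = toggle0 (contract false 0 (toggle0 D)).
Proof. by rewrite toggle0_contract0. Qed.

Definition adjN (i j : nat) : bool :=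
  let e i j := [|| (i == 0) && (j == 2), (i == 1) && (j == 2) | (2 <= i) && (j == i.+1)]
  in e i j || e j i.

Variant adj_spec : nat -> nat -> Type :=
| Adj02 : adj_spec 0 2 | Adj20 : adj_spec 2 0
| AdjS i : adj_spec i.+1 i.+2 | AdjP i : adj_spec i.+2 i.+1.
Lemma adjP i j : adjN i j -> adj_spec i j.
Proof.
rewrite /adjN /=; case: i j => [|[|i]] [|[|j]] //=.
- by case: j => //; constructor.
- by case: j => //; constructor.
- by case: i => //; constructor.
- by case: i => //; constructor.
move=> h; case: (i.+1 =P j) => [<-|n]; first by constructor.
have -> : i = j.+1 by lia.
by constructor.
Qed.

Lemma contractS_toggle0 s k D : contract s k.+1 (toggle0 D) = toggle0 (contract s k.+1 D).
Proof. by apply: toggle0_inj; rewrite toggle0K toggle0_contractS. Qed.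
Lemma toggle0_insertS k D : toggle0 (insert_cap k.+1 D) = insert_cap k.+1 (toggle0 D).
Proof. by apply: toggle0_inj; rewrite toggle0K toggle0_insert_toggle0. Qed.

Lemma act_add_cap_adj i j D : adjN i j -> act j (add_cap i D) = add_cap j D /\ loop_at j
  (add_cap i D) = false.
Proof.
case/adjP => [||{}i|{}i]; rewrite /loop_at /add_cap /=.
- rewrite /act /= contractS_toggle0 contract_insertP toggle0_insertS toggle0K; split=> //.
- rewrite act0_toggle0 toggle0_insertS contract_insertS looped_insertS //.
- by rewrite looped_insertP /act /= contract_insertP.
- by rewrite looped_insertS /act /= contract_insertS.
Qed.

(** The letter j applied below a cap at position i is the letter with this
    index for the remaining strands. Below the dotted cap of index 0 the letter
    3 reaches the left-most remaining strand, whose dot was toggled, so that it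
    becomes 0 and not 1. *)
Definition shift_letter (i j : nat) : nat :=
  if j < i then j else if (i == 0) && (j == 3) then 0 else j.-2.

Definition far (i j : nat) := [&& i != j, ~~ adjN i j & i + j != 1].

Variant far_spec : nat -> nat -> Type :=
| Far03 : far_spec 0 3
| Far0S k : far_spec 0 k.+4
| FarU i k : i < k -> far_spec i.+1 k.+2
| Far0D i : far_spec i.+3 0
| FarD i k : k.+1 < i -> far_spec i.+1 k.+1.

Lemma farP i j : far i j -> far_spec i j.
Proof.
rewrite /far /adjN /=; case: i j => [|i] [|j] //=.
- by case: j => [|[|[|j]]] // _; constructor.
- by case: i => [|[|i]] // _; constructor.
move=> h; case: (ltngtP i j) => [ij|ij|ij]; last by lia.
- by case: j ij h => // j ij h; constructor; lia.
- by constructor; lia.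
Qed.

(** A letter that does not meet the cap acts on what remains after the cap is
    removed. *)
Lemma act_add_cap_far i j D : far i j ->
  [/\ act j (add_cap i D) = add_cap i (act (shift_letter i j) D),
      loop_at j (add_cap i D) = loop_at (shift_letter i j) D & dotted_loop_at j (add_cap i D) =
        dotted_loop_at (shift_letter i j) D].
Proof.
case/farP => [|k|{}i k ik|{}i|{}i k ik]; rewrite /dotted_loop_at /loop_at /act /add_cap
  /shift_letter /=.
- have [h1 h2] := @looped_insert 0 2 0 (toggle0 D) (or_intror (conj erefl isT)).
  rewrite /looped /= in h1 h2 *; split=> //.
    by rewrite contractS_toggle0 (@contract_insert _ 0) -?(toggle0_contract0 false) ?toggle0K
      //; auto.
  by rewrite h1 /toggle_dotted /= h2 insert_mateL /toggle_dotted eqxx /= addbF addbF.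
- have [h1 h2] := @looped_insert k.+1 k.+3 0 (toggle0 D) (or_intror (conj erefl isT)).
  rewrite /looped /= in h1 h2 *; split=> //.
    by rewrite contractS_toggle0 (@contract_insert _ k.+1) -?contractS_toggle0 //; auto.
  rewrite h1 /toggle_dotted /= h2 insert_mateL /toggle_dotted /= !addbF; case: eqP => //= E.
  case: eqP => [e|_]; last by rewrite addbF.
  by rewrite e mateK in E.
- case: k ik => // k ik.
  have h : (k.+2 = k /\ k.+1 < i) \/ (k.+2 = k.+2 /\ i <= k) by right.
  have [h1 h2] := looped_insert D h; rewrite /= in h2.
  have -> : k.+3 < i.+1 = false by lia.
  by rewrite (contract_insert _ _ h) h1 h2.
- have h : (0 = 0 /\ 1 < i.+2) \/ (0 = 2 /\ i.+2 <= 0) by left.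
  have [h1 h2] := looped_insert D h; rewrite /= in h2.
  by rewrite (contract_insert _ _ h) h1 h2.
- have h : (k = k /\ k.+1 < i) \/ (k = k.+2 /\ i <= k) by left.
  have [h1 h2] := looped_insert D h; rewrite /= in h2.
  have -> : k.+1 < i.+1 by lia.
  by rewrite (contract_insert _ _ h) h1 h2.
Qed.

(** Also with the index 0 allowed, two different caps are removed in either
    order; positions 0 and 1 exclude each other because the cap is either
    dotted or not. *)
Lemma add_cap_conf i k D1 D2 : i < k -> add_cap i D1 = add_cap k D2 ->
  far i k /\ exists2 D3, D1 = add_cap (shift_letter i k) D3 & D2 = add_cap i D3.
Proof.
case: k => // k ik; rewrite /add_cap /=; case: i ik => [_|i ik] /= E; last first.
  have [h [D3 E1 E2]] := @insert_cap_conf i k _ _ ik E.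
  split; first by rewrite /far /adjN; lia.
  exists D3 => //; rewrite E1 /shift_letter [k.+1 < _]leqNgt ltnS (ltnW ik) /=.
  by case: k ik E h E1 => [|[|k]].
case: k E => [|k] E.
  have := congr1 (fun D => dotted D 0) E.
  by rewrite /= /toggle_dotted /= !insert_capE.
have {}E : insert_cap 0 (toggle0 D1) = insert_cap k.+1 (toggle0 D2).
  by apply: toggle0_inj; rewrite E toggle0_insertS toggle0K.
have [h [D3 E1 E2]] := @insert_cap_conf 0 k.+1 _ _ isT E.
case: k E h E1 => // k E h /= E1.
split; first by rewrite /far /adjN; lia.
exists (toggle0 D3); rewrite /shift_letter /=; last by rewrite toggle0K -E2 toggle0K.
case: k E h E1 => [|k] E h E1 /=; first by rewrite toggle0K -E1 toggle0K.
by rewrite -toggle0_insertS -E1 toggle0K.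
Qed.

(** The word g_{N,i} = E_N E_{N-1} ... E_i, empty for i = N + 1, with g_{N,0} =
    E_N ... E_2 E_0. It carries the right-most vertical strand to a cap at
    position i. *)
Definition capword N i : seq nat :=
  if i == 0 then rcons (rev (iota 2 N.-1)) 0 else rev (iota i (N.+1 - i)).

Lemma capword_top N : capword N N.+1 = [::].
Proof. by rewrite /capword subnn. Qed.
Lemma capword_rcons N i : 0 < i <= N -> capword N i = rcons (capword N i.+1) i.
Proof.
case: i => // i /= iN; rewrite /capword /= subSn //.
by rewrite -[RHS]rev_cons.
Qed.
Lemma capword_0 N : 0 < N -> capword N 0 = rcons (capword N 2) 0.
Proof. by case: N => // N _; rewrite /capword /= !subSS subn0. Qed.
Lemma iota_rcons m n : iota m n.+1 = rcons (iota m n) (m + n).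
Proof. by rewrite -cats1 -addn1 iotaD. Qed.
Lemma capword_cons N i : 0 < N -> i <= N -> (i == 0) ==> (1 < N) -> capword N i = N :: capword
  N.-1 i.
Proof.
case: N => // N _; rewrite /capword; case: i => [|i] iN hN.
  by case: N hN iN => // N _ _; rewrite eqxx [_.-1]/= iota_rcons rev_rcons.
rewrite [_ == 0]/= subSn // iota_rcons rev_rcons; congr (_ :: _); lia.
Qed.
Lemma all_capword N i : all (leq^~ N) (capword N i).
Proof.
rewrite /capword; case: ifP => _; rewrite ?all_rcons all_rev; last first.
  by apply/allP => x; rewrite mem_iota; lia.
by rewrite leq0n; apply/allP => x; rewrite mem_iota; lia.
Qed.

Section Runs.
Variables (K : fieldType) (q : K).

Lemma act_weightE j D : act_weight q j D = if loop_at j D then if dotted_loop_at j D then 0%R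
  else (- qint q 2)%R else 1%R.
Proof. by rewrite /act_weight /contract_weight /loop_at /dotted_loop_at /loop_at;
  case: looped. Qed.

Lemma run_cat w w' D : run (w ++ w') D = run w' (run w D).
Proof. exact: foldl_cat. Qed.
Lemma run_rcons w j D : run (rcons w j) D = act j (run w D).
Proof. by rewrite -cats1 run_cat. Qed.
Lemma run_weight_rcons w j D : run_weight q (rcons w j) D = (run_weight q w D * act_weight q j
  (run w D))%R.
Proof. by rewrite -cats1 run_weight_cat /= mulr1. Qed.

(** Starting from a vertical strand on the right, seen as a cap at position N +
    1, each letter slides the cap one step to the left, and no loop is
    closed. *)
Lemma run_capword N i D : 0 < N -> i <= N.+1 ->
  run (capword N i) (add_cap N.+1 D) = add_cap i D /\ run_weight q (capword N i) (add_cap N.+1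
    D) = 1%R.
Proof.
move=> N0.
have H m : m <= N -> run (capword N (N.+1 - m)) (add_cap N.+1 D) = add_cap (N.+1 - m) D
    /\ run_weight q (capword N (N.+1 - m)) (add_cap N.+1 D) = 1%R.
  elim: m => [|m IH] mN; first by rewrite subn0 capword_top.
  have [e1 e2] := IH (ltnW mN).
  have E : N.+1 - m = (N.+1 - m.+1).+1 by lia.
  rewrite E in e1 e2; rewrite capword_rcons; last by lia.
  have [a1 a2] : act (N.+1 - m.+1) (add_cap (N.+1 - m.+1).+1 D) = add_cap (N.+1 - m.+1) D
     /\ loop_at (N.+1 - m.+1) (add_cap (N.+1 - m.+1).+1 D) = false.
    by apply: act_add_cap_adj; rewrite /adjN; lia.
  by rewrite run_rcons run_weight_rcons e1 e2 a1 act_weightE a2 mul1r.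
move=> iN; case: (posnP i) => [->|i0].
  have [e1 e2] : run (capword N 2) (add_cap N.+1 D) = add_cap 2 D /\ run_weight q (capword N 2)
    (add_cap N.+1 D) = 1%R.
    by have := H N.-1; rewrite (_ : N.+1 - N.-1 = 2); [apply; lia | lia].
  have [a1 a2] := @act_add_cap_adj 2 0 D isT.
  by rewrite capword_0 // run_rcons run_weight_rcons e1 e2 a1 act_weightE a2 mul1r.
by have := H (N.+1 - i); rewrite (_ : N.+1 - (N.+1 - i) = i); [apply; lia | lia].
Qed.
End Runs.

(** The pairing of 2 k with 2 k + 1. It fills the points beyond the diagram,
    and it is compatible with the shift by two caused by a cap. *)
Definition xor1 x := if odd x then x.-1 else x.+1.
Section IdPairing.
Variable N : nat.
Definition id_mate x := if x < 2 * N then (2 * N).-1 - x else xor1 x.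
Lemma id_mate_neq x : id_mate x <> x. Proof. by rewrite /id_mate /xor1; case: ifP => ?;
  [lia | case: ifP; lia]. Qed.
Lemma id_mateK x : id_mate (id_mate x) = x.
Proof. rewrite /id_mate /xor1; case: (ltnP x (2 * N)) => h; first by rewrite ifT; lia.
by case: (boolP (odd x)) => o; (rewrite ifF; last by lia); case: ifP; lia.
Qed.
Definition id_pairing := @DPairing id_mate (fun=> false) id_mate_neq id_mateK (fun=> erefl).
End IdPairing.

(** The vertical strand on the right of the identity is a cap at the last
    position. *)
Lemma add_cap_id N : add_cap N.+1 (id_pairing N) = id_pairing N.+1.
Proof.
apply: dpairing_ext => y; rewrite /add_cap /=; case: (skipP N y) => [||x];
  rewrite ?insert_capE //.
- by rewrite /id_mate; case: ifP; lia.
- by rewrite /id_mate; case: ifP; lia.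
- by rewrite [mate _ _]/= /id_mate /xor1; slia.
Qed.

(** * Words inserting caps, and normal words *)

Local Open Scope ring_scope.

Lemma capword_single N : (0 < N)%N -> capword N N = [:: N].
Proof. by move=> N0; rewrite capword_rcons ?N0 ?leqnn // capword_top. Qed.

Lemma adjN_S x : (0 < x)%N -> adjN x x.+1.
Proof. by rewrite /adjN; lia. Qed.

Lemma far_up i k : far i k -> (i < k)%N -> far i k.+1.
Proof. by rewrite /far /adjN; lia. Qed.

Lemma shift_letter_up i k : (i < k)%N -> (shift_letter i k <= k.-2)%N.
Proof. by move=> ik; rewrite /shift_letter ifF; [case: ifP; lia | lia]. Qed.
Lemma shift_letter_lt i k N : far i k -> (i <= N.+1)%N -> (k <= N)%N -> (shift_letter i k <
  N)%N.
Proof.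
case/farP => [|{}k|{}i {}k ik|{}i|{}i {}k ik] h1 h2; rewrite /shift_letter /=; try lia.
all: by case: ifP; lia.
Qed.

Lemma capword_shift_letter N i k : far i k -> (i < k <= N)%N ->
  capword N.-1 (shift_letter i k) = rcons (capword N.-1 (shift_letter i k.+1)) (shift_letter i
    k) /\ (shift_letter i k < N)%N.
Proof.
case/farP => [|{}k|{}i {}k ik|{}i|{}i {}k ik] /andP[ik' kN]; rewrite /shift_letter /=; try lia.
- rewrite capword_0; last by lia.
  by split => //; lia.
- rewrite capword_rcons; last by lia.
  by split => //; lia.
- have -> : (k.+2 < i.+1)%N = false by lia.
  have -> : (k.+3 < i.+1)%N = false by lia.
  rewrite capword_rcons; last by lia.
  by split => //; lia.
Qed.

Lemma capword_exchange_top N i : (1 < N)%N -> (i < N)%N ->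
  exists l w, [/\ capword N.-1 (shift_letter i N.+1) = [:: l], capword N.-1 i = l :: w,
    adjN l N & (l < N)%N].
Proof.
move=> N1 iN; rewrite /shift_letter ltnNge (ltnW (ltnW _)) //=.
case: ifP => h.
  have [-> ->] : i = 0%N /\ N = 2 by lia.
  by exists 0%N, [::].
exists N.-1, (capword N.-2 i); split; last by lia.
- by rewrite capword_single //; lia.
- by rewrite (@capword_cons N.-1) //; lia.
- by rewrite -{2}(prednK (ltnW N1)) adjN_S //; lia.
Qed.

Section Words.
Variables (K : fieldType) (q : K) (n : nat).
Notation A := (TLD q n).
Notation gn := (genN q n).
Notation W := (wordN q n).
Notation d2 := (- qint q 2).

Lemma adjN_D i j : (i <= n)%N -> (j <= n)%N ->
  adjD (inord i : 'I_n.+1) (inord j) = adjN i j.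
Proof. by move=> ni nj; rewrite /adjD /edgeD !inordK. Qed.

Lemma genN_sqr i : gn i * gn i = d2 *: gn i.
Proof. by case: (TLD_relations q n) => h _ _; exact: h. Qed.
Lemma genN_braid i j : adjN i j -> (i <= n)%N -> (j <= n)%N ->
  gn i * gn j * gn i = gn i.
Proof. by move=> ij ni nj; case: (TLD_relations q n) => _ h _; apply: h; rewrite adjN_D. Qed.
Lemma genN_comm i j : ~~ adjN i j -> (i <= n)%N -> (j <= n)%N -> gn i * gn j = gn j * gn i.
Proof.
move=> ij ni nj; case: (i =P j) => [->//|/eqP nij].
case: (TLD_relations q n) => _ _; apply; last by rewrite adjN_D.
by apply: contra nij => /eqP/(congr1 val); rewrite /= !inordK // => ->.
Qed.

Lemma wordN_comm j w : (j <= n)%N -> all (fun i => ~~ adjN i j && (i <= n)%N) w ->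
  W w * gn j = gn j * W w.
Proof.
move=> jn; elim: w => [|i w IH] /=; first by rewrite wordN_nil mul1r mulr1.
case/andP=> /andP[ij ni] /IH E.
by rewrite wordN_cons -mulrA E !mulrA genN_comm.
Qed.

Lemma capword_split N i k : (0 < N)%N -> (i < k <= N.+1)%N -> (i == 0%N) ==> (1 < k)%N ->
  capword N i = capword N k ++ capword k.-1 i.
Proof.
move=> N0 /andP[ik kN] h.
have H m : (m <= N.+1 - k)%N -> capword N i = capword N (N.+1 - m)%N ++ capword (N.+1 - m)%N.-1
  i.
  elim: m => [|m IH] mN; first by rewrite subn0 capword_top.
  rewrite IH; last by lia.
  set l := (N.+1 - m.+1)%N; have -> : (N.+1 - m = l.+1)%N by rewrite /l; lia.
  rewrite (@capword_rcons N l) ?cat_rcons; last by rewrite /l; lia.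
  by rewrite (@capword_cons l i) //; rewrite /l; lia.
have := H _ (leqnn _); rewrite (_ : N.+1 - (N.+1 - k) = k)%N //; lia.
Qed.

Lemma mem_capword N i x : x \in capword N i -> (x <= N)%N /\ (x = i \/ (maxn i 1 < x)%N).
Proof.
rewrite /capword; case: eqP => [->|i0]; rewrite ?mem_rcons ?inE ?mem_rev ?mem_iota; lia.
Qed.

Section GE.
Variable N : nat.
Hypotheses (N0 : (0 < N)%N) (Nn : (N <= n)%N).

Lemma capword_gen_same i : (i <= N)%N -> W (capword N i) * gn i = d2 *: W (capword N i).
Proof.
move=> iN; have [w ->] : exists w, capword N i = rcons w i.
  case: (posnP i) => [->|i0]; first by rewrite capword_0 //; eexists.
  by rewrite capword_rcons ?i0 //; eexists.
by rewrite wordN_rcons -mulrA genN_sqr -scalerAr.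
Qed.

Lemma capword_gen_adj i j : adjN i j -> (i <= N.+1)%N -> (j <= N)%N ->
  W (capword N i) * gn j = W (capword N j).
Proof.
move=> ij iN jN; have a := adjP ij; case: a iN jN ij => [||{}i|{}i] iN jN ij.
- rewrite capword_0 // capword_rcons; last by lia.
  by rewrite !wordN_rcons -!mulrA [gn 2 * _]mulrA genN_braid //; lia.
- by rewrite [capword N 0]capword_0 // wordN_rcons.
- rewrite (@capword_rcons _ i.+1); last by lia.
  rewrite (@capword_rcons _ i.+2); last by lia.
  rewrite !wordN_rcons -!mulrA [gn i.+2 * _]mulrA genN_braid //; rewrite /adjN; lia.
- by rewrite (@capword_rcons _ i.+1) ?wordN_rcons //; lia.
Qed.

(** The letter j travels through E_N ... E_{j+1}, meets E_j E_{j-1}, and leaves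
    as the letter l that follows them in the word; both l and j are adjacent to
    j - 1. *)
Lemma capword_gen_up i j l H : (2 < j <= N)%N -> (i < j.-1)%N -> capword j.-2 i = l :: H ->
  adjN l j.-1 -> W (capword N i) * gn j = gn l * W (capword N i).
Proof.
move=> /andP[j2 jN] ij gE al.
have lj : (l <= j.-2)%N by have := all_capword j.-2 i; rewrite gE => /andP[].
rewrite (@capword_split N i j.+1) //; try lia.
rewrite wordN_cat (@capword_cons j i) //; try lia.
rewrite (@capword_cons j.-1 i) //; try lia.
rewrite gE !wordN_cons -!mulrA; set G := W (capword N j.+1); set HH := W H.
have c1 : HH * gn j = gn j * HH.
  apply: wordN_comm; first by lia.
  apply/allP => x xH; have := all_capword j.-2 i; rewrite gE /= => /andP[_ /allP/(_ _ xH)].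
  by rewrite /adjN; lia.
have c2 : gn l * gn j = gn j * gn l by apply: genN_comm; rewrite /adjN; lia.
have c3 : G * gn l = gn l * G.
  apply: wordN_comm; first by lia.
  by apply/allP => x /mem_capword; rewrite /adjN; lia.
rewrite c1 [RHS]mulrA -c3 -!mulrA; congr (G * _).
transitivity (gn j * (gn l * HH)).
  rewrite (mulrA (gn l)) c2 -(mulrA (gn j)) (mulrA (gn j.-1)) mulrA (mulrA (gn j)).
  by rewrite genN_braid //; rewrite /adjN; lia.
rewrite (mulrA (gn l) (gn j)) c2 -mulrA; congr (gn j * _).
by rewrite !mulrA genN_braid //; lia.
Qed.

(** A letter away from the cap moves to the left of the word, where it acts on
    the strands other than the cap; compare [act_add_cap_far]. *)
Lemma capword_gen_far i j : far i j -> (i <= N.+1)%N -> (j <= N)%N ->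
  W (capword N i) * gn j = gn (shift_letter i j) * W (capword N i).
Proof.
move=> ij iN jN.
case: (ltnP j i) => ji.
  rewrite /shift_letter ji; apply: wordN_comm; first by lia.
  by apply/allP => x /mem_capword; move: ij; rewrite /far /adjN; lia.
rewrite /shift_letter ltnNge ji /=.
case: (boolP ((i == 0%N) && (j == 3))) => [/andP[/eqP i0 /eqP j3]|h].
  by subst; apply: (@capword_gen_up 0%N 3 0%N [::]).
move: (ij); rewrite /far /adjN => ij'.
apply: (@capword_gen_up i j j.-2 (capword j.-2.-1 i)); try lia.
- by rewrite capword_cons //; lia.
- by rewrite (_ : j.-1 = j.-2.+1) ?adjN_S //; lia.
Qed.

(** Removing two caps in the two possible orders gives equal products of
    words. *)
Lemma capword_exchange i k : (1 < N)%N -> far i k -> (i < k <= N.+1)%N ->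
  W (capword N.-1 (shift_letter i k)) * W (capword N i) = W (capword N.-1 i) * W (capword N k).
Proof.
move=> N1 f /andP[ik kN]; have [m km] : exists m, (k + m = N.+1)%N.
  by exists (N.+1 - k)%N; lia.
elim: m k km f ik kN => [|m IH] k km f ik kN.
  rewrite addn0 in km; subst k; rewrite capword_top wordN_nil mulr1.
  have iN : (i < N)%N by move: f ik {kN}; rewrite /far /adjN; lia.
  have [l [w [-> el al ln]]] := capword_exchange_top N1 iN.
  rewrite wordN_1 (@capword_cons N i) //; try lia.
  by rewrite el !wordN_cons !mulrA genN_braid //; lia.
have kN' : (k <= N)%N by lia.
have [e2 l0] := @capword_shift_letter N i k f (introT andP (conj ik kN')).
rewrite e2 wordN_rcons -mulrA -capword_gen_far //; last by lia.
rewrite mulrA IH; [|lia|exact: far_up|lia|lia].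
rewrite -mulrA -wordN_rcons -capword_rcons //; lia.
Qed.
End GE.

Inductive ideal01 : A -> Prop :=
| ideal01_gen : ideal01 (gn 0 * gn 1)
| ideal01_add x y : ideal01 x -> ideal01 y -> ideal01 (x + y)
| ideal01_scale a x : ideal01 x -> ideal01 (a *: x)
| ideal01_l a x : ideal01 x -> ideal01 (a * x)
| ideal01_r a x : ideal01 x -> ideal01 (x * a).

Lemma capword_gen_01 N i j : (0 < n)%N -> (0 < N)%N -> (i + j = 1)%N -> ideal01 (W (capword N
  i) * gn j).
Proof.
move=> n0 N0 ij; have [w ->] : exists w, capword N i = rcons w i.
  case: (posnP i) => [->|i0]; first by rewrite capword_0 //; eexists.
  by rewrite capword_rcons ?i0 //; [eexists | lia].
rewrite wordN_rcons -mulrA; apply: ideal01_l.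
have [[-> ->]|[-> ->]] : (i = 0 /\ j = 1)%N \/ (i = 1 /\ j = 0)%N by lia.
  exact: ideal01_gen.
by rewrite genN_comm //; exact: ideal01_gen.
Qed.
End Words.

(** The words obtained by recording an order in which a diagram is built from
    the identity by adding caps. A diagram has several of them in general. *)
Inductive normal : nat -> dpairing -> seq nat -> Prop :=
| normal1 : normal 1 (id_pairing 1) [::]
| normalS N D w i : normal N D w -> (i <= N.+1)%N -> normal N.+1 (add_cap i D) (w ++ capword N
  i).

Lemma normal_inv N D w : normal N D w -> (N = 1 /\ D = id_pairing 1 /\ w = [::])%N \/
  exists N' D' w' i, [/\ N = N'.+1, D = add_cap i D', w = w' ++ capword N' i, (0 < N')%N
                         & (i <= N)%N /\ normal N' D' w'].
Proof.
case=> [|{}N {}D {}w i h iN]; [by left | right].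
exists N, D, w, i; split=> //; by case: h.
Qed.

(** Any cap can be the last one to be added. *)
Lemma normal_remove N D i w : normal N.+1 (add_cap i D) w -> (i <= N.+1)%N -> (0 < N)%N ->
  exists w', normal N D w'.
Proof.
elim: N D i w => // N IH D i w h iN _.
case: (normal_inv h) => [[]//|[N' [D' [w' [k [[?] E _ N0 [kN normalD']]]]]]]; subst N'.
case: (ltngtP i k) => ik.
- have [f [D3 E1 E2]] := add_cap_conf ik E; subst.
  have N1 : (0 < N)%N by move: f; rewrite /far /adjN; lia.
  have iN' : (i <= N.+1)%N by move: f; rewrite /far /adjN; lia.
  have [|w3 h3] := IH _ _ _ normalD' _ N1; first by [].
  by exists (w3 ++ capword N (shift_letter i k)); apply: normalS => //;
    have := shift_letter_up ik; lia.
- have [f [D3 E1 E2]] := add_cap_conf ik (esym E); subst.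
  have N1 : (0 < N)%N by move: f; rewrite /far /adjN; lia.
  have kN' : (k <= N.+1)%N by move: f; rewrite /far /adjN; lia.
  have [|w3 h3] := IH _ _ _ normalD' _ N1; first by have := shift_letter_up ik; lia.
  by exists (w3 ++ capword N k); apply: normalS.
- by subst k; exists w'; rewrite (add_cap_inj E).
Qed.

Section Normal.
Variables (K : fieldType) (q : K) (n : nat).
Notation W := (wordN q n).
Notation gn := (genN q n).

(** By induction on the number of strands: two different last caps both come
    last in words for the diagram, and the words of [capword_exchange] relate
    the two orders. *)
Lemma normal_uniq N D w w' : (N.-1 <= n)%N -> normal N D w -> normal N D w' -> W w = W w'.
Proof.
elim: N D w w' => [|N IH] D w w' Nn h h'; first by case: (normal_inv h) => [[]|[?[?[?[?[]]]]]].
case: (normal_inv h) => [[NE [_ ->]]|].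
  case: (normal_inv h') => [[_ [_ ->]] //|[N' [? [? [? [E _ _ N0 _]]]]]]; lia.
case=> N' [D1 [w1 [i [[?] E -> N0 [iN normal1]]]]]; subst N'.
case: (normal_inv h') => [[NE _]|]; first by lia.
case=> N' [D2 [w2 [k [[?] E' -> _ [kN normal2]]]]]; subst N'.
wlog ik : i k w1 w2 D1 D2 E E' iN kN normal1 normal2 / (i <= k)%N => [H|].
  case/orP: (leq_total i k) => ik; first exact: (H i k _ _ D1 D2).
  by symmetry; apply: (H k i _ _ D2 D1).
move: ik; rewrite leq_eqVlt => /orP[/eqP ?|ik].
  subst k; rewrite E' in E; rewrite !wordN_cat; congr (_ * _).
  by apply: (IH D1) => //; [lia | rewrite -(add_cap_inj E)].
rewrite E in E'; have [f [D3 E1 E2]] := add_cap_conf ik E'; subst.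
have N1 : (1 < N)%N by move: f; rewrite /far /adjN; lia.
case: N N1 IH Nn h h' N0 iN kN normal1 normal2 => // N N1 IH Nn h h' _ iN kN normal1 normal2.
have lN : (shift_letter i k <= N.+1)%N by have := shift_letter_up ik; lia.
have [w3 normal3] := normal_remove normal1 lN N1.
have iN' : (i <= N.+1)%N by move: f; rewrite /far /adjN; lia.
rewrite !wordN_cat (IH _ _ (w3 ++ capword N (shift_letter i k)) _ normal1);
  last exact: normalS; last by lia.
rewrite (IH _ _ (w3 ++ capword N i) _ normal2); last exact: normalS; last by lia.
by rewrite !wordN_cat -!mulrA (@capword_exchange _ _ _ N.+1) //; lia.
Qed.

(** The effect of a letter on the last cap: it closes a loop, slides the cap,
    forms E_0 E_1, or passes to the remaining strands, where induction
    applies. *)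
Lemma normal_step N D w j : (1 < N)%N -> (N.-1 <= n)%N -> normal N D w -> (j < N)%N ->
  if dotted_loop_at j D then ideal01 (W w * gn j)
  else exists2 w', normal N (act j D) w' & W w * gn j = act_weight q j D *: W w'.
Proof.
elim: N D w j => // N IH D w j N1 Nn h jN.
case: (normal_inv h) => [[]|]; first lia.
case=> N' [D1 [w1 [i [[?] -> -> N0 [iN normal1]]]]]; subst N'.
have [?|[ij|[ij|ij]]] : i = j \/ adjN i j \/ (i + j = 1)%N \/ far i j.
  by rewrite /far; case: eqP; case: (adjN i j); case: eqP; auto.
- subst i; rewrite /dotted_loop_at loop_at_add_cap add_cap_dotted addbb /= act_add_cap_same.
  exists (w1 ++ capword N j); first exact: normalS.
  rewrite act_weightE loop_at_add_cap /dotted_loop_at loop_at_add_cap add_cap_dotted addbb /=.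
  by rewrite wordN_cat -mulrA capword_gen_same // scalerAr.
- have [a1 a2] := act_add_cap_adj D1 ij.
  rewrite /dotted_loop_at a2 /= a1 act_weightE a2; exists (w1 ++ capword N j);
    first by apply: normalS => //; lia.
  by rewrite scale1r !wordN_cat -mulrA capword_gen_adj.
- have -> : dotted_loop_at j (add_cap i D1).
    rewrite /dotted_loop_at; have -> : loop_at j (add_cap i D1) = loop_at i (add_cap i D1).
      by rewrite /loop_at; congr looped; lia.
    by rewrite loop_at_add_cap (_ : j.-1 = i.-1) ?add_cap_dotted; lia.
  by rewrite wordN_cat -mulrA; apply/ideal01_l/capword_gen_01 => //; lia.
- have [a1 a2 a3] := act_add_cap_far D1 ij.
  have N2 : (1 < N)%N by move: ij; rewrite /far /adjN; lia.
  have lN : (shift_letter i j < N)%N by exact: shift_letter_lt.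
  have := IH D1 w1 (shift_letter i j) N2 _ normal1 lN;
    rewrite -a3 wordN_cat -mulrA capword_gen_far //; try lia.
  rewrite mulrA; case: ifP => d; first by move=> /(_ ltac:(lia)) Jx; apply: ideal01_r.
  case; first by lia.
  move=> w2 normal2 ->; exists (w2 ++ capword N i); first by rewrite a1; apply: normalS.
  by rewrite wordN_cat scalerAl !act_weightE a2 a3.
Qed.
End Normal.

(** * Anti-involution, augmentation, and the ideal of E_0 E_1 *)

Section Star.
Variables (K : fieldType) (q : K) (n : nat).
Notation A := (TLD q n).
Notation gn := (genN q n).
Notation W := (wordN q n).

Fixpoint term_rev (t : tld_term K n) : tld_term K n :=
  match t with
  | TScal a => TScal a
  | TGen i => TGen i
  | TAdd t u => TAdd (term_rev t) (term_rev u)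
  | TMul t u => TMul (term_rev u) (term_rev t)
  end.

Lemma term_revP t u : tld_eqv q t u -> tld_eqv q (term_rev t) (term_rev u).
Proof.
elim=> {t u} /=.
- by move=> t; apply: tld_refl.
- by move=> t u _; apply: tld_sym.
- by move=> t u v _ h _; apply: tld_trans.
- by move=> t t' u _; apply: tld_addl.
- by move=> t t' u _; apply: tld_mulr.
- by move=> t u u' _; apply: tld_mull.
- by move=> t u; apply: tld_addC.
- by move=> t u v; apply: tld_addA.
- by move=> t; apply: tld_add0.
- by move=> t u v; apply/tld_sym/tld_mulA.
- by move=> t; apply: tld_trans (tld_sym (tld_scalC _ _ _)) (tld_mul1 _ _).
- by move=> t; apply: tld_trans (tld_sym (tld_scalC _ _ _)) (tld_mul0 _ _).
- by move=> t u v; apply: tld_mulDr.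
- by move=> t u v; apply: tld_mulDl.
- by move=> a b; apply: tld_scalD.
- by move=> a b; rewrite mulrC; apply: tld_scalM.
- by move=> a t; apply/tld_sym/tld_scalC.
- by move=> i; apply: tld_trans (tld_sqr q i) (tld_scalC _ _ _).
- by move=> i j ij; apply: tld_trans (tld_sym (tld_mulA _ _ _ _)) (tld_braid _ ij).
- by move=> i j ij nij; apply/tld_sym/tld_comm.
Qed.

(** The anti-automorphism that fixes the generators; it transports statements
    about multiplication on the right to the left. *)
Definition star (x : A) : A := \pi_(TLD q n) (term_rev (repr x)).
Lemma star_pi t : star (\pi_(TLD q n) t) = \pi_(TLD q n) (term_rev t).
Proof. by apply/tld_pi_eq/term_revP/tld_repr_pi. Qed.
Lemma pi_add t u : \pi_(TLD q n) (TAdd t u) = \pi_(TLD q n) t + \pi_(TLD q n) u.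
Proof. by rewrite -[RHS]/(tld_add _ _) tld_piD. Qed.
Lemma pi_mul t u : \pi_(TLD q n) (TMul t u) = \pi_(TLD q n) t * \pi_(TLD q n) u.
Proof. by rewrite -[RHS]/(tld_mul _ _) tld_piM. Qed.
Lemma pi_scal a : \pi_(TLD q n) (TScal a) = a *: 1.
Proof. by rewrite -[RHS]/(tld_mul (tld_scal q n a) 1) tldM1. Qed.
Lemma starD x y : star (x + y) = star x + star y.
Proof. by elim/tld_ind: x => t; elim/tld_ind: y => u; rewrite -pi_add !star_pi pi_add. Qed.
Lemma starM x y : star (x * y) = star y * star x.
Proof. by elim/tld_ind: x => t; elim/tld_ind: y => u; rewrite -pi_mul !star_pi pi_mul. Qed.
Lemma starZ a x : star (a *: x) = a *: star x.
Proof. by rewrite -mulr_algl -pi_scal starM star_pi /= pi_scal mulr_algr. Qed.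
Lemma star_genN i : star (gn i) = gn i. Proof. exact: star_pi. Qed.
Lemma star1 : star 1 = 1.
Proof. by rewrite -[1]scale1r -pi_scal star_pi. Qed.
Lemma star0 : star 0 = 0. Proof. by rewrite -(scale0r 1) starZ !scale0r. Qed.
Lemma star_wordN w : star (W w) = W (rev w).
Proof.
elim: w => [|j w IH]; first by rewrite wordN_nil star1.
by rewrite wordN_cons starM IH star_genN rev_cons wordN_rcons.
Qed.
Lemma term_revK t : term_rev (term_rev t) = t.
Proof. by elim: t => //= [t -> u ->|t -> u ->]. Qed.
Lemma starK x : star (star x) = x.
Proof. by elim/tld_ind: x => t; rewrite !star_pi term_revK. Qed.

(** The character killing all generators. *)
Definition eps (x : A) : K := tld_aug (repr x).
Lemma eps_pi t : eps (\pi_(TLD q n) t) = tld_aug t.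
Proof. exact/tld_augP/tld_repr_pi. Qed.
Lemma epsD x y : eps (x + y) = eps x + eps y.
Proof. by elim/tld_ind: x => t; elim/tld_ind: y => u; rewrite -pi_add !eps_pi. Qed.
Lemma epsM x y : eps (x * y) = eps x * eps y.
Proof. by elim/tld_ind: x => t; elim/tld_ind: y => u; rewrite -pi_mul !eps_pi. Qed.
Lemma eps1 : eps 1 = 1. Proof. by rewrite -[1]scale1r -pi_scal eps_pi. Qed.
Lemma epsZ a x : eps (a *: x) = a * eps x.
Proof. by rewrite -mulr_algl -pi_scal epsM eps_pi. Qed.
Lemma eps0 : eps 0 = 0. Proof. by rewrite -(scale0r 1) epsZ mul0r. Qed.
Lemma eps_genN i : eps (gn i) = 0. Proof. exact: eps_pi. Qed.
Lemma eps_star x : eps (star x) = eps x.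
Proof.
elim/tld_ind: x => t; rewrite star_pi !eps_pi.
by elim: t => //= [t -> u ->|t -> u ->] //; rewrite mulrC.
Qed.
Lemma eps_wordN w : eps (W w) = (w == [::])%:R.
Proof. by case: w => [|j w]; rewrite ?wordN_nil ?eps1 // wordN_cons epsM eps_genN mul0r. Qed.
Lemma eps_sum I r (P : pred I) F : eps (\sum_(i <- r | P i) F i) = \sum_(i <- r | P i) eps (F
  i).
Proof. exact: (big_morph eps epsD eps0). Qed.

(** The subalgebra generated by the letters in P, as a span of words. *)
Inductive word_span (P : pred nat) : A -> Prop :=
| word_span_wordN w : all P w -> word_span P (W w)
| word_span_add x y : word_span P x -> word_span P y -> word_span P (x + y)
| word_span_scale a x : word_span P x -> word_span P (a *: x).

Lemma word_span_1 P : word_span P 1. Proof. by rewrite -wordN_nil; apply: word_span_wordN. Qed.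
Lemma word_span_0 P : word_span P 0. Proof. by rewrite -(scale0r 1);
  apply/word_span_scale/word_span_1. Qed.
Lemma word_span_sum P I r (Q : pred I) F : (forall i,
  Q i -> word_span P (F i)) -> word_span P (\sum_(i <- r | Q i) F i).
Proof. by move=> h; apply: big_ind => //; [exact: word_span_0 | exact: word_span_add]. Qed.
Lemma word_span_mul P x y : word_span P x -> word_span P y -> word_span P (x * y).
Proof.
move=> hx hy; elim: hx => [w Pw|{}x x' _ h1 _ h2|a {}x _ h].
- elim: hy => [w' Pw'|{}y y' _ h1 _ h2|a {}y _ h].
  + by rewrite -wordN_cat; apply: word_span_wordN; rewrite all_cat Pw.
  + by rewrite mulrDr; apply: word_span_add.
  + by rewrite -scalerAr; apply: word_span_scale.
- by rewrite mulrDl; apply: word_span_add.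
- by rewrite -scalerAl; apply: word_span_scale.
Qed.
Lemma word_span_star P x : word_span P x -> word_span P (star x).
Proof.
elim=> [w Pw|{}x x' _ h1 _ h2|a {}x _ h].
- by rewrite star_wordN; apply: word_span_wordN; rewrite all_rev.
- by rewrite starD; apply: word_span_add.
- by rewrite starZ; apply: word_span_scale.
Qed.
Lemma word_span_all x : word_span (leq^~ n) x.
Proof.
elim/tld_ind: x => t; elim: t => [a|i|t IHt u IHu|t IHt u IHu].
- by rewrite pi_scal; apply/word_span_scale/word_span_1.
- rewrite -[\pi_(TLD q n) (TGen i)]/(genE q i) -[i]inord_val -/(gn i) -wordN_1.
  by apply: word_span_wordN; rewrite /= -ltnS ltn_ord.
- by rewrite pi_add; apply: word_span_add.
- by rewrite pi_mul; apply: word_span_mul.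
Qed.

Lemma ideal01_0 : ideal01 (0 : A).
Proof. by rewrite -(scale0r (gn 0 * gn 1)); apply/ideal01_scale/ideal01_gen. Qed.
Lemma genN_01 : (0 < n)%N -> gn 1 * gn 0 = gn 0 * gn 1.
Proof. by move=> n0; apply: genN_comm. Qed.
Lemma ideal01_star (x : A) : (0 < n)%N -> ideal01 x -> ideal01 (star x).
Proof.
move=> n0; elim=> [|{}x y _ h1 _ h2|a {}x _ h|a {}x _ h|a {}x _ h].
- by rewrite starM !star_genN genN_01 //; exact: ideal01_gen.
- by rewrite starD; apply: ideal01_add.
- by rewrite starZ; apply: ideal01_scale.
- by rewrite starM; apply: ideal01_r.
- by rewrite starM; apply: ideal01_l.
Qed.
Lemma ideal01_eps (x : A) : ideal01 x -> eps x = 0.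
Proof.
elim=> [|{}x y _ h1 _ h2|a {}x _ h|a {}x _ h|a {}x _ h].
- by rewrite epsM !eps_genN mul0r.
- by rewrite epsD h1 h2 addr0.
- by rewrite epsZ h mulr0.
- by rewrite epsM h mulr0.
- by rewrite epsM h mul0r.
Qed.
Lemma fun_act_cst0 (x : A) D : fun_act x (fun=> 0) D = 0.
Proof.
rewrite /fun_act; elim: (repr x) D => [a|i|t IHt u IHu|t IHt u IHu] D /=; rewrite ?mulr0 //.
  by rewrite IHt IHu addr0.
have -> : (term_act q u (fun=> 0)) = fun=> 0 by apply: funext => D'; exact: IHu.
exact: IHt.
Qed.
(** After E_0 E_1 the two generators have closed a dotted loop. *)
Lemma ideal01_fun_act (x : A) f D : (0 < n)%N -> ideal01 x -> fun_act x f D = 0.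
Proof.
move=> n0 h; elim: h f D => [|{}x y _ h1 _ h2|a {}x _ h|a {}x _ h|a {}x _ h] f D.
- by rewrite fun_actM !fun_act_genN // /act_weight /act /contract_weight looped_contract
  dotted_contract /= mul0r mulr0.
- by rewrite fun_actD h1 h2 addr0.
- by rewrite fun_actZ h mulr0.
- rewrite fun_actM (_ : fun_act x f = fun=> 0); last by apply: funext => D'; rewrite h.
  exact: fun_act_cst0.
- by rewrite fun_actM h.
Qed.

Section Key.
Hypothesis n0 : (0 < n)%N.
Notation z := (gn 0 * gn 1).
Notation d2 := (- qint q 2).
(** On the ideal the two ends of the fork of the graph cannot be told apart. *)
Definition agree01 (x : A) := gn 0 * x = gn 1 * x.
Lemma agree01_r x y : agree01 x -> agree01 (x * y).
Proof. by rewrite /agree01 !mulrA => ->. Qed.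
Lemma agree01_scale a x : agree01 x -> agree01 (a *: x).
Proof. by rewrite /agree01 -!scalerAr => ->. Qed.
Lemma agree01_far j x : (2 < j <= n)%N -> agree01 x -> agree01 (gn j * x).
Proof.
move=> /andP[j2 jn]; rewrite /agree01 !mulrA => E.
by rewrite -!(genN_comm _ _ jn) ?n0 //; [rewrite -!mulrA E| rewrite /adjN; lia ..].
Qed.
Lemma agree01_01 j x : (j < 2)%N -> agree01 x -> agree01 (gn j * x).
Proof.
rewrite /agree01; case: j => [|[|//]] _ E.
  by rewrite {2}E !mulrA !genN_sqr -!scalerAl E.
by rewrite -{1}E !mulrA !genN_sqr -!scalerAl E.
Qed.
(** E_i E_2 E_j x = E_i x for i, j in {0, 1}: if i = j this is a relation,
    otherwise E_j can be replaced by E_i in front of x. *)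
Lemma agree01_2 j x : (j < 2)%N -> (1 < n)%N -> agree01 x -> agree01 (gn 2 * gn j * x).
Proof.
rewrite /agree01 => j2 n1 E.
have b0 : gn 0 * gn 2 * gn 0 = gn 0 by apply: genN_braid.
have b1 : gn 1 * gn 2 * gn 1 = gn 1 by apply: genN_braid.
case: j j2 => [|[|//]] _.
  by rewrite !mulrA b0 -[gn 1 * gn 2 * _ * x]mulrA E mulrA b1.
by rewrite !mulrA b1 -[gn 0 * gn 2 * _ * x]mulrA -E mulrA b0.
Qed.

(** Induction on the length of the word. A word that begins with E_2 is treated
    by following its maximal prefix E_2 E_3 ...: the next letter either extends
    the prefix, or shortens the word, or moves to the front, or is E_0 or E_1,
    in which case [agree01_2] applies. *)
Lemma agree01_word w : all (leq^~ n) w -> agree01 (W w * z).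
Proof.
have [m] := ubnP (size w); elim: m w => // m IH w wm wn.
have zD : agree01 z by rewrite /agree01 -{2}genN_01 // !mulrA !genN_sqr -!scalerAl genN_01.
(* The prefix is E_2 ... E_{k+2}, and v is what remains of the word. *)
have B v k : all (leq^~ n) v -> (k.+1 < n)%N -> (k.+1 + size v <= m)%N ->
    agree01 (W (iota 2 k.+1) * W v * z).
  elim: v k => [|j v IHv] k vn kn kv.
    rewrite wordN_nil mulr1 [iota _ _]/= wordN_cons -mulrA.
    have -> : W (iota 3 k) * z = z * W (iota 3 k).
      have c j : (j < 2)%N -> W (iota 3 k) * gn j = gn j * W (iota 3 k).
        move=> j2; apply: wordN_comm; first lia.
        by apply/allP => x; rewrite mem_iota /adjN; lia.
      by rewrite mulrA c // -!mulrA c.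
    rewrite mulrA; apply: agree01_r; rewrite /agree01.
    have b0 : gn 0 * gn 2 * gn 0 = gn 0 by apply: genN_braid => //; lia.
    have b1 : gn 1 * gn 2 * gn 1 = gn 1 by apply: genN_braid => //; lia.
    by rewrite !mulrA b0 -(mulrA (gn 1 * gn 2)) -{2}genN_01 // !mulrA b1 genN_01.
  case/andP: (vn) => jn vn'; rewrite [size _]/= in kv.
  have sz : (k.+1 + size v < m)%N by lia.
  have wi : all (leq^~ n) (iota 2 k.+1).
    by apply/allP => x; rewrite mem_iota; lia.
  have wi3 : all (leq^~ n) (iota 3 k).
    by apply/allP => x; rewrite mem_iota; lia.
  have D0 : agree01 (W (iota 2 k.+1) * W v * z).
    rewrite -wordN_cat; apply: IH; first by rewrite size_cat size_iota.
    by rewrite all_cat wi.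
  rewrite wordN_cons (mulrA (W (iota 2 _))).
  have [j2|j2] := ltnP j 2.
    rewrite [iota _ _]/= wordN_cons.
    have c : W (iota 3 k) * gn j = gn j * W (iota 3 k).
      apply: wordN_comm; first lia.
      by apply/allP => x; rewrite mem_iota /adjN; lia.
    rewrite -(mulrA (gn 2)) c (mulrA (gn 2)) -(mulrA _ (W (iota 3 _)) (W v)).
    rewrite -(mulrA (gn 2 * gn j)); apply: agree01_2 => //; first by lia.
    rewrite -wordN_cat; apply: IH; first by rewrite size_cat size_iota; lia.
    by rewrite all_cat wi3.
  have [jk|jk|jk] := ltngtP j k.+2; last first.
  - subst j; move: D0.
    rewrite iota_rcons wordN_rcons -(mulrA (W _) _ (gn k.+2)) genN_sqr -scalerAr -!scalerAl.
    exact: agree01_scale.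
  - have [jk1|jk1] := ltnP k.+3 j.
      rewrite wordN_comm //; last by apply/allP => x; rewrite mem_iota /adjN; lia.
      rewrite -(mulrA (gn j)) -(mulrA (gn j)); apply: agree01_far => //; lia.
    have ? : j = k.+3 by lia.
    subst j; have := IHv k.+1 vn' jn.
    by rewrite iota_rcons wordN_rcons; apply; lia.
  - have e : iota 2 k.+1 = iota 2 j.-1 ++ j.+1 :: iota j.+2 (k.+2 - j.+1).
      rewrite -[_ :: _]/(iota j.+1 (k.+2 - j.+1).+1).
      have e1 : (j.+1 = 2 + j.-1)%N by lia.
      by rewrite {1}e1 -iotaD; congr iota; lia.
    have e' : iota 2 j.-1 = rcons (iota 2 j.-2) j.
      by rewrite (_ : j.-1 = j.-2.+1) ?iota_rcons; [congr (rcons _ _) | ]; lia.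
    have c : W (iota j.+2 (k.+2 - j.+1)) * gn j = gn j * W (iota j.+2 (k.+2 - j.+1)).
      by apply: wordN_comm => //; apply/allP => x; rewrite mem_iota /adjN; lia.
    have -> : W (iota 2 k.+1) * gn j = W (iota 2 j.-1 ++ iota j.+2 (k.+2 - j.+1)).
      rewrite e !wordN_cat wordN_cons -!mulrA c e' wordN_rcons -!mulrA; congr (W _ * _).
      by rewrite !mulrA genN_braid //; [rewrite adjN_S| ]; lia.
    rewrite -wordN_cat; apply: IH.
      by rewrite !size_cat !size_iota; lia.
    rewrite !all_cat; move: wi; rewrite e all_cat [all _ (_ :: _)]/= => /and3P[-> _ ->].
    exact: vn'.
case: w wm wn => [|i w] wm; first by rewrite wordN_nil mul1r.
move=> /andP[ni wn]; have Dw : agree01 (W w * z) by apply: IH.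
rewrite wordN_cons -mulrA.
have [i2|i2] := ltnP i 2; first exact: agree01_01.
have [i3|i3] := ltnP 2 i; first by apply: agree01_far => //; lia.
have -> : i = 2 by lia.
by have := B w 0%N wn; rewrite [iota _ _]/= wordN_1 -mulrA; apply => //; lia.
Qed.

Lemma agree01_ideal a : ideal01 a -> agree01 a.
Proof.
suff H : ideal01 a -> forall y, agree01 (y * a) by move=> /H/(_ 1); rewrite mul1r.
elim=> [|{}a b _ h1 _ h2|c {}a _ h|b {}a _ h|b {}a _ h] y.
- elim: (word_span_all y) => [w|{}y y' _ h1 _ h2|c {}y _ h].
  + exact: agree01_word.
  + by rewrite mulrDl; move: h1 h2; rewrite /agree01 !mulrDr => -> ->.
  + by rewrite -scalerAl; apply: agree01_scale.
- by rewrite mulrDr; move: (h1 y) (h2 y); rewrite /agree01 !mulrDr => -> ->.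
- by rewrite -scalerAr; apply/agree01_scale/h.
- by rewrite mulrA.
- by rewrite mulrA; apply: agree01_r.
Qed.
Lemma agree01_ideal_r a : ideal01 a -> a * gn 0 = a * gn 1.
Proof.
move=> Ja; have /(congr1 star) := agree01_ideal (ideal01_star n0 Ja).
by rewrite !starM !star_genN starK.
Qed.

End Key.
End Star.

(** * The type A projector and the unit of the ideal *)

Section Scalars.
Variables (K : fieldType) (q : K).
Definition generic := q != 0 /\ forall k, (0 < k)%N -> q ^+ k != 1.
Hypothesis qg : generic.

Lemma qneq0 : q != 0. Proof. by case: qg. Qed.
Lemma q_denom : q - q^-1 != 0.
Proof.
case: qg => q0 h; rewrite subr_eq0; apply/eqP => E.
by have := h 2 isT; rewrite expr2 {1}E mulVf // eqxx.
Qed.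
Lemma qint_neq0 m : (0 < m)%N -> qint q m != 0.
Proof.
move=> m0; case: qg => q0 h; rewrite /qint mulf_neq0 ?invr_neq0 ?q_denom //.
rewrite subr_eq0; apply/eqP => E.
have := h (m + m)%N; rewrite exprD {1}E mulVf ?expf_neq0 // eqxx.
by rewrite addn_gt0 m0 => /(_ isT).
Qed.
Lemma qint0 : qint q 0 = 0. Proof. by rewrite /qint expr0 invr1 subrr mul0r. Qed.
Lemma qint1 : qint q 1 = 1. Proof. by rewrite /qint expr1 divff ?q_denom. Qed.
Lemma qint2 : qint q 2 = q + q^-1.
Proof.
have h := qneq0; rewrite /qint; apply: (canLR (mulfK q_denom)).
by field.
Qed.
Lemma qint_rec m : qint q m.+2 = qint q 2 * qint q m.+1 - qint q m.
Proof.
have h1 := qneq0; rewrite qint2 /qint mulrA -mulrBl; congr (_ / _).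
have h3 : q ^+ m != 0 by rewrite expf_neq0.
by rewrite !exprS; field; rewrite h1 h3.
Qed.

(** The scalar with which g_{m,i} E_j contributes to g_{m,j} when i and j are
    equal or adjacent. *)
Definition step_coef (i j : nat) : K := if i == j then - qint q 2 else (adjN i j)%:R.
Definition step_sum (M : nat) (b : nat -> K) j := \sum_(0 <= i < M) step_coef i j * b i.

Lemma sum_support (s : seq nat) M (F : nat -> K) : uniq s -> all (ltn^~ M) s ->
  (forall i, (i < M)%N -> i \notin s -> F i = 0) ->
  \sum_(0 <= i < M) F i = \sum_(i <- s) F i.
Proof.
move=> us sM h; rewrite (bigID (mem s)) /= [X in _ + X]big1_seq ?addr0; last first.
  by move=> i /andP[/= ni]; rewrite mem_index_iota => /andP[_ iM]; apply: h.
rewrite -big_filter; apply: perm_big; apply: uniq_perm => //.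
  by rewrite filter_uniq // iota_uniq.
move=> i; rewrite mem_filter mem_index_iota /=; case: (boolP (i \in s)) => //= is_.
by have /= -> := allP sM _ is_.
Qed.

Lemma step_sumE M b j : (j.+1 < M)%N -> (0 < j)%N || (2 < M)%N ->
  step_sum M b j = match j with
    | 0 => b 2%N - qint q 2 * b 0%N
    | 1 => b 2%N - qint q 2 * b 1%N
    | 2 => b 0%N + b 1%N + b 3%N - qint q 2 * b 2%N
    | j'.+1 => b j' + b j.+1 - qint q 2 * b j
    end.
Proof.
rewrite /step_sum => jM jM'.
have far0 i : i != j -> ~~ adjN i j -> step_coef i j * b i = 0.
  by rewrite /step_coef => /negPf-> /negPf->; rewrite mul0r.
case: j jM jM' far0 => [|[|[|j]]] jM jM' far0.
- have sM : all (ltn^~ M) [:: 0; 2]%N by move: jM jM' => /=; lia.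
  rewrite (sum_support _ sM) //; last first.
    by move=> i iM; rewrite !inE ?negb_or => h; apply: far0 => //; rewrite /adjN; lia.
  by rewrite !big_cons big_nil /step_coef /=; ring.
- have sM : all (ltn^~ M) [:: 1; 2]%N by move: jM jM' => /=; lia.
  rewrite (sum_support _ sM) //; last first.
    by move=> i iM; rewrite !inE ?negb_or => h; apply: far0 => //; rewrite /adjN; lia.
  by rewrite !big_cons big_nil /step_coef /=; ring.
- have sM : all (ltn^~ M) [:: 0; 1; 2; 3]%N by move: jM jM' => /=; lia.
  rewrite (sum_support _ sM) //; last first.
    by move=> i iM; rewrite !inE ?negb_or => h; apply: far0 => //; rewrite /adjN; lia.
  by rewrite !big_cons big_nil /step_coef /=; ring.
- have sM : all (ltn^~ M) [:: j.+2; j.+3; j.+4]%N by move: jM jM' => /=; lia.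
  have us : uniq [:: j.+2; j.+3; j.+4]%N by rewrite /= !inE; lia.
  rewrite (sum_support us sM) //; last first.
    by move=> i iM; rewrite !inE ?negb_or => h; apply: far0 => //; rewrite /adjN; lia.
  rewrite !big_cons big_nil /step_coef !eqxx.
  have -> : (j.+2 == j.+3) = false by lia.
  have -> : (j.+4 == j.+3) = false by lia.
  have -> : adjN j.+2 j.+3 by rewrite /adjN; lia.
  have -> : adjN j.+4 j.+3 by rewrite /adjN; lia.
  by rewrite /=; ring.
Qed.
End Scalars.

Lemma shift_letter_gt0 i j : far i j -> (0 < i)%N -> (0 < j)%N -> (0 < shift_letter i j)%N.
Proof.
case/farP => [|k|{}i k ik|{}i|{}i k ik] //= _ _; rewrite /shift_letter /=.
  by case: ifP; lia.
by case: ifP; lia.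
Qed.

Section Rec.
Variables (K : fieldType) (q : K) (n : nat).
Notation A := (TLD q n).
Notation gn := (genN q n).
Notation W := (wordN q n).
Notation d2 := (- qint q 2).

Definition cap_sum m (b : nat -> K) : A := \sum_(0 <= i < m.+2) b i *: W (capword m i).

(** For I the zero ideal this builds the type A projector, and for I the ideal
    of E_0 E_1 the type D projector up to the ideal. The terms with i equal or
    adjacent to j cancel by the relation on b; the others are handled one at a
    time. *)
Lemma cap_sum_step m b j X (I : A -> Prop) :
  I 0 -> (forall x y, I x -> I y -> I (x + y)) ->
  (0 < m <= n)%N -> (j <= m)%N ->
  (forall i, (i + j = 1)%N -> I (b i *: (X * (W (capword m i) * gn j)))) ->
  (forall i, far i j -> (i <= m.+1)%N -> I (b i *: (X * (gn (shift_letter i j) * W (capword m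
    i))))) ->
  step_sum q m.+2 b j = 0 ->
  I (X * cap_sum m b * gn j).
Proof.
move=> I0 ID /andP[m0 mn] jm h1 h2 hs.
suff -> : X * cap_sum m b * gn j = \sum_(0 <= i < m.+2)
    b i *: (X * (W (capword m i) * gn j - step_coef q i j *: W (capword m j))).
  rewrite big_seq; apply: big_ind => // i; rewrite mem_index_iota => /andP[_ im].
  rewrite /step_coef; have [->|/eqP nij] := i =P j.
    by rewrite capword_gen_same // subrr mulr0 scaler0.
  case: (boolP (adjN i j)) => a.
    by rewrite capword_gen_adj // scale1r subrr mulr0 scaler0.
  rewrite scale0r subr0; case: (boolP (i + j == 1)%N) => [/eqP|] ij; first exact: h1.
  have f : far i j by rewrite /far nij a.
  by rewrite capword_gen_far //; apply: h2.
transitivity (\sum_(0 <= i < m.+2) (b i *: (X * (W (capword m i) * gn j)) - (step_coef q i j *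
  b i) *: (X * W (capword m j)))).
  rewrite sumrB -scaler_suml -/(step_sum q m.+2 b j) hs scale0r subr0 /cap_sum mulr_sumr
    mulr_suml.
  by apply: eq_bigr => i _; rewrite -scalerAr -scalerAl mulrA.
by apply: eq_bigr => i _; rewrite mulrBr scalerBr -scalerAr scalerA [b i * _]mulrC.
Qed.

Lemma capword_neq_nil m i : (0 < m)%N -> (i <= m)%N -> capword m i <> [::].
Proof.
move=> m0 im; case: (posnP i) => [->|i0].
  by rewrite capword_0 //; case: (capword m 2).
by rewrite capword_rcons ?i0 //; case: (capword m i.+1).
Qed.

Lemma eps_cap_sum m b : (0 < m)%N -> eps (cap_sum m b) = b m.+1.
Proof.
move=> m0; rewrite /cap_sum eps_sum big_nat_recr //= epsZ eps_wordN capword_top eqxx mulr1.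
rewrite big_nat big1 ?add0r // => i /andP[_ im]; rewrite epsZ eps_wordN.
by case: eqP => [/capword_neq_nil|_]; rewrite ?mulr0 //; case.
Qed.

Hypothesis qg : generic q.

(** The recursion of Jones and Wenzl, P_m = P_{m-1} sum_i ([i] / [m+1])
    g_{m,i}; the relation on the coefficients is the recursion of the quantum
    integers. *)
Lemma jones_wenzl_right m : (m <= n)%N -> exists P : A,
  [/\ word_span (fun x => 0 < x <= m)%N P, eps P = 1
    & forall j, (0 < j <= m)%N -> P * gn j = 0].
Proof.
elim: m => [|m IH] mn.
  exists 1; split; [exact: word_span_1 | exact: eps1 | move=> j; lia].
have [P [SP eP kP]] := IH (ltnW mn).
pose b i : K := qint q i / qint q m.+2.
have b0 : b 0%N = 0 by rewrite /b qint0 mul0r.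
exists (P * cap_sum m.+1 b); split.
- apply: word_span_mul.
    elim: SP => [w Pw|x y _ h1 _ h2|a x _ h].
    + by apply: word_span_wordN; apply: sub_all Pw => x; lia.
    + exact: word_span_add.
    + exact: word_span_scale.
  apply: word_span_sum => i _; case: (posnP i) => [->|i0].
    by rewrite b0 scale0r; exact: word_span_0.
  apply/word_span_scale/word_span_wordN/allP => x /mem_capword; lia.
- by rewrite epsM eP mul1r eps_cap_sum // /b divff // qint_neq0.
- move=> j /andP[j0 jm].
  apply: (@cap_sum_step m.+1 b j P (fun x => x = 0)) => //.
  + by move=> x y -> ->; rewrite addr0.
  + move=> i ij; have -> : i = 0%N by lia.
    by rewrite b0 scale0r.
  + move=> i fij im; case: (posnP i) => [->|i0]; first by rewrite b0 scale0r.
    have l1 : (shift_letter i j < m.+1)%N by apply: shift_letter_lt.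
    have l2 : (0 < shift_letter i j)%N by exact: shift_letter_gt0.
    by rewrite mulrA kP ?mul0r ?scaler0 // l2.
  + have jm2 : (j.+1 < m.+3)%N by lia.
    rewrite step_sumE //; last by rewrite j0.
    have e3 : b 3%N = qint q 2 * b 2%N - b 1%N by rewrite /b (qint_rec qg 1) mulrBl mulrA.
    case: j j0 jm jm2 => [|[|[|j]]] // _ jm _.
    * by rewrite /b qint1 // mulrA mulr1 subrr.
    * by rewrite b0 e3; ring.
    * by rewrite /b (qint_rec qg j.+2); ring.
Qed.

(** An element killed by generators is multiplied by the constant term. *)
Lemma word_span_killr (P : pred nat) (X x : A) : (forall j,
  P j -> X * gn j = 0) -> word_span P x -> X * x = eps x *: X.
Proof.
move=> h; elim=> [w Pw|{}x y _ h1 _ h2|a {}x _ h1].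
- rewrite eps_wordN; case: w Pw => [|j w]; first by rewrite wordN_nil mulr1 scale1r.
  by case/andP=> Pj _; rewrite wordN_cons mulrA h // mul0r scale0r.
- by rewrite mulrDr h1 h2 epsD scalerDl.
- by rewrite -scalerAr h1 epsZ scalerA.
Qed.

Lemma star_killr (P : pred nat) (X : A) : (forall j, P j -> X * gn j = 0) ->
  forall j, P j -> gn j * star X = 0.
Proof. by move=> h j Pj; rewrite -(star_genN q n j) -starM h // star0. Qed.
Lemma star_killl (P : pred nat) (X : A) : (forall j, P j -> gn j * X = 0) ->
  forall j, P j -> star X * gn j = 0.
Proof. by move=> h j Pj; rewrite -(star_genN q n j) -starM h // star0. Qed.

(** The product of a right projector with its image under the anti-involution
    is killed on both sides. *)
Lemma jones_wenzl : exists P : A, [/\ word_span (fun x => 0 < x <= n)%N P, eps P = 1,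
   forall j, (0 < j <= n)%N -> P * gn j = 0 & forall j, (0 < j <= n)%N -> gn j * P = 0].
Proof.
have [P [SP eP kP]] := jones_wenzl_right (leqnn n).
exists (P * star P); split.
- exact/word_span_mul/word_span_star.
- by rewrite epsM eps_star eP mulr1.
- move=> j jn; rewrite (word_span_killr kP (word_span_star SP)) -scalerAl kP ?scaler0 //.
- move=> j jn; have := @star_killr _ _ kP j jn.
  have -> : P * star P = star P.
    have := congr1 (@star _ _ _) (word_span_killr kP (word_span_star SP)).
    by rewrite starM starK starZ eps_star eP scale1r.
  by [].
Qed.

Section Unit.
Hypothesis n0 : (0 < n)%N.

(** Multiplication by y on the ideal is multiplication by one of its
    elements. *)
Definition acts_as_ideal01 (y : A) := exists2 j, ideal01 j & forall a,
  ideal01 a -> y * a = j * a /\ a * y = a * j.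
Lemma acts_as_ideal01_0 : acts_as_ideal01 0.
Proof. by exists 0 => //; exact: ideal01_0. Qed.
Lemma acts_as_ideal01_add x y : acts_as_ideal01 x -> acts_as_ideal01 y -> acts_as_ideal01 (x +
  y).
Proof.
move=> [i Ji hi] [j Jj hj]; exists (i + j); first exact: ideal01_add.
by move=> a Ja; have [h1 h2] := hi _ Ja; have [h3 h4] := hj _ Ja;
  rewrite !mulrDl !mulrDr h1 h2 h3 h4.
Qed.
Lemma acts_as_ideal01_scale c x : acts_as_ideal01 x -> acts_as_ideal01 (c *: x).
Proof.
move=> [i Ji hi]; exists (c *: i); first exact: ideal01_scale.
by move=> a Ja; have [h1 h2] := hi _ Ja; rewrite -!scalerAl -!scalerAr h1 h2.
Qed.
Lemma acts_as_ideal01_l c x : acts_as_ideal01 x -> acts_as_ideal01 (c * x).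
Proof.
move=> [i Ji hi]; exists (c * i); first exact: ideal01_l.
move=> a Ja; have [h1 _] := hi _ Ja; have [_ h2] := hi _ (ideal01_r c Ja).
by rewrite -!mulrA h1 !mulrA h2.
Qed.
Lemma acts_as_ideal01_r c x : acts_as_ideal01 x -> acts_as_ideal01 (x * c).
Proof.
move=> [i Ji hi]; exists (i * c); first exact: ideal01_r.
move=> a Ja; have [h1 _] := hi _ (ideal01_l c Ja); have [_ h2] := hi _ Ja.
by rewrite -!mulrA h1 !mulrA h2.
Qed.
(** For a in the ideal, E_0 E_1 a = E_1 E_1 a = - [2] E_1 a, so E_1 acts as a
    multiple of E_0 E_1; the next generators follow from E_{k+1} = E_{k+1} E_k
    E_{k+1}. *)
Lemma acts_as_ideal01_genN k : (0 < k <= n)%N -> acts_as_ideal01 (gn k).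
Proof.
have d0 : d2 != 0 by rewrite oppr_eq0 qint_neq0.
elim: k => // k IH /andP[_ kn]; case: (posnP k) => [->|k0].
  exists (d2^-1 *: (gn 0 * gn 1)); first exact/ideal01_scale/ideal01_gen.
  move=> a Ja; rewrite -scalerAl -scalerAr; split.
    rewrite -mulrA [gn 0 * _](agree01_ideal n0 (ideal01_l _ Ja)) mulrA genN_sqr -scalerAl
      scalerA mulVf ?scale1r //.
  by rewrite mulrA (agree01_ideal_r n0 Ja) -mulrA genN_sqr -scalerAr scalerA mulVf ?scale1r.
rewrite -(@genN_braid _ _ _ k.+1 k); [|by rewrite /adjN; lia|by []|by lia].
by apply/acts_as_ideal01_r/acts_as_ideal01_l/IH; rewrite k0 ltnW.
Qed.
Lemma acts_as_ideal01_span x : word_span (fun x => 0 < x <= n)%N x -> acts_as_ideal01 (x - eps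
  x *: 1).
Proof.
elim=> [w Pw|{}x y _ h1 _ h2|a {}x _ h1].
- rewrite eps_wordN; case: w Pw => [|j w]; first by rewrite wordN_nil scale1r subrr => _;
  exact: acts_as_ideal01_0.
  by case/andP=> Pj _; rewrite scale0r subr0 wordN_cons;
    apply/acts_as_ideal01_r/acts_as_ideal01_genN.
- by rewrite epsD scalerDl opprD addrACA; apply: acts_as_ideal01_add.
- by rewrite epsZ -scalerA -scalerBr; apply: acts_as_ideal01_scale.
Qed.

(** In front of an element of the ideal E_0 can be replaced by E_1, so that any
    word there begins with a letter killed by P. *)
Lemma kill_ideal01 (P : A) : (forall j, (0 < j <= n)%N -> P * gn j = 0) -> forall a,
  ideal01 a -> P * a = 0.
Proof.
move=> kP; suff H a : ideal01 a -> forall y, P * (y * a) = 0.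
  by move=> a /H/(_ 1); rewrite mul1r.
have k1 : P * gn 1 = 0 by apply: kP.
elim=> [|{}a b _ h1 _ h2|c {}a _ h|b {}a _ h|b {}a _ h] y.
- elim: (word_span_all y) => [w wn|{}y y' _ h1 _ h2|c {}y _ h].
  + case: w wn => [|j w]; first by rewrite wordN_nil mul1r -genN_01 // mulrA k1 mul0r.
    case/andP=> jn wn; rewrite wordN_cons -mulrA; case: (posnP j) => [->|j0].
      by rewrite (agree01_ideal n0 (ideal01_l _ (ideal01_gen _ _))) mulrA k1 mul0r.
    by rewrite mulrA kP ?mul0r // j0.
  + by rewrite mulrDl mulrDr h1 h2 addr0.
  + by rewrite -scalerAl -scalerAr h scaler0.
- by rewrite mulrDr mulrDr h1 h2 addr0.
- by rewrite -scalerAr -scalerAr h scaler0.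
- by rewrite (mulrA y) h.
- by rewrite (mulrA y) (mulrA P) h mul0r.
Qed.

(** The type A projector P kills the ideal, so 1 - P acts on it as the
    identity; and it acts as an element of the ideal, because its constant term
    is zero. *)
Lemma ideal01_unit : exists2 f : A, ideal01 f & forall a, ideal01 a -> f * a = a /\ a * f = a.
Proof.
have [P [SP eP kP1 kP2]] := jones_wenzl.
have [f Jf hf] : acts_as_ideal01 (1 - P).
  have := acts_as_ideal01_scale (-1) (acts_as_ideal01_span SP).
  by rewrite eP scale1r scaleN1r opprB.
exists f => // a Ja; have [<- <-] := hf _ Ja.
rewrite mulrBl mulrBr mul1r mulr1 (kill_ideal01 kP1 Ja).
have := kill_ideal01 (star_killl kP2) (ideal01_star n0 Ja);
  rewrite -starM => /(congr1 (@star _ _ _)).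
by rewrite starK star0 => ->; rewrite !subr0.
Qed.
End Unit.
End Rec.

(** * Existence and recursion of the projector *)

Section Embed.
Variables (K : fieldType) (q : K) (m n : nat).
Hypothesis mn : (m <= n)%N.

Definition embed_gen (i : 'I_m.+1) : TLD q n := genN q n i.
(** The map TL^D_{m+1} -> TL^D_{n+1}, from the universal property of the
    presentation. *)
Definition embed (x : TLD q m) : TLD q n := tld_eval embed_gen (repr x).

Lemma embed_gen_rel : tld_relations q embed_gen.
Proof.
split=> [i|i j ij|i j ij nij]; rewrite /embed_gen.
- exact: genN_sqr.
- by apply: genN_braid; [exact: ij | rewrite (leq_trans _ mn) // -ltnS ltn_ord ..].
- by apply: genN_comm; [exact: nij | rewrite (leq_trans _ mn) // -ltnS ltn_ord ..].
Qed.
Lemma embed_pi t : embed (\pi_(TLD q m) t) = tld_eval embed_gen t.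
Proof. exact: tld_evalP embed_gen_rel (tld_repr_pi q t). Qed.
Lemma embedD x y : embed (x + y) = embed x + embed y.
Proof. by elim/tld_ind: x => t; elim/tld_ind: y => u; rewrite -pi_add !embed_pi. Qed.
Lemma embedM x y : embed (x * y) = embed x * embed y.
Proof. by elim/tld_ind: x => t; elim/tld_ind: y => u; rewrite -pi_mul !embed_pi. Qed.
Lemma embed1 : embed 1 = 1.
Proof. by rewrite -[1 in LHS]scale1r -pi_scal embed_pi /= scale1r. Qed.
Lemma embedZ a x : embed (a *: x) = a *: embed x.
Proof. by rewrite -mulr_algl -pi_scal embedM embed_pi /= mulr_algl. Qed.
Lemma embed0 : embed 0 = 0.
Proof. by rewrite -(scale0r 1) embedZ scale0r. Qed.
Lemma embed_genN j : (j <= m)%N -> embed (genN q m j) = genN q n j.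
Proof. by move=> jm; rewrite [LHS]embed_pi /= /embed_gen inordK. Qed.
Lemma embed_wordN w : all (leq^~ m) w -> embed (wordN q m w) = wordN q n w.
Proof.
elim: w => [|j w IH]; first by rewrite !wordN_nil embed1.
by case/andP=> jm wm; rewrite !wordN_cons embedM embed_genN // IH.
Qed.
Lemma eps_embed x : eps (embed x) = eps x.
Proof.
elim: (word_span_all x) => [w wm|{}x y _ h1 _ h2|a {}x _ h].
- by rewrite embed_wordN // !eps_wordN.
- by rewrite embedD !epsD h1 h2.
- by rewrite embedZ !epsZ h.
Qed.
Lemma fun_act_embed x f D : fun_act (embed x) f D = fun_act x f D.
Proof.
elim: (word_span_all x) => [w wm|{}x y _ h1 _ h2|a {}x _ h].
- by rewrite embed_wordN // !fun_act_wordN //; apply: sub_all wm => j jm; apply: leq_trans mn.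
- by rewrite embedD !fun_actD h1 h2.
- by rewrite embedZ !fun_actZ h.
Qed.
Lemma embed_sub x : TLD_sub m (embed x).
Proof.
move=> S [S1 Slin SM] cap_sum; elim: (word_span_all x) => [w|{}x y _ h1 _ h2|a {}x _ h].
- elim: w => [|j w IH]; first by rewrite wordN_nil embed1.
  case/andP=> jm wm; rewrite wordN_cons embedM; apply: SM; last exact: IH.
  by rewrite embed_genN //; apply: cap_sum; rewrite inordK // ltnS (leq_trans jm).
- by rewrite embedD -[embed x]scale1r; apply: Slin.
- have S0 : 0 \in S by have := Slin (-1) _ _ S1 S1; rewrite scaleN1r addNr.
  by rewrite embedZ -[_ *: _]addr0; apply: Slin.
Qed.
End Embed.

Section Proj.
Variables (K : fieldType) (q : K).
Hypothesis qg : generic q.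

(** The normalisation eps Q = 1 replaces Q <> 0 and Q Q = Q, and it is stable
    under the embeddings. For n = 0 the diagram algebra of one strand is meant,
    which consists of scalars. *)
Definition is_proj n (Q : TLD q n) : Prop :=
  eps Q = 1 /\ if n is 0 then Q = 1
    else forall j, (j <= n)%N -> genN q n j * Q = 0 /\ Q * genN q n j = 0.

(** The words for the dotted and the undotted cap at position 1 have the same
    coefficient. *)
Definition cap_weight n i : K := coef_g q n (maxn i 1%N).

Lemma qint_double m : qint q (2 * m) = qint q m * (q ^+ m + q ^- m).
Proof.
have q0 := qneq0 qg; have h3 : q ^+ m != 0 by rewrite expf_neq0.
rewrite mul2n -addnn /qint exprD mulrAC; congr (_ / _); field; exact: h3.
Qed.
(** In this form, (q^{i-1} + q^{1-i}) [n] / [2n] for i >= 2 and half of the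
    value at i = 1 for each of the two words there, the relations
    [cap_weight_step_sum] are visible. *)
Lemma cap_weightE n i : (0 < n)%N ->
  cap_weight n i = qint q n / qint q (2 * n) * (if (i <= 1)%N then 1 else q ^+ i.-1 + q ^-
    i.-1).
Proof.
move=> n0; rewrite /cap_weight /coef_g; case: (leqP i 1%N) => i1.
  by rewrite eqxx mulr1.
rewrite ifF; last by lia.
rewrite (_ : 2 * i - 2 = 2 * i.-1)%N; last by lia.
have h1 : qint q (2 * n) != 0 by apply: qint_neq0; rewrite ?muln_gt0.
have h2 : qint q i.-1 != 0 by apply: qint_neq0 => //; lia.
by rewrite (qint_double i.-1); field; rewrite ?h1 ?h2 ?expf_neq0 ?(qneq0 qg).
Qed.
Lemma cap_weight_top n : (0 < n)%N -> cap_weight n n.+1 = 1.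
Proof.
move=> n0; rewrite cap_weightE // ifF; last by lia.
have h2 : qint q n != 0 by apply: qint_neq0.
have h1 : qint q (2 * n) != 0 by apply: qint_neq0; rewrite ?muln_gt0.
move: h1; rewrite qint_double mulf_eq0 => /norP[_]; rewrite /=.
by set s := q ^+ n + q ^- n => h3; field; rewrite h2 h3.
Qed.
Lemma cap_weight_step_sum n j : (0 < n)%N -> (j <= n)%N -> step_sum q n.+2 (cap_weight n) j = 0.
Proof.
move=> n0 jn; have q0 := qneq0 qg.
rewrite step_sumE //; last by rewrite !ltnS n0 orbT.
case: j jn => [|[|[|j]]] jn; rewrite !cap_weightE //= qint2 //.
- by rewrite expr1; ring.
- by rewrite expr1; ring.
- by set c := qint q n / _; field.
- set c := qint q n / _; have h3 : q ^+ j != 0 by rewrite expf_neq0.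
  by rewrite !exprS; field; rewrite q0 h3.
Qed.

Section Q.
Variable n : nat.
Hypothesis n0 : (0 < n)%N.
Notation A := (TLD q n).
Notation gn := (genN q n).
Notation W := (wordN q n).

Lemma word_span_killl (P : pred nat) (X x : A) :
  (forall j, P j -> gn j * X = 0) -> word_span P x -> x * X = eps x *: X.
Proof.
move=> h Sx; have := word_span_killr (star_killl h) (word_span_star Sx).
by move=> /(congr1 (@star _ _ _)); rewrite starM !starK starZ starK eps_star.
Qed.

(** The analogue of [word_span_killr] modulo the ideal. *)
Lemma killr_mod_ideal01 (X x : A) : (forall j, (j <= n)%N -> ideal01 (X * gn j)) ->
  ideal01 (X * x - eps x *: X).
Proof.
move=> h; elim: (word_span_all x) => [w|{}x y _ h1 _ h2|a {}x _ h1].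
- rewrite eps_wordN; case: w => [|j w]; first by rewrite wordN_nil mulr1 scale1r subrr => _;
  exact: ideal01_0.
  by case/andP=> jn _; rewrite scale0r subr0 wordN_cons mulrA; apply/ideal01_r/h.
- by rewrite mulrDr epsD scalerDl opprD addrACA; apply: ideal01_add.
- by rewrite -scalerAr epsZ -scalerA -scalerBr; apply: ideal01_scale.
Qed.

Lemma proj_cap_sum_step (Q' : TLD q n.-1) : is_proj Q' -> forall j, (j <= n)%N ->
  ideal01 (embed n Q' * cap_sum q n n (cap_weight n) * gn j).
Proof.
move=> [_ hQ'] j jn; apply: (@cap_sum_step _ _ n n) => //.
- exact: ideal01_0.
- exact: ideal01_add.
- by rewrite n0 leqnn.
- by move=> i ij; apply/ideal01_scale/ideal01_l/capword_gen_01.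
- move=> i fij im; have ln : (shift_letter i j < n)%N by exact: shift_letter_lt.
  rewrite mulrA -(@embed_genN _ _ n.-1) ?leq_pred //; last by lia.
  rewrite -embedM ?leq_pred //.
  suff -> : Q' * genN q n.-1 (shift_letter i j) = 0 by rewrite embed0 ?leq_pred // mul0r
    scaler0; exact: ideal01_0.
  case: n Q' hQ' n0 ln im jn => // [[|m]] Q' hQ' _ ln im jn.
    by move: fij; rewrite /far /adjN; lia.
  by have [|_ ->] := hQ' (shift_letter i j) _; first by lia.
- exact: cap_weight_step_sum.
Qed.

(** Computing the product Q' S Q, where S is the sum of the words: Q absorbs
    what is on its left, while Q' S absorbs Q modulo the ideal. *)
Lemma proj_rec (Q : A) (Q' : TLD q n.-1) : is_proj Q -> is_proj Q' ->
  ideal01 (Q - embed n Q' * cap_sum q n n (cap_weight n)).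
Proof.
move=> [eQ hQ] iQ'; set X := embed _ _ * _.
have eX : eps X = 1.
  by rewrite epsM eps_embed ?leq_pred // eps_cap_sum // cap_weight_top // mulr1; case: iQ'.
have kQ j : (j <= n)%N -> gn j * Q = 0 by case: n n0 Q hQ {eQ} X eX => // m _ Q hQ X eX /hQ[].
have := killr_mod_ideal01 Q (proj_cap_sum_step iQ').
by rewrite (word_span_killl kQ (word_span_all X)) eX eQ !scale1r.
Qed.
End Q.

(** Multiplication by 1 - f, for the unit f of the ideal, turns vanishing
    modulo the ideal into vanishing. *)
Lemma proj_ex n : exists Q : TLD q n, is_proj Q.
Proof.
elim: n => [|n [Q' hQ']]; first by exists 1; split; rewrite ?eps1.
have [f Jf hf] := ideal01_unit qg (ltn0Sn n).
pose X := embed n.+1 Q' * cap_sum q n.+1 n.+1 (cap_weight n.+1).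
have kX j : (j <= n.+1)%N -> ideal01 (X * genN q n.+1 j) by apply: (@proj_cap_sum_step n.+1).
pose Y := (1 - f) * X.
have kY j : (j <= n.+1)%N -> Y * genN q n.+1 j = 0.
  move=> /kX/hf[h _]; by rewrite /Y -mulrA mulrBl mul1r h subrr.
have eY : eps Y = 1.
  rewrite /Y epsM epsD eps1 -scaleN1r epsZ (ideal01_eps Jf) mulr0 addr0 mul1r.
  by rewrite epsM eps_embed // eps_cap_sum // cap_weight_top // mulr1; case: hQ'.
have sY := word_span_killr kY (word_span_star (word_span_all Y)).
have e : Y * star Y = Y by rewrite sY eps_star eY scale1r.
have e' : Y * star Y = star Y.
  by have := congr1 (@star _ _ _) e; rewrite starM starK.
exists Y; split=> // j jn; split; last exact: kY.
by rewrite -e e'; apply: (star_killr kY).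
Qed.

Lemma is_proj_embed m n (Q : TLD q m.+1) j : (m < n)%N -> is_proj Q -> (j <= m.+1)%N ->
  genN q n j * embed n Q = 0 /\ embed n Q * genN q n j = 0.
Proof.
move=> mn [_ hQ] jm; have [h1 h2] := hQ j jm.
by rewrite -(@embed_genN _ _ m.+1) // -!embedM // h1 h2 embed0.
Qed.

Lemma genE_genN n (i : 'I_n.+1) : genE q i = genN q n i.
Proof. by rewrite /genN inord_val. Qed.

(** The family of projectors exists by [proj_ex], and a nonzero idempotent
    killed by all generators has constant term 1. *)
Lemma is_proj_projector n : (0 < n)%N -> is_proj (projector q n).
Proof.
case: n => // n _; have d0 : qint q 2 != 0 by exact: qint_neq0.
pose E0 := genN q n.+1 0.
have E00 : E0 * E0 = - qint q 2 *: E0 by exact: genN_sqr.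
(* The projector of the algebra generated by E_0, which is the first member of
   the family. *)
pose Q0 : TLD q n.+1 := 1 + (qint q 2)^-1 *: E0.
have kQ0 : E0 * Q0 = 0 /\ Q0 * E0 = 0.
  by rewrite /Q0 mulrDl mulrDr mul1r mulr1 -scalerAl -scalerAr E00 scalerA mulrN mulVf //
    scaleN1r subrr.
pose F m : TLD q n.+1 := if m is m'.+1 then embed n.+1 (projT1 (cid (proj_ex m'.+1))) else Q0.
have F1 m : (m <= n.+1)%N -> eps (F m) = 1.
  case: m => [|m] mn; first by rewrite epsD epsZ eps_genN mulr0 addr0 eps1.
  by rewrite /F; case: cid => Q [eQ _] /=; rewrite eps_embed.
have Fk m j : (m <= n.+1)%N -> (j <= m)%N -> genN q n.+1 j * F m = 0 /\ F m * genN q n.+1 j = 0.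
  case: m => [|m] mn jm; first by move: jm; rewrite leqn0 => /eqP->.
  by rewrite /F; case: cid => Q iQ /=; exact: is_proj_embed.
have Fs m : (m <= n.+1)%N -> word_span (leq^~ m) (F m).
  case: m => [|m] mn.
    by apply: word_span_add; [exact: word_span_1 | apply: word_span_scale;
      rewrite /E0 -wordN_1; exact: word_span_wordN].
  rewrite /F; case: cid => Q iQ /=.
  elim: (word_span_all Q) => [w wm|x y _ h1 _ h2|a x _ h].
  - by rewrite embed_wordN //; apply: word_span_wordN.
  - by rewrite embedD //; apply: word_span_add.
  - by rewrite embedZ //; apply: word_span_scale.
have Fsub m : (m <= n.+1)%N -> TLD_sub m (F m).
  case: m => [|m] mn; last exact: embed_sub.
  move=> S [S1 Slin SM] cap_sum; rewrite /F /Q0 addrC; apply: Slin => //.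
  by apply: cap_sum; rewrite inordK.
have Ffam : projector_family F.
  move=> m mn; split.
  - exact: Fsub.
  - apply/eqP => F0; have := F1 m mn; rewrite F0 eps0 => /esym/eqP.
    by rewrite oner_eq0.
  - move=> k km; have kn := leq_trans km mn; split.
      rewrite (@word_span_killr _ _ _ (leq^~ k) _ _ _ (Fs k kn)) ?F1 ?scale1r //.
      by move=> j jk; case: (Fk m j mn (leq_trans jk km)).
    rewrite (@word_span_killl _ (leq^~ k) _ _ _ (Fs k kn)) ?F1 ?scale1r //.
    by move=> j jk; case: (Fk m j mn (leq_trans jk km)).
  - by move=> i im; rewrite genE_genN; exact: Fk.
rewrite /projector; case: classical_sets.xgetP => [Q _ [Q' fam ->]|/(_ (F n.+1))]; last first.
  by case; exists F.
have [_ Qn0 Qid Qk] := fam _ (leqnn n.+1).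
have kill j : (j <= n.+1)%N -> genN q n.+1 j * Q' n.+1 = 0 /\ Q' n.+1 * genN q n.+1 j = 0.
  by move=> jn; have := Qk (inord j); rewrite inordK ?ltnS //; apply.
split; last exact: kill.
have [QQ _] := Qid _ (leqnn _).
have := @word_span_killr _ _ _ (leq^~ n.+1) (Q' n.+1) _ (fun j h => (kill j h).2)
  (word_span_all (Q' n.+1)).
rewrite QQ -{1}[Q' _]scale1r => /eqP; rewrite -subr_eq0 -scalerBl.
move=> /eqP E; apply/eqP; apply: contraNT Qn0 => ne.
rewrite -[Q' _](scalerK (a := 1 - eps (Q' n.+1))) ?E ?scaler0 //.
by rewrite subr_eq0 eq_sym.
Qed.
End Proj.

(** * Coefficients at reduced words *)

(** Each chord is counted at its smaller end. *)
Definition dot_parity N D : bool :=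
  \big[addb/false]_(x <- iota 0 (2 * N)) ((x < mate D x)%N && dotted D x).
Definition closed_below N D := forall x, (x < 2 * N)%N -> (mate D x < 2 * N)%N.

Lemma closed_contract N s k D : (k.+1 < 2 * N)%N -> closed_below N D -> closed_below N
  (contract s k D).
Proof.
move=> kN cD x xN /=; rewrite /contract_mate; have := cD k (ltnW kN); have := cD _ kN;
  have := cD _ xN.
by repeat case: eqP => _; lia.
Qed.

Lemma big_addb_split (s : seq nat) M (F : nat -> bool) : uniq s -> all (ltn^~ M) s ->
  \big[addb/false]_(x <- iota 0 M) F x =
  (\big[addb/false]_(x <- s) F x) (+) \big[addb/false]_(x <- iota 0 M | x \notin s) F x.
Proof.
move=> us sM; rewrite (bigID (mem s)) /=; congr (_ (+) _).
rewrite -big_filter; apply: perm_big; apply: uniq_perm => //.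
  by rewrite filter_uniq // iota_uniq.
move=> i; rewrite mem_filter mem_iota /=; case: (boolP (i \in s)) => //= is_.
by have /= -> := allP sM _ is_.
Qed.

Lemma ltn_neg x y : x <> y -> (x < y)%N = ~~ (y < x)%N.
Proof. by lia. Qed.

(** The two merged strands keep the sum of their dots, and the cup and the cap
    of the generator are dotted together; so dots are lost only with a loop. *)
Lemma dot_parity_contract N s k D : (k.+1 < 2 * N)%N -> closed_below N D ->
  dot_parity N (contract s k D) = dot_parity N D (+) (looped k D && (dotted D k (+) s)).
Proof.
move=> kN cD; rewrite /dot_parity.
have kk : k <> k.+1 by lia.
have ck := cD k (ltnW kN); have ck1 := cD _ kN.
have kk1 : (k.+1 == k) = false by lia.
have kk2 : (k.+1 < k)%N = false by lia.
rewrite /looped; case: (mate D k =P k.+1) => E /=.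
  have E' : mate D k.+1 = k by rewrite -E mateK.
  have us : uniq [:: k; k.+1] by rewrite /= inE; lia.
  have sM : all (ltn^~ (2 * N)%N) [:: k; k.+1] by rewrite /= kN (ltnW kN).
  rewrite !(big_addb_split _ us sM) !big_cons !big_nil /= /contract_mate /contract_dotted !eqxx
    /= E E'.
  rewrite kk1 kk2 ltnSn /= !addbF.
  set R1 := bigop _ _ _; set R2 := bigop _ _ _; have -> : R1 = R2.
    apply: eq_bigr => x; rewrite !inE negb_or => /andP[/negPf-> /negPf->] //=.
  case: R2 => {R1}; case: (dotted D k); by case: s.
rewrite addbF.
have nd : mate D k.+1 <> k by move=> e; have := mateK D k.+1; rewrite e => /E.
have nck := mate_neq D k; have ndk := mate_neq D k.+1; have ncd := mate_neq2 (D := D) kk.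
have pc := mateK D k; have pd := mateK D k.+1.
have dc := dotted_mate D k; have dd := dotted_mate D k.+1.
have [c cE] : exists c, c = mate D k by eexists.
have [d dE] : exists d, d = mate D k.+1 by eexists.
rewrite -cE -dE in ck ck1 E nd nck ndk ncd pc pd dc dd.
have e1 : (c == k) = false by apply/eqP.
have e2 : (c == k.+1) = false by apply/eqP.
have e3 : (d == k) = false by apply/eqP.
have e4 : (d == k.+1) = false by apply/eqP.
have e5 : (d == c) = false by apply/eqP => e; apply: ncd.
have us : uniq [:: k; k.+1; c; d].
  have kk0 : (k == k.+1) = false by lia.
  by rewrite /= !inE ![_ == c]eq_sym ![_ == d]eq_sym kk0 e1 e2 e3 e4 e5.
have sM : all (ltn^~ (2 * N)%N) [:: k; k.+1; c; d] by rewrite /= kN (ltnW kN) ck ck1.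
rewrite !(big_addb_split _ us sM); congr (_ (+) _); last first.
  apply: eq_bigr => x; rewrite !inE !negb_or => /and4P[/negPf h1 /negPf h2 /negPf h3 /negPf h4]
    /=.
  by rewrite /contract_mate /contract_dotted -cE -dE h1 h2 h3 h4.
rewrite !big_cons !big_nil /= /contract_mate /contract_dotted -cE -dE !eqxx kk1 e1 e2 e3 e4 e5
  pc pd dc dd /= ?eqxx ?orbT.
rewrite ltnSn kk2 (ltn_neg nck) (ltn_neg ndk) [(d < c)%N]ltn_neg; last by move=> e; apply: ncd.
clear; case: (k < c)%N; case: (k.+1 < d)%N; case: (c < d)%N;
  case: (dotted D k); case: (dotted D k.+1); by case: s.
Qed.

Lemma dot_parity_id N : dot_parity N (id_pairing N) = false.
Proof. by rewrite /dot_parity big1_seq // => x _ /=; rewrite andbF. Qed.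
Lemma closed_id N : closed_below N (id_pairing N).
Proof. by move=> x xN; rewrite /= /id_mate xN; lia. Qed.

Section Coef.
Variables (K : fieldType) (q : K).

Definition indicator (D0 D : dpairing) : K := `[< D = D0 >]%:R.

Lemma fun_act_lincomb n I (r : seq I) (c : I -> K) (f : I -> dpairing -> K) (x : TLD q n) D :
  fun_act x (fun D => \sum_(i <- r) c i * f i D) D = \sum_(i <- r) c i * fun_act x (f i) D.
Proof.
elim: r => [|i r IH].
  rewrite big_nil (_ : (fun _ => _) = fun=> 0) ?fun_act_cst0 //.
  by apply: funext => D'; rewrite big_nil.
rewrite big_cons -IH -[X in _ + X]mul1r.
have := term_act_lin q (repr x) (c i) 1 (f i) (fun D => \sum_(i <- r) c i * f i D) D.
rewrite /fun_act => <-; congr (term_act _ _ _ _); apply: funext => D'.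
by rewrite big_cons mul1r.
Qed.

Lemma run_add_cap_top N w D : (1 < N)%N -> all (leq^~ N.-1) w ->
  run w (add_cap N.+1 D) = add_cap N.+1 (run w D) /\ run_weight q w (add_cap N.+1 D) =
    run_weight q w D.
Proof.
move=> N1; elim: w D => [|j w IH] D //= /andP[jN wN].
have f : far N.+1 j by rewrite /far /adjN; lia.
have [a1 a2 a3] := act_add_cap_far D f.
have lE : shift_letter N.+1 j = j by rewrite /shift_letter ifT //; lia.
rewrite lE in a1 a2 a3; have [i1 i2] := IH (act j D) wN.
by rewrite a1 i1 i2 !act_weightE a2 a3.
Qed.

Lemma fun_act_add_cap_top n (x : TLD q n) f D : (0 < n)%N ->
  fun_act x f (add_cap n.+2 D) = fun_act x (fun D => f (add_cap n.+2 D)) D.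
Proof.
move=> n0; elim: (word_span_all x) => [w wn|{}x y _ h1 _ h2|a {}x _ h].
- by rewrite !fun_act_wordN //; have [-> ->] := @run_add_cap_top n.+1 w D n0 wn.
- by rewrite !fun_actD h1 h2.
- by rewrite !fun_actZ h.
Qed.

Lemma fun_act_cap_sum n m b f D : (0 < m <= n)%N ->
  fun_act (cap_sum q n m b) f (add_cap m.+1 D) = \sum_(0 <= i < m.+2) b i * f (add_cap i D).
Proof.
move=> /andP[m0 mn]; rewrite /cap_sum fun_act_sum; apply: eq_big_nat => i /andP[_ im].
rewrite fun_actZ fun_act_wordN; last by apply: sub_all (all_capword m i) => x xm;
  apply: leq_trans mn.
by have [-> ->] := run_capword q D m0 (im : (i <= m.+1)%N); rewrite mul1r.
Qed.

(** If i is the index of a cap of D, this is the coefficient in Q' of D without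
    that cap, and it is zero otherwise. *)
Definition removed_coef n (Q' : TLD q n) D i :=
  fun_act Q' (fun D' => indicator D (add_cap i D')) (id_pairing n.+1).

Lemma removed_coef_add_cap n (Q' : TLD q n) D i : removed_coef Q' (add_cap i D) i = fun_act Q'
  (indicator D) (id_pairing n.+1).
Proof.
rewrite /removed_coef; congr (fun_act _ _ _); apply: funext => D'; rewrite /indicator;
  congr (_%:R).
congr nat_of_bool; by apply: asbool_equiv_eq; split=> [/add_cap_inj|->].
Qed.
Lemma removed_coef_eq0 n (Q' : TLD q n) D i : (forall D',
  D <> add_cap i D') -> removed_coef Q' D i = 0.
Proof.
move=> h; rewrite /removed_coef (_ : (fun _ => _) = fun=> 0) ?fun_act_cst0 //.
by apply: funext => D'; rewrite /indicator asboolF // => /esym; apply: h.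
Qed.

Hypothesis qg : generic q.

(** The recursion, before it is translated into diagrams. *)
Lemma fun_act_proj_rec n (Q : TLD q n.+1) (Q' : TLD q n) D : is_proj Q -> is_proj Q' ->
  fun_act Q (indicator D) (id_pairing n.+2) = \sum_(0 <= i < n.+3) cap_weight q n.+1 i *
    removed_coef Q' D i.
Proof.
move=> iQ iQ'.
have Jq := proj_rec qg (ltn0Sn n) iQ iQ'; rewrite /= in Jq.
rewrite -[Q](subrK (embed n.+1 Q' * cap_sum q n.+1 n.+1 (cap_weight q n.+1))) fun_actD
  ideal01_fun_act // add0r fun_actM.
rewrite fun_act_embed // -add_cap_id.
transitivity (fun_act Q' (fun D' => fun_act (cap_sum q n.+1 n.+1 (cap_weight q n.+1))
  (indicator D) (add_cap n.+2 D')) (id_pairing n.+1)).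
  case: n Q' iQ' {Q iQ Jq} => [|n] Q' iQ'; last by rewrite fun_act_add_cap_top.
  by have [_ ->] := iQ'; rewrite !fun_act1.
rewrite -fun_act_lincomb; congr (fun_act _ _ _); apply: funext => D'.
by rewrite fun_act_cap_sum // !ltnS leqnn.
Qed.

Lemma normal_letters N D v : normal N D v -> all (leq^~ N.-1) v.
Proof.
elim=> [|{}N {}D w i h IH iN] //; rewrite all_cat all_capword andbT.
by apply: sub_all IH => x; rewrite /=; lia.
Qed.
Lemma normal_run N D v : normal N D v -> run v (id_pairing N) = D /\ run_weight q v (id_pairing
  N) = 1.
Proof.
elim=> [|{}N {}D w i h [IH1 IH2] iN] //.
rewrite -add_cap_id run_cat run_weight_cat.
have [N0|[N1|N1]] : (N = 0 \/ N = 1 \/ 1 < N)%N by lia.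
- by subst N; case: (normal_inv h) => [[]|[?[?[?[?[]]]]]].
- subst N; case: (normal_inv h) => [[_ [E ->]]|[N'[?[?[?[E _ _ N0 _]]]]]]; last by lia.
  by rewrite [run [::] _]/= [run_weight _ [::] _]/= mul1r E; apply: run_capword.
have [-> ->] := run_add_cap_top (id_pairing N) N1 (normal_letters h).
by rewrite IH1 IH2 mul1r; apply: run_capword => //; lia.
Qed.
Lemma normal_id N : normal N.+1 (id_pairing N.+1) [::].
Proof.
elim: N => [|N IH]; first exact: normal1.
by rewrite -add_cap_id -[[::]]cats0 -{2}(capword_top N.+1); apply: normalS.
Qed.

Section Reduced.
Variable n : nat.
Hypothesis n0 : (0 < n)%N.
Notation A := (TLD q n).
Notation gn := (genN q n).
Notation W := (wordN q n).
Notation I := (id_pairing n.+1).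

Lemma fun_act_normal D v f : normal n.+1 D v -> fun_act (W v) f I = f D.
Proof.
move=> h; have [r c] := normal_run h.
by rewrite fun_act_wordN ?r ?c ?mul1r //; have := normal_letters h.
Qed.

Lemma normal_loop D v j : normal n.+1 D v -> (j <= n)%N -> loop_at j D -> ~~ dotted_loop_at j D
  ->
  act j D = D /\ W v * gn j = - qint q 2 *: W v.
Proof.
move=> h jn l nd; have := @normal_step _ q n n.+1 D v j n0 (leqnn _) h jn.
rewrite (negPf nd) act_weightE l (negPf nd).
have aD : act j D = D.
  have e : dotted D j.-1 = (j == 0%N).
    by move: nd; rewrite /dotted_loop_at l /=; case: (dotted D j.-1); case: (j == 0%N).
  by rewrite /act -e contract_looped.
rewrite aD => -[v' h' E]; split=> //.
by rewrite E (normal_uniq q (leqnn _) h h').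
Qed.

(** Replacing E_0 by E_1 changes no connectivity, avoids all dotted loops, and
    does not change the product of the word with an element of the ideal. *)
Definition undot (w : seq nat) := map (maxn^~ 1%N) w.
Lemma undot_run w D D' : mate D =1 mate D' -> (forall x, dotted D' x = false) ->
  mate (run w D) =1 mate (run (undot w) D') /\ (forall x, dotted (run (undot w) D') x = false).
Proof.
elim: w D D' => [|j w IH] D D' E d //=; apply: IH => x.
  by rewrite /act /= /contract_mate (_ : (maxn j 1).-1 = j.-1)%N ?E //; lia.
rewrite /act /= /contract_dotted (_ : (maxn j 1 == 0)%N = false); last by lia.
by case: ifP => // _; case: ifP; rewrite !d.
Qed.
Lemma undot_normal w : all (leq^~ n) w -> exists2 v, normal n.+1 (run (undot w) I) v &
  W (undot w) = run_weight q (undot w) I *: W v.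
Proof.
elim/last_ind: w => [|w j IH].
  by exists [::]; [exact: normal_id | rewrite wordN_nil scale1r].
rewrite all_rcons => /andP[jn /IH[v h E]].
have jn' : (maxn j 1 < n.+1)%N by lia.
have [_ d] := @undot_run w I I (fun=> erefl) (fun=> erefl).
have := @normal_step _ q n n.+1 _ _ _ n0 (leqnn _) h jn'.
have -> : dotted_loop_at (maxn j 1) (run (undot w) I) = false.
  by rewrite /dotted_loop_at d (_ : (maxn j 1 == 0)%N = false) ?andbF //; lia.
case=> v' h' E'; rewrite /undot map_rcons -/(undot w); exists v'; first by rewrite run_rcons.
by rewrite wordN_rcons run_weight_rcons E -scalerAl E' scalerA.
Qed.
Lemma ideal01_undot w a : all (leq^~ n) w -> ideal01 a -> W w * a = W (undot w) * a.
Proof.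
move=> + Ja; elim: w => //= j w IH /andP[jn wn].
rewrite !wordN_cons -!mulrA IH //; case: (posnP j) => [->|j0].
  by apply: (agree01_ideal n0); apply: ideal01_l.
by rewrite (_ : maxn j 1 = j)%N //; lia.
Qed.
(** With the unit f of the ideal, W(w) = W(w) f = W(undot w) f. The word undot
    w is a multiple of a normal word, for which the loop is an undotted one and
    contributes - [2]. *)
Lemma ideal01_loop w j : all (leq^~ n) w -> (j <= n)%N -> ideal01 (W w) -> loop_at j (run w I)
  ->
  W (rcons w j) = - qint q 2 *: W w.
Proof.
move=> wn jn Jw l.
have [f Jf hf] := ideal01_unit qg n0.
have [v h E] := undot_normal wn.
have [p d] := @undot_run w I I (fun=> erefl) (fun=> erefl).
have jn' : (maxn j 1 <= n)%N by lia.
have l' : loop_at (maxn j 1)%N (run (undot w) I).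
  by move: l; rewrite /loop_at /looped p (_ : (maxn j 1).-1 = j.-1)%N //; lia.
have nd : ~~ dotted_loop_at (maxn j 1)%N (run (undot w) I).
  by rewrite /dotted_loop_at d (_ : (maxn j 1 == 0)%N = false) ?andbF //; lia.
have [_ L] := normal_loop h jn' l' nd.
have Jwj : ideal01 (W (rcons w j)) by rewrite wordN_rcons; apply: ideal01_r.
have wjn : all (leq^~ n) (rcons w j) by rewrite all_rcons jn.
have [_ <-] := hf _ Jwj; have [_ <-] := hf _ Jw.
rewrite (ideal01_undot wjn Jf) (ideal01_undot wn Jf) /undot map_rcons -/(undot w) wordN_rcons E.
by rewrite -!scalerAl L -!scalerAl scalerA mulrC -scalerA.
Qed.

Definition reducedN (w : seq nat) := all (leq^~ n) w /\
  ~ exists v c, [/\ all (leq^~ n) v, (size v < size w)%N & W w = c *: W v].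

Lemma reducedN_rcons w j : reducedN (rcons w j) -> reducedN w.
Proof.
case; rewrite all_rcons => /andP[jn wn] h; split=> // -[v [c [vn sv E]]].
apply: h; exists (rcons v j), c; split; rewrite ?all_rcons ?jn ?size_rcons ?ltnS //.
by rewrite !wordN_rcons E scalerAl.
Qed.
Lemma run_closed w : all (leq^~ n) w -> closed_below n.+1 (run w I).
Proof.
elim/last_ind: w => [|w j IH]; first by move=> _; exact: closed_id.
rewrite all_rcons run_rcons => /andP[jn /IH]; apply: closed_contract; lia.
Qed.
Lemma dot_parity_act w j : all (leq^~ n) w -> (j <= n)%N ->
  dot_parity n.+1 (act j (run w I)) = dot_parity n.+1 (run w I) (+) dotted_loop_at j (run w I).
Proof. by move=> wn jn; rewrite dot_parity_contract //; [lia | exact: run_closed]. Qed.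

(** Letters are added one at a time. As long as no loop occurs the word is
    normal; an undotted loop would make it shorter; the first dotted loop puts
    it into the ideal and makes the parity odd; after that any loop would make
    the word shorter, so the parity remains odd. *)
Lemma reducedN_dichotomy w : reducedN w ->
  [/\ run_weight q w I = 1, dot_parity n.+1 (run w I) = false & exists2 v,
    normal n.+1 (run w I) v & W w = W v]
  \/ (ideal01 (W w) /\ dot_parity n.+1 (run w I) = true).
Proof.
elim/last_ind: w => [|w j IH].
  by move=> _; left; split; rewrite ?dot_parity_id //; exists [::] => //; exact: normal_id.
move=> h; have [hwj nred] := h; have rw := reducedN_rcons h; have wn := rw.1.
have jn : (j <= n)%N by move: hwj; rewrite all_rcons => /andP[].
have shorter c : W (rcons w j) <> c *: W w.
  by move=> E; apply: nred; exists w, c; rewrite size_rcons.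
case: (IH rw) => [[c p [v hv E]]|[Jw p]]; rewrite run_rcons dot_parity_act // p.
  case: (boolP (dotted_loop_at j (run w I))) => d.
    right; split=> //; rewrite wordN_rcons E.
    by have := @normal_step _ q n n.+1 _ _ _ n0 (leqnn _) hv (jn : (j < n.+1)%N); rewrite d.
  case: (boolP (loop_at j (run w I))) => l.
    have [_ L] := normal_loop hv jn l d.
    by case: (shorter (- qint q 2)); rewrite wordN_rcons E.
  left; have := @normal_step _ q n n.+1 _ _ _ n0 (leqnn _) hv (jn : (j < n.+1)%N).
  rewrite (negPf d) act_weightE (negPf l) => -[v' hv' E'].
  split=> //; first by rewrite run_weight_rcons c mul1r act_weightE (negPf l).
  by exists v' => //; rewrite wordN_rcons E E' scale1r.
case: (boolP (loop_at j (run w I))) => l.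
  by case: (shorter (- qint q 2)); apply: ideal01_loop.
right; split; first by rewrite wordN_rcons; apply: ideal01_r.
by rewrite /dotted_loop_at (negPf l).
Qed.

Lemma reducedN_coef w D v : reducedN w -> normal n.+1 D v ->
  fun_act (W w) (indicator D) I = (W w == W v)%:R.
Proof.
move=> rw hv; have e1 : fun_act (W v) (indicator D) I = 1 by rewrite (fun_act_normal _ hv)
  /indicator asboolT.
case: eqP => [->|ne] //; case: (reducedN_dichotomy rw) => [[c _ [v' hv' E]]|[Jw _]].
  rewrite E (fun_act_normal _ hv') /indicator asboolF // => e; apply: ne.
  by rewrite E; apply: (normal_uniq q (leqnn _) hv'); rewrite e.
exact: ideal01_fun_act.
Qed.

Lemma reducedN_ex w : all (leq^~ n) w -> exists v c, reducedN v /\ W w = c *: W v.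
Proof.
have [m] := ubnP (size w); elim: m w => // m IH w wm wn.
have [h|h] := pselect (reducedN w); first by exists w, 1; rewrite scale1r.
have [v [c [vn vw E]]] : exists v c, [/\ all (leq^~ n) v, (size v < size w)%N & W w = c *: W v].
  by apply: contra_notP h => h; split.
have [v' [c' [rv E']]] := IH v (leq_trans vw wm) vn.
by exists v', (c * c'); rewrite E E' scalerA.
Qed.

Lemma reducedN_expansion (x : A) : exists (s : seq A) (f : A -> K),
  [/\ uniq s, forall y, y \in s -> exists2 w, reducedN w & y = W w & x = \sum_(y <- s) f y *:
    y].
Proof.
elim: (word_span_all x) => [w wn|{}x x2 _ [s [f [us hs ->]]] _ [t [f' [ut ht ->]]]|a {}x _ [s
  [f [us hs ->]]]].
- have [v [c [rv ->]]] := reducedN_ex wn.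
  exists [:: W v], (fun=> c); split=> //; last by rewrite big_seq1.
  by move=> y; rewrite inE => /eqP->; exists v.
- exists (undup (s ++ t)), (fun y => (if y \in s then f y else 0) + (if y \in t then f' y else
  0)).
  split; first exact: undup_uniq.
    by move=> y; rewrite mem_undup mem_cat => /orP[/hs|/ht].
  under [RHS]eq_bigr do rewrite scalerDl.
  rewrite [RHS]big_split /=; congr (_ + _).
    rewrite [RHS](bigID (mem s)) /= [X in _ + X]big1 ?addr0; last first.
      by move=> y /negPf->; rewrite scale0r.
    rewrite -[RHS]big_filter [RHS](perm_big s) /=; last first.
      apply: uniq_perm; rewrite ?filter_uniq ?undup_uniq // => y.
      by rewrite mem_filter mem_undup mem_cat; case: (y \in s).
    by apply: eq_big_seq => y ->.
  rewrite [RHS](bigID (mem t)) /= [X in _ + X]big1 ?addr0; last first.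
    by move=> y /negPf->; rewrite scale0r.
  rewrite -[RHS]big_filter [RHS](perm_big t) /=; last first.
    apply: uniq_perm; rewrite ?filter_uniq ?undup_uniq // => y.
    by rewrite mem_filter mem_undup mem_cat; case: (y \in t); rewrite ?orbT.
  by apply: eq_big_seq => y ->.
- exists s, (fun y => a * f y); split=> //.
  by rewrite scaler_sumr; apply: eq_bigr => y _; rewrite scalerA.
Qed.

(** Coefficients with respect to reduced words are well defined at even
    diagrams, being values of the action. *)
Lemma expansion_coefE (x : A) (s : seq A) (f : A -> K) D v : uniq s ->
  (forall y, y \in s -> exists2 w, reducedN w & y = W w) -> x = \sum_(y <- s) f y *: y ->
  normal n.+1 D v ->
  (if W v \in s then f (W v) else 0) = fun_act x (indicator D) I.
Proof.
move=> us hs -> hv; rewrite fun_act_sum.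
transitivity (\sum_(y <- s) f y * (y == W v)%:R); last first.
  apply: eq_big_seq => y /hs[w rw ->]; by rewrite fun_actZ (reducedN_coef rw hv).
case: ifP => [vs|/negP vs].
  rewrite (bigD1_seq (W v)) //= eqxx mulr1 big1 ?addr0 // => y /negPf->.
  by rewrite mulr0.
rewrite big1_seq // => y /andP[_ ys]; case: eqP => [e|_]; last by rewrite mulr0.
by rewrite e in ys.
Qed.
End Reduced.
End Coef.

(** * Stacking of diagrams *)

Local Open Scope nat_scope.

Ltac iflia :=
  repeat match goal with |- context [if ?c then _ else _] =>
    lazymatch c with context [if _ then _ else _] => fail | _ => case: (boolP c) => ? end end;
      lia.

Section Represents.
Variable N : nat.
Notation pt := 'I_(2 * N).

(** The third condition makes the pairing unique. *)
Definition represents (D : diagram N) (E : dpairing) : Prop :=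
  [/\ forall x : pt, partner D x = mate E x :> nat,
      forall x : pt, (x \in dots D) = (x < mate E x) && dotted E x
    & forall y, 2 * N <= y -> mate E y = xor1 y /\ dotted E y = false].

Lemma represents_id : represents id_diagram (id_pairing N).
Proof.
split=> [x|x|y Ny] /=.
- by rewrite ffunE /id_mate ltn_ord /=; have := ltn_ord x; lia.
- by rewrite inE andbF.
- by rewrite /id_mate ltnNge Ny.
Qed.

Lemma represents_closed D E : represents D E -> closed_below N E.
Proof. by case=> h _ _ x xN; rewrite -(h (Ordinal xN)). Qed.

Lemma represents_inj D D' E : represents D E -> represents D' E -> D = D'.
Proof.
case: D => p d; case: D' => p' d' [/= h1 h2 _] [/= h1' h2' _].
have -> : p = p' by apply/ffunP => x; apply: val_inj; rewrite /= h1 h1'.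
by congr Diagram; apply/setP => x; rewrite h2 h2'.
Qed.

Lemma represents_fun D E E' : represents D E -> represents D E' -> E = E'.
Proof.
move=> r r'; have [h1 h2 h3] := r; have [h1' h2' h3'] := r'.
have ep x : mate E x = mate E' x.
  case: (ltnP x (2 * N)) => xN; last by rewrite (h3 _ xN).1 (h3' _ xN).1.
  by rewrite -(h1 (Ordinal xN)) h1'.
have ed x : x < 2 * N -> x < mate E x -> dotted E x = dotted E' x.
  move=> xN xp; have := h2 (Ordinal xN); have := h2' (Ordinal xN).
  by rewrite /= -ep xp => ->.
apply: dpairing_ext => // x; case: (ltnP x (2 * N)) => xN;
  last by rewrite (h3 _ xN).2 (h3' _ xN).2.
case: (ltngtP x (mate E x)) => xp; first exact: ed.
  rewrite -(dotted_mate E) -(dotted_mate E') -ep; apply: ed; last by rewrite mateK.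
  exact: represents_closed r _ xN.
by case: (mate_neq E x).
Qed.

Lemma represents_dot_parity D E : represents D E -> odd #|dots D| = dot_parity N E.
Proof.
move=> [_ h _]; rewrite /dot_parity -[2 * N in RHS]subn0 -/(index_iota _ _) big_mkord.
rewrite -sum1_card big_mkcond /= (big_morph odd oddD (erefl _)).
by apply: eq_bigr => x _; rewrite h; case: ifP.
Qed.

Lemma represents_ex D : connectivity (partner D) -> (forall x,
  x \in dots D -> x < partner D x) ->
  exists E, represents D E.
Proof.
move=> /and3P[/forallP pN /forallP pK _] dD; set p := partner D in pN pK dD.
have pN' (x : pt) : p x <> x by apply/eqP.
have pK' (x : pt) : p (p x) = x by apply/eqP.
pose f y := if insub y is Some x then p x : nat else xor1 y.
pose d y := if insub y is Some x then (x \in dots D) || (p x \in dots D) else false.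
have xN y : 2 * N <= y -> 2 * N <= xor1 y by rewrite /xor1; case: ifP; lia.
have f1 (x : pt) : f x = p x by rewrite /f valK.
have f2 y : 2 * N <= y -> f y = xor1 y by rewrite /f => h; rewrite insubF //; lia.
have d1 (x : pt) : d x = (x \in dots D) || (p x \in dots D) by rewrite /d valK.
have d2 y : 2 * N <= y -> d y = false by rewrite /d => h; rewrite insubF //; lia.
have fN y : f y <> y.
  case: (ltnP y (2 * N)) => h; last by rewrite f2 // /xor1; case: ifP; lia.
  by rewrite (f1 (Ordinal h)) => e; apply: (pN' (Ordinal h)); apply: val_inj.
have fK y : f (f y) = y.
  case: (ltnP y (2 * N)) => h; last by rewrite !f2 ?xN // /xor1; case: ifP => /=; case: ifP;
    lia.
  by rewrite (f1 (Ordinal h)) f1 pK'.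
have fd y : d (f y) = d y.
  case: (ltnP y (2 * N)) => h; last by rewrite f2 // !d2 ?xN.
  by rewrite (f1 (Ordinal h)) (d1 (Ordinal h)) d1 pK' orbC.
exists (DPairing fN fK fd); split=> [x|x|y h].
- exact: (esym (f1 x)).
- rewrite -[RHS]/((x < f x) && d x) f1 d1.
  apply/idP/idP => [xd|]; first by rewrite dD // xd.
  by case/andP=> xp /orP[//|/dD]; rewrite pK'; lia.
- by split; [exact: f2 | exact: d2].
Qed.
End Represents.

(** Stacking the generator i on L contracts the top points a and a + 1 of L,
    which lie under the two points of its cap. *)
Section Stack.
Variables (N i : nat) (L : diagram N) (E : dpairing).
Hypotheses (N1 : 1 < N) (iN : i < N) (rL : represents L E).
Notation pt := 'I_(2 * N).
Notation U := (gen_diagram N i).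
Notation p := (mate E).
Notation h := i.-1.
Let a := (2 * N).-2 - i.-1.
Notation r := (stack_rel U L).

Let aN : N <= a. Proof. by rewrite /a; lia. Qed.
Let aN2 : a.+1 < 2 * N. Proof. by rewrite /a; lia. Qed.
Let aE : a = (2 * N).-2 - h. Proof. by []. Qed.
Let pL (x : pt) : partner L x = p x :> nat. Proof. by case: rL. Qed.
Let cE : closed_below N E := represents_closed rL.

Lemma gen_bound x : x < 2 * N -> gen_partner N i x < 2 * N.
Proof. by rewrite /gen_partner; repeat case: eqP => ?; lia. Qed.
Lemma gen_val (x : pt) : partner U x = gen_partner N i x :> nat.
Proof. by rewrite ffunE val_insubd gen_bound. Qed.
Lemma genK x : x < 2 * N -> gen_partner N i (gen_partner N i x) = x.
Proof. by move=> xN; clear -N1 iN xN; rewrite /gen_partner; iflia. Qed.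

(** Vertices of the stacking graph are labelled by points of L: a bottom point
    of the generator is glued to a top point of L, and a vertical strand
    prolongs it to the top. The two ends of the cup of the generator are on no
    strand of L, and they are given the extra label 2 N. *)
Definition strand_label (u : bool * pt) : nat :=
  if u.1 then if u.2 < N then (2 * N).-1 - u.2
    else if (u.2 == a :> nat) || (u.2 == a.+1 :> nat) then 2 * N else u.2
  else u.2.

Definition touched y := [|| y == a, y == a.+1, y == p a | y == p a.+1].
(** The classes of labels under connection: the chords of L, with those of a
    and a + 1 merged by the cap of the generator. *)
Definition same_strand y z := [|| y == z, p y == z | touched y && touched z].

Lemma touched_mate y : touched (p y) = touched y.
Proof.
have eqp x : (p y == p x) = (y == x) by apply/eqP/eqP => [/mate_inj|->].
by rewrite /touched !eqp !mate_eq; case: (y == a); case: (y == a.+1); case: (y == p a);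
  case: (y == p a.+1).
Qed.
Lemma same_strand_refl y : same_strand y y. Proof. by rewrite /same_strand eqxx. Qed.
Lemma same_strand_sym y z : same_strand y z = same_strand z y.
Proof. by rewrite /same_strand eq_sym mate_eq [y == p z]eq_sym andbC. Qed.
Lemma same_strand_trans y x z : same_strand x y -> same_strand y z -> same_strand x z.
Proof.
rewrite /same_strand => /or3P[/eqP->|/eqP<-|/andP[h1 h2]] //.
  by rewrite mateK touched_mate => /or3P[|->|->]; rewrite ?eqxx ?orbT // => ->; rewrite orbT.
case/or3P => [/eqP<-|/eqP<-|/andP[_ ->]]; rewrite ?touched_mate ?h1 ?h2 ?orbT //.
Qed.

Lemma stack_rel_label u v : r u v -> same_strand (strand_label u) (strand_label v).
Proof.
case: u v => [[|] x] [[|] y]; rewrite /stack_rel /=.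
- move=> /eqP/(congr1 val); rewrite /= gen_val => e.
  have := ltn_ord x; have := ltn_ord y; move: e; rewrite /strand_label /=;
    move: (nat_of_ord x) (nat_of_ord y) => {}x {}y.
  case: (x =P h) => [->|n1].
    rewrite /gen_partner eqxx => <- _ _.
    have -> : h < N by lia. have -> : h.+1 < N by lia.
    have -> : (2 * N).-1 - h = a.+1 by lia.
    have -> : (2 * N).-1 - h.+1 = a by lia.
    by rewrite /same_strand /touched !eqxx ?orbT.
  case: (x =P h.+1) => [->|n2].
    have -> : gen_partner N i h.+1 = h by rewrite /gen_partner eqxx; case: eqP; lia.
    move=> <- _ _.
    have -> : h < N by lia. have -> : h.+1 < N by lia.
    have -> : (2 * N).-1 - h = a.+1 by lia.
    have -> : (2 * N).-1 - h.+1 = a by lia.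
    by rewrite /same_strand /touched !eqxx ?orbT.
  rewrite /gen_partner (introF eqP n1) (introF eqP n2).
  have -> : (2 * N).-1 - h = a.+1 by lia.
  rewrite -aE; case: (x =P a.+1) => [->|n3].
    move=> <- _ _; have -> : a < N = false by lia.
    have -> : a.+1 < N = false by lia.
    by rewrite !eqxx orbT; exact: same_strand_refl.
  case: (x =P a) => [->|n4].
    move=> <- _ _; have -> : a < N = false by lia.
    have -> : a.+1 < N = false by lia.
    by rewrite !eqxx orbT; exact: same_strand_refl.
  move=> e yN xN; have -> : (y == a) || (y == a.+1) = false by lia.
  rewrite /=.
  case: (ltnP x N) => xN'.
    have -> : y < N = false by lia.
    by rewrite e same_strand_refl.
  have -> : y < N by lia.
  by rewrite (_ : (2 * N).-1 - y = x) ?same_strand_refl //; lia.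
- case/andP => /eqP/(congr1 val) /= e xN; rewrite /strand_label /= xN e.
  by rewrite (_ : 2 * N - x.+1 = (2 * N).-1 - x) ?same_strand_refl //; lia.
- case/andP => /eqP/(congr1 val) /= e xN; rewrite /strand_label /= e ifT;
  last by have := ltn_ord x; lia.
  by rewrite (_ : (2 * N).-1 - _ = x) ?same_strand_refl //; have := ltn_ord x; lia.
- by move=> /eqP <-; rewrite /strand_label /= pL /same_strand eqxx orbT.
Qed.

Lemma stack_sym : connect_sym r.
Proof.
suff S u v : r u v -> r v u by move=> u v; apply: (@sym_connect_sym _ r); move=> x y;
  apply/idP/idP; apply: S.
case: u v => [[|] x] [[|] y]; rewrite /stack_rel /=.
- move=> /eqP <-; apply/eqP/val_inj; rewrite /= !gen_val genK //.
- by case/andP => /eqP -> xN; rewrite rev_ordK eqxx /=; have := ltn_ord x; lia.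
- by case/andP => /eqP -> xN; rewrite rev_ordK eqxx /=; have := ltn_ord x; lia.
- by move=> /eqP <-; apply/eqP/val_inj; rewrite /= !pL mateK.
Qed.

Lemma glue_up (y : pt) : N <= y -> r (false, y) (true, rev_ord y).
Proof. by move=> yN; rewrite /stack_rel /= eqxx yN. Qed.

Lemma cap_conn (x y : pt) : x = a :> nat -> y = a.+1 :> nat -> connect r (false, x) (false, y).
Proof.
move=> xa ya.
apply: (@connect_trans _ _ (true, rev_ord x)); first by apply/connect1/glue_up; rewrite xa.
apply: (@connect_trans _ _ (true, rev_ord y)); last first.
  by rewrite stack_sym; apply/connect1/glue_up; rewrite ya; apply: leqW.
apply: connect1; rewrite /stack_rel /=; apply/eqP/val_inj;
  rewrite /= gen_val /= xa ya /gen_partner.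
have -> : 2 * N - a.+1 = h.+1 by lia.
by rewrite eqxx; case: eqP; lia.
Qed.

Lemma label_connect u (y : pt) : strand_label u = y -> connect r u (false, y).
Proof.
case: u => [[|] x]; last by rewrite /strand_label /= => /val_inj ->; exact: connect0.
have xl := ltn_ord x; have yl := ltn_ord y; rewrite /strand_label /=.
case: (ltnP x N) => xN.
  move=> e; rewrite stack_sym; apply: connect1; rewrite /stack_rel /=; apply/andP; split;
    last by lia.
  by apply/eqP/val_inj; rewrite /= -e; lia.
case: ifP => e'; first by lia.
move=> /val_inj <-; apply: (@connect_trans _ _ (true, rev_ord x)); last first.
  by rewrite stack_sym; apply/connect1/glue_up.
apply: connect1; rewrite /stack_rel /=; apply/eqP/val_inj; rewrite /= gen_val /gen_partner.
clear - e' xN xl N1 iN aE.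
by iflia.
Qed.

(** Along edges the class of the label does not change; conversely vertices are
    connected to the point of L that labels them, and these points are
    connected within a class. *)
Lemma stack_connectE u v : connect r u v = same_strand (strand_label u) (strand_label v).
Proof.
apply/idP/idP => [/connectP[w + ->]|].
  elim: w u => [|w s IH] u /=; first by rewrite same_strand_refl.
  by case/andP=> /stack_rel_label h1 /IH; apply: same_strand_trans.
have lb w : strand_label w <= 2 * N.
  by case: w => [[|] x]; rewrite /strand_label /=; have := ltn_ord x; repeat case: ifP => ?;
    lia.
have [uN|uN] := ltnP (strand_label u) (2 * N); last first.
  have eu : strand_label u = 2 * N by have := lb u; lia.
  have p2 : p (2 * N) = (2 * N).+1.
    by case: rL => _ _ /(_ _ (leqnn _))[-> _]; rewrite /xor1 mul2n odd_double.
  have t2 : touched (2 * N) = false.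
    have := cE (ltnW aN2); have := cE aN2; rewrite /touched; lia.
  rewrite /same_strand eu t2 p2 orbF => uv.
  have ev_v : strand_label v = 2 * N by have := lb v; lia.
  (* The label 2 N belongs to the two ends of the cup only, which are
     joined. *)
  have sp w : strand_label w = 2 * N -> exists2 z : pt, w = (true,
    z) & (z == a :> nat) || (z == a.+1 :> nat).
    case: w => [[|] z]; rewrite /strand_label /=; have zl := ltn_ord z; last by lia.
    case: (ltnP z N) => zN; first by lia.
    by case: ifP => [zz _|_]; [exists z | lia].
  have [x -> hx] := sp _ eu; have [y -> hy] := sp _ ev_v.
  have [->|nxy] := eqVneq x y; first exact: connect0.
  apply: connect1; rewrite /stack_rel /=; apply/eqP/val_inj; rewrite /= gen_val /gen_partner.
  have nxy' : (x != y :> nat) by [].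
  clear - hx hy nxy' N1 iN aE.
  by iflia.
have ub : (strand_label u < 2 * N) by [].
move=> uv.
have vN : strand_label v < 2 * N.
  rewrite ltn_neqAle lb andbT; apply/eqP => e.
  have p2 : p (2 * N) = (2 * N).+1.
    by case: rL => _ _ /(_ _ (leqnn _))[-> _]; rewrite /xor1 mul2n odd_double.
  have t2 : touched (2 * N) = false.
    have := cE (ltnW aN2); have := cE aN2; rewrite /touched; lia.
  by move: uv; rewrite same_strand_sym /same_strand e p2 t2 orbF; lia.
have cu := @label_connect u (Ordinal uN) erefl.
have cv := @label_connect v (Ordinal vN) erefl.
apply: connect_trans cu _; rewrite stack_sym; apply: connect_trans cv _; rewrite stack_sym.
move: (strand_label u) (strand_label v) uN vN uv {ub lb} => y z yN zN.
have pc (s t : pt) : p s = t -> connect r (false, s) (false, t).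
  by move=> e; apply: connect1; rewrite /stack_rel /=; apply/eqP/val_inj; rewrite /= pL.
have tc (s : pt) : touched s -> connect r (false, s) (false, Ordinal (ltnW aN2)).
  rewrite /touched => /or4P[] /eqP e.
  - by rewrite (_ : s = Ordinal (ltnW aN2)) //; apply: val_inj.
  - by rewrite stack_sym; apply: cap_conn.
  - by apply: pc; rewrite e mateK.
  - apply: (@connect_trans _ _ (false, Ordinal aN2)); first by apply: pc; rewrite e mateK.
    by rewrite stack_sym; apply: cap_conn.
case/or3P => [/eqP e|/eqP e|/andP[ty tz]].
- by rewrite (_ : Ordinal yN = Ordinal zN) //; apply: val_inj.
- exact: (pc (Ordinal yN) (Ordinal zN)).
- apply: connect_trans (tc (Ordinal yN) ty) _; rewrite stack_sym; exact: (tc (Ordinal zN) tz).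
Qed.

Notation C := (contract (i == 0) a E).
Lemma strand_label_outer (x : pt) : strand_label (outer_vertex x) =
  if (x == a :> nat) || (x == a.+1 :> nat) then 2 * N else x.
Proof.
rewrite /strand_label /outer_vertex /=; case: (leqP N x) => xN //=.
by rewrite ifF //; lia.
Qed.

Lemma same_strand_outer (x y : pt) : y != x ->
  same_strand (if (x == a :> nat) || (x == a.+1 :> nat) then 2 * N else x)
      (if (y == a :> nat) || (y == a.+1 :> nat) then 2 * N else y) = (y == contract_mate a E x
        :> nat).
Proof.
move=> yx; have yx' : (y != x :> nat) by [].
have p2 : p (2 * N) = (2 * N).+1.
  by case: rL => _ _ /(_ _ (leqnn _))[-> _]; rewrite /xor1 mul2n odd_double.
have t2 : touched (2 * N) = false.
  have := cE (ltnW aN2); have := cE aN2; rewrite /touched; lia.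
have xl := ltn_ord x; have yl := ltn_ord y.
case: (boolP ((x == a :> nat) || (x == a.+1 :> nat))) => hx.
  rewrite /same_strand p2 t2 orbF.
  have -> : (y == contract_mate a E x :> nat) = (y == a :> nat) || (y == a.+1 :> nat).
    by rewrite /contract_mate; move: hx yx'; clear; iflia.
  by case: ifP => hy; lia.
case: (boolP ((y == a :> nat) || (y == a.+1 :> nat))) => hy.
  rewrite same_strand_sym /same_strand p2 t2 orbF.
  have -> : (y == contract_mate a E x :> nat) = false.
    apply/eqP => e; move: hx; have <- : contract_mate a E y = x by rewrite e contract_mateK.
    by rewrite /contract_mate; move: hy; clear; iflia.
  by lia.
case/norP: hx => /negPf hx1 /negPf hx2; case/norP: hy => /negPf hy1 /negPf hy2.
rewrite /same_strand /touched /contract_mate hx1 hx2 hy1 hy2 [x == y :> nat]eq_sym (negPf yx')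
  /=.
case: (x =P p a :> nat) => [e|n1].
  by rewrite e mateK [a == y]eq_sym hy1 -e (negPf yx').
case: (x =P p a.+1 :> nat) => [e|n2].
  by rewrite e mateK [a.+1 == y]eq_sym hy2 -e (negPf yx') orbF.
by rewrite /= orbF [p x == y]eq_sym.
Qed.

Lemma stack_partnerE (x : pt) : stack_partner U L x = contract_mate a E x :> nat.
Proof.
have cx : contract_mate a E x < 2 * N.
  exact: (@closed_contract N false a E aN2 cE x (ltn_ord x)).
rewrite /stack_partner ffunE.
have P (y : pt) : (y != x) && connect r (outer_vertex x) (outer_vertex y) = (y == Ordinal cx).
  have -> : (y == Ordinal cx) = (y == contract_mate a E x :> nat) by [].
  rewrite stack_connectE !strand_label_outer.
  case: (eqVneq y x) => [->|yx] /=; last exact: same_strand_outer.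
  by apply/esym/eqP => /esym; apply: contract_mate_neq.
case: pickP => [y|/(_ (Ordinal cx))]; rewrite P; first by move=> /eqP->.
by rewrite eqxx.
Qed.

Lemma big_nat_split (s : seq nat) (F : nat -> bool) : uniq s -> all (ltn^~ (2 * N)) s ->
  (forall x, x < 2 * N -> x \notin s -> F x = false) ->
  \big[addb/false]_(x < 2 * N) F x = \big[addb/false]_(x <- s) F x.
Proof.
move=> us sM h; rewrite -(big_mkord xpredT F) /index_iota subn0 (big_addb_split F us sM).
rewrite [X in _ (+) X]big1_seq ?addbF // => x /andP[xs]; rewrite mem_iota /= => xN.
exact: h.
Qed.

(** A chord is counted at whichever of its ends is the smaller one. *)
Lemma chord_parity c : ((c < p c) && dotted E c) (+) ((p c < p (p c)) && dotted E (p c)) =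
  dotted E c.
Proof.
rewrite mateK dotted_mate; case: (ltngtP c (p c)) => h; rewrite ?addbF //.
by case: (mate_neq E c).
Qed.

Let pE2N : p (2 * N) = (2 * N).+1.
Proof. by case: rL => _ _ /(_ _ (leqnn _))[-> _]; rewrite /xor1 mul2n odd_double. Qed.
Let touched_2N : touched (2 * N) = false.
Proof. by have := cE (ltnW aN2); have := cE aN2; rewrite /touched; lia. Qed.
Lemma same_strand_2N z : z < 2 * N -> same_strand (2 * N) z = false.
Proof. by move=> zN; rewrite /same_strand pE2N touched_2N orbF; lia. Qed.

(** The strand of x consists of the chord of x, or of the chords of a and a +
    1, which are one chord if a loop is closed. *)
Lemma lower_dots_odd (x : pt) :
  \big[addb/false]_(y : pt) (same_strand x (strand_label (false, y)) && (y \in dots L)) =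
  if touched x then (if looped a E then dotted E a else dotted E a (+) dotted E a.+1) else
    dotted E x.
Proof.
pose F y := same_strand x y && ((y < p y) && dotted E y).
transitivity (\big[addb/false]_(y < 2 * N) F y).
  by apply: eq_bigr => y _; case: rL => _ h _; rewrite h.
have pa := cE (ltnW aN2); have pa1 := cE aN2; have xl := ltn_ord x; have px := cE xl.
have naa : a <> a.+1 by lia.
case: ifP => tx; last first.
  have us : uniq [:: x : nat; p x] by rewrite /= inE andbT; apply/eqP => e;
    case: (mate_neq E x).
  have sM : all (ltn^~ (2 * N)) [:: x : nat; p x] by rewrite /= xl px.
  rewrite (big_nat_split us sM) => [|y yN]; last first.
    by rewrite !inE negb_or /F /same_strand tx orbF [x == y :> nat]eq_sym [p x == y]eq_sym =>
      /andP[/negPf-> /negPf->].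
  rewrite !big_cons big_nil addbF /F /same_strand !eqxx /= orbT.
  exact: chord_parity.
have F_in y : touched y -> F y = (y < p y) && dotted E y by rewrite /F /same_strand tx => ->;
  rewrite !orbT.
have F_out y : touched y = false -> F y = false.
  move=> ty; have nxy : x != y :> nat by apply: contraFneq ty => <-.
  have nxy' : p x != y by apply: contraFneq ty => <-; rewrite touched_mate.
  by rewrite /F /same_strand ty andbF (negPf nxy) (negPf nxy').
have [t1 t2] : touched a /\ touched a.+1 by rewrite /touched !eqxx orbT.
case: ifP => [/eqP l|/eqP l].
  have us : uniq [:: a; p a] by rewrite /= inE l; lia.
  have sM : all (ltn^~ (2 * N)) [:: a; p a] by rewrite /= pa (ltnW aN2).
  rewrite (big_nat_split us sM) => [|y yN].
    by rewrite !big_cons big_nil addbF !F_in ?touched_mate // chord_parity.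
  rewrite !inE negb_or => /andP[/negPf n1 /negPf n2]; apply: F_out.
  have e : p a.+1 = a by rewrite -l mateK.
  by rewrite /touched e n1 n2 -{1}l n2.
have np := mate_neq2 (D := E) naa; have n1 := mate_neq E a; have n2 := mate_neq E a.+1.
have n3 : p a.+1 <> a by move=> e; have := mateK E a.+1; rewrite e => /l.
have us : uniq [:: a; p a; a.+1; p a.+1].
  rewrite /= !inE !negb_or; do ?[apply/andP; split] => //; apply/eqP; first [lia | congruence].
have sM : all (ltn^~ (2 * N)) [:: a; p a; a.+1; p a.+1] by rewrite /= pa pa1 aN2 (ltnW aN2).
rewrite (big_nat_split us sM) => [|y yN].
  by rewrite !big_cons big_nil addbF !F_in ?touched_mate // addbA !chord_parity.
rewrite !inE !negb_or => /and4P[/negPf m1 /negPf m2 /negPf m3 /negPf m4]; apply: F_out.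
by rewrite /touched m1 m2 m3 m4.
Qed.

(** The dots of E_0 are at its cap, which belongs to the strand of a + 1, and
    at its cup, labelled 2 N. *)
Lemma upper_dots_odd lx : \big[addb/false]_(y : pt) (same_strand lx (strand_label (true,
  y)) && (y \in dots U)) =
  (i == 0) && (same_strand lx a.+1 (+) same_strand lx (2 * N)).
Proof.
rewrite /gen_diagram /=; case: eqP => [i0|i0] /=; last by rewrite big1 // => y _;
  rewrite inE andbF.
have a0 : a = (2 * N).-2 by rewrite /a i0; lia.
pose F y := (same_strand lx (if y < N then (2 * N).-1 - y else if (y == a) || (y == a.+1) then
  2 * N else y))
  && ((y == 0) || (y == (2 * N).-2)).
transitivity (\big[addb/false]_(y < 2 * N) F y).
  by apply: eq_bigr => y _; rewrite inE.
have us : uniq [:: 0; a] by rewrite /= inE; lia.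
have sM : all (ltn^~ (2 * N)) [:: 0; a] by rewrite /=; lia.
rewrite (big_nat_split us sM) => [|y yN].
  rewrite !big_cons big_nil addbF /F -a0 !eqxx orbT /= !andbT.
  have -> : 0 < N by lia. have -> : a < N = false by lia.
  by have -> : (2 * N).-1 - 0 = a.+1 by lia.
by rewrite !inE /F -a0 => h0; rewrite (negPf (_ : ~~ ((y == 0) || (y == a)))) ?andbF.
Qed.

Lemma strand_dots_odd (x : pt) : odd (strand_dots U L x) = contract_dotted (i == 0) a E x.
Proof.
rewrite /strand_dots -sum1_card big_mkcond /= (big_morph odd oddD (erefl _)).
set lx := strand_label (outer_vertex x).
transitivity (\big[addb/false]_(u : bool) \big[addb/false]_(y : pt) (same_strand lx
  (strand_label (u, y)) && (y \in dots (if u then U else L)))).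
  rewrite pair_bigA /=; apply: eq_bigr => -[u y] _ /=.
  by rewrite inE stack_connectE /=; case: (same_strand _ _ && _).
rewrite big_bool /= upper_dots_odd.
rewrite /lx strand_label_outer; case: (boolP ((x == a :> nat) || (x == a.+1 :> nat))) => hx.
  rewrite big1 => [|y _]; last by rewrite same_strand_2N // /strand_label /=; exact: ltn_ord.
  by rewrite same_strand_2N // same_strand_refl andbT addbF /contract_dotted hx.
rewrite lower_dots_odd [same_strand x (2 * N)]same_strand_sym same_strand_2N // addbF
  /contract_dotted (negPf hx).
have tE : touched x = (x == p a :> nat) || (x == p a.+1 :> nat).
  by rewrite /touched orbA (negPf hx).
have eE : same_strand x a.+1 = touched x.
  case/norP: hx => _ /negPf h2; rewrite /same_strand h2 /= mate_eq.
  have -> : touched a.+1 by rewrite /touched eqxx orbT.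
  by rewrite andbT tE; case: (_ == p a); case: (_ == p a.+1).
rewrite eE -tE; case: (boolP (touched x)) => tx; last by rewrite andbF.
have -> : looped a E = false.
  apply: contraNF hx => /eqP l; have e : p a.+1 = a by rewrite -l mateK.
  by move: tx; rewrite tE l e orbC.
by rewrite andbT addbC.
Qed.

Lemma represents_stack : represents (stack U L) C.
Proof.
split=> [x|x|y yN].
- exact: stack_partnerE.
- by rewrite inE stack_partnerE strand_dots_odd.
- case: rL => _ _ /(_ _ yN)[e1 e2].
  have pa := cE (ltnW aN2); have pa1 := cE aN2.
  by rewrite /= /contract_mate /contract_dotted !ifF ?e1 ?e2 //; lia.
Qed.
End Stack.

Section TopBottom.
Variable N : nat.
Hypothesis N1 : 1 < N.

(** The diagram of a word is built by stacking on top, while the action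
    contracts at the bottom. *)
Definition top_act i D := contract (i == 0) ((2 * N).-2 - i.-1) D.

Lemma top_act_comm i j D : i < N -> j < N -> top_act i (act j D) = act j (top_act i D).
Proof. by move=> iN jN; rewrite /top_act /act -contract_comm //; lia. Qed.

Lemma top_act_id i : i < N -> top_act i (id_pairing N) = act i (id_pairing N).
Proof.
move=> iN; have [h hE] : exists h, h = i.-1 by eexists.
have hN : h.+1 < N by lia.
have [a aE] : exists a, a = (2 * N).-2 - h by eexists.
have ha : h.+1 < a by lia.
have e1 : id_mate N a = h.+1 by rewrite /id_mate ifT; lia.
have e2 : id_mate N a.+1 = h by rewrite /id_mate ifT; lia.
have e3 : id_mate N h = a.+1 by rewrite /id_mate ifT; lia.
have e4 : id_mate N h.+1 = a by rewrite /id_mate ifT; lia.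
apply: dpairing_ext => x; rewrite /= /contract_mate /contract_dotted /= -hE -aE e1 e2 e3 e4.
  by move: (id_mate N x) => y; clear - ha; iflia.
by case: (x == h); case: (x == h.+1); case: (x == a); case: (x == a.+1).
Qed.

(** Contractions at the top and at the bottom commute and they agree on the
    identity, so a word can be read from either end. *)
Lemma foldr_top_act w : all (ltn^~ N) w -> foldr top_act (id_pairing N) w = run w (id_pairing
  N).
Proof.
elim: w => //= i w IH /andP[iN wN]; rewrite IH // -top_act_id //.
elim: w (id_pairing N) wN {IH} => //= j w IH D /andP[jN wN].
by rewrite IH // top_act_comm.
Qed.

Lemma represents_word w : all (ltn^~ N) w ->
  represents (foldr (fun i D => stack (gen_diagram N i) D) id_diagram w) (run w (id_pairing N)).
Proof.
move=> wN; rewrite -foldr_top_act //; elim: w wN => [|i w IH] /=; first by move=> _;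
  exact: represents_id.
by case/andP=> iN wN; apply: represents_stack => //; apply: IH.
Qed.
End TopBottom.

(** * Even diagrams and removal of caps *)

(** Type D with an even number of dots, for a pairing that need not come from a
    diagram. *)
Definition even_typeD N E :=
  [/\ forall x y, x < y -> y < mate E x -> mate E x < mate E y -> y < 2 * N -> False,
      forall x y, x < 2 * N -> x < mate E x -> dotted E x -> y < x -> mate E x < mate E y ->
        False
    & dot_parity N E = false].

(** A type D diagram of the second kind has one dot, so it is excluded by
    parity. *)
Lemma even_typeD_of N (D : diagram N) E : represents D E -> typeD D -> ~~ odd #|dots D| ->
  even_typeD N E.
Proof.
move=> r /and3P[/and3P[_ _ /forallP nc] _ h] even; have [h1 h2 h3] := r.
have cl := represents_closed r.
have out : forall x, x \in dots D -> outer (partner D) x.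
  case/orP: h => [/andP[_ /forall_inP//]|/and3P[/eqP e _ _]].
  by rewrite e in even.
split; last by rewrite -(represents_dot_parity r); apply: negbTE.
- move=> x y xy yp pp yN; have xN := ltn_trans xy yN.
  have /forallP/(_ (Ordinal yN)) := nc (Ordinal xN); rewrite !h1 /= => /negP; apply.
  by rewrite xy yp.
- move=> x y xN xp dx yx pp; have yN := ltn_trans yx xN.
  have xd : Ordinal xN \in dots D by rewrite h2 /= xp.
  have /forallP/(_ (Ordinal yN)) := out _ xd; rewrite !h1 /= => /negP; apply.
  by rewrite yx.
Qed.

Lemma typeD_of_even N (D : diagram N) E : represents D E -> even_typeD N E -> typeD D && ~~ odd
  #|dots D|.
Proof.
move=> r [nc out even]; have [h1 h2 h3] := r.
have od : ~~ odd #|dots D| by rewrite (represents_dot_parity r) even.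
rewrite od andbT; apply/and3P; split.
- apply/and3P; split; apply/forallP => x.
  + by apply/eqP => /(congr1 val); rewrite /= h1; apply: mate_neq.
  + by apply/eqP/val_inj; rewrite /= !h1 mateK.
  + apply/forallP => y; rewrite !h1; apply/negP => /and3P[a1 a2 a3].
    exact: nc a1 a2 a3 (ltn_ord y).
- by apply/forall_inP => x; rewrite h2 h1 => /andP[].
- apply/orP; left; rewrite od; apply/forall_inP => x; rewrite h2 => /andP[xp dx].
  apply/forallP => y; rewrite !h1; apply/negP => /andP[yx pp].
  exact: out (ltn_ord x) xp dx yx pp.
Qed.

Lemma skip_ltn k x y : (skip k x < skip k y) = (x < y).
Proof. by slia. Qed.

Lemma dot_parity_insert N k E : k <= 2 * N -> dot_parity N.+1 (insert_cap k E) = dot_parity N E.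
Proof.
move=> kN; have us : uniq [:: k; k.+1] by rewrite /= inE; lia.
have sM : all (ltn^~ (2 * N.+1)) [:: k; k.+1] by rewrite /=; lia.
rewrite /dot_parity -[mate (insert_cap k E)]/(insert_mate k E) -[dotted (insert_cap k
  E)]/(insert_dotted k E) (big_addb_split _ us sM).
rewrite 2!big_cons big_nil !insert_capE !andbF !addFb.
rewrite -big_filter (perm_big (map (skip k) (iota 0 (2 * N)))).
  have Ef x : (skip k x < insert_mate k E (skip k x)) && insert_dotted k E (skip k x) = (x <
    mate E x) && dotted E x.
    by rewrite !insert_capE skip_ltn.
  by rewrite big_map (eq_bigr _ (fun x _ => Ef x)).
apply: uniq_perm.
- by rewrite filter_uniq // iota_uniq.
- by rewrite map_inj_uniq ?iota_uniq //; exact: skip_inj.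
- move=> y; rewrite mem_filter mem_iota /= !inE; case: (skipP k y) => [||x].
  + rewrite eqxx /=; apply/esym/mapP => -[z _ e]; have := skip_neq k z; rewrite -e eqxx //.
  + rewrite eqxx orbT /=; apply/esym/mapP => -[z _ e]; have := skip_neq k z;
    rewrite -e eqxx orbT //.
  + rewrite skip_neq (mem_map (@skip_inj k)) mem_iota /=; slia.
Qed.

Lemma dot_parity_toggle0 N E : 0 < N -> closed_below N E -> dot_parity N (toggle0 E) = ~~
  dot_parity N E.
Proof.
move=> N0 cE; have p0 := cE 0; have n0 := mate_neq E 0.
have us : uniq [:: 0; mate E 0] by rewrite /= inE; lia.
have sM : all (ltn^~ (2 * N)) [:: 0; mate E 0] by rewrite /=; lia.
rewrite /dot_parity !(big_addb_split _ us sM) !big_cons !big_nil /= /toggle_dotted eqxx /=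
  !mateK ltn0 /= !addbF.
have -> : 0 < mate E 0 by lia.
set R1 := bigop _ _ _; set R2 := bigop _ _ _; have -> : R1 = R2.
  by apply: eq_bigr => x; rewrite !inE => /negPf->; rewrite addbF.
by case: R2 => {R1}; case: (dotted E 0).
Qed.

Lemma mate_add_cap i E x : mate (add_cap i E) (skip i.-1 x) = skip i.-1 (mate E x).
Proof. by case: i => [|i]; rewrite /add_cap /= insert_capE. Qed.
Lemma dotted_add_cap i E x : dotted (add_cap i E) (skip i.-1 x) =
  dotted E x (+) ((i == 0) && ((x == 0) || (x == mate E 0))).
Proof. by case: i => [|i]; rewrite /add_cap /= ?/toggle_dotted /= insert_capE ?addbF. Qed.

Lemma add_cap_closed N i E : closed_below N.+1 (add_cap i E) -> i.-1 <= 2 * N -> closed_below N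
  E.
Proof.
move=> c iN x xN; have := c (skip i.-1 x); rewrite mate_add_cap; rewrite /skip; case: ifP;
  case: ifP; lia.
Qed.

(** Removing a dotted cap removes a dot and toggles another one. The chord
    whose dot is toggled contains the left-most point, so it is outer. *)
Lemma even_typeD_add_cap N i E : 0 < N -> i.-1 <= 2 * N -> closed_below N.+1 (add_cap i E) ->
  even_typeD N.+1 (add_cap i E) -> even_typeD N E.
Proof.
move=> N0 iN cl [nc out even]; have cE := add_cap_closed cl iN.
have sb x : x < 2 * N -> skip i.-1 x < 2 * N.+1 by move=> ?; slia.
split.
- move=> x y xy yp pp yN; apply: (nc (skip i.-1 x) (skip i.-1 y));
  rewrite ?mate_add_cap ?skip_ltn ?sb //.
- move=> x y xN xp dx yx pp; case: (boolP ((i == 0) && ((x == 0) || (x == mate E 0)))) => h.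
    case/andP: h => _ /orP[/eqP x0|/eqP x0]; first by rewrite x0 in yx.
    by rewrite x0 mateK in xp.
  apply: (out (skip i.-1 x) (skip i.-1 y)); rewrite ?mate_add_cap ?skip_ltn ?sb //.
  by rewrite dotted_add_cap (negPf h) addbF.
- case: i {cl nc out sb} iN even => [|i] iN; rewrite /add_cap /= ?dot_parity_insert //.
  have ct : closed_below N (toggle0 E) by [].
  rewrite dot_parity_toggle0 // ?dot_parity_insert ?dot_parity_toggle0 ?negbK //.
  move=> x; case: (skipP 0 x) => [||y]; rewrite /= ?insert_capE => xN; try lia.
  have yN : y < 2 * N by move: xN; slia.
  by move: (cE y yN); rewrite -[mate (toggle0 E)]/(mate E); move: (mate E y) => z; slia.
Qed.

Section Cap.
Variables (n : nat) (D : diagram n.+1) (E : dpairing).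
Hypotheses (n0 : 0 < n) (rD : represents D E).

Lemma represents_remove (j : 'I_n.+1) E' :
  (forall x, mate E (skip j x) = skip j (mate E' x)) ->
  (forall x, dotted E (skip j x) = dotted E' x) -> represents (remove_cap D j) E'.
Proof.
move=> hp hd; have [h1 h2 h3] := rD; have jn := ltn_ord j.
have b x : x < 2 * n -> mate E' x < 2 * n.
  move=> xn; have := represents_closed rD (x := skip j x) _; rewrite hp; move: (mate E' x) => y.
  by move=> /(_ ltac:(slia)); slia.
split=> [x|x|y yn].
- have uE y : unskip_cap j y = unskip j y by [].
  rewrite ffunE h1 uE -[nat_of_ord (old_point j x)]/(skip j x) hp skipK.
  by rewrite val_insubd b.
- by rewrite inE h2 -[nat_of_ord (old_point j x)]/(skip j x) hp hd skip_ltn.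
- have e : skip j y = y.+2 by slia.
  have [|e1 e2] := h3 y.+2; first by lia.
  rewrite -hd e e2; split=> //; apply: (@skip_inj j); rewrite -hp e e1.
  have yj : j <= xor1 y by rewrite /xor1; case: ifP; lia.
  by rewrite /skip ltnNge yj /xor1 /= negbK; case: ifP; lia.
Qed.

Lemma represents_toggle N (C : diagram N) F : 0 < N -> represents C F -> represents
  (toggle_first_dot C) (toggle0 F).
Proof.
move=> N0 [h1 h2 h3]; split=> [x|x|y yN] /=.
- exact: h1.
- rewrite inE h2 /toggle_dotted; have n1 := mate_neq F 0.
  case: (x =P 0 :> nat) => [->|x0] /=; first by have -> : 0 < mate F 0 by lia.
  by case: (x =P mate F 0 :> nat) => [->|x1]; rewrite ?addbF // mateK.
- have [e1 e2] := h3 _ yN; split=> //; rewrite /toggle_dotted e2.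
  have -> : (y == 0) = false by lia.
  apply/eqP => e; have p0 : mate F 0 < 2 * N.
    have N1 : 0 < 2 * N by lia.
    by rewrite -(h1 (Ordinal N1)).
  by move: yN; rewrite e; lia.
Qed.

Lemma bottom_val (j : 'I_n.+1) : bottom_point j = j :> nat. Proof. by []. Qed.

Lemma dotted_caps_add (j : 'I_n.+1) : j \in dotted_caps D ->
  j = 0 :> nat /\ exists2 E', E = add_cap 0 E' & represents (cap_removed D j) E'.
Proof.
move=> jd; move: (jd); rewrite inE => /and3P[/eqP j0 /eqP c d].
have [h1 h2 h3] := rD; have j0' : j = 0 :> nat by rewrite j0.
have e1 : mate E 0 = 1 by move: c; rewrite h1 bottom_val j0'.
have e2 : dotted E 0 by move: d; rewrite h2 bottom_val j0' => /andP[].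
have [E1 hE1] : exists E1, toggle0 E = insert_cap 0 E1.
  by apply: insert_cap_ex => //=; rewrite /toggle_dotted e2.
split=> //; exists (toggle0 E1); first by rewrite /add_cap /= toggle0K -hE1 toggle0K.
rewrite /cap_removed jd; apply: represents_toggle => //; apply: represents_remove => x;
  rewrite j0'.
  by rewrite -[mate E]/(mate (toggle0 E)) hE1 /= insert_capE.
have := congr1 (fun D => dotted D (skip 0 x)) hE1;
  rewrite /= insert_capE /toggle_dotted e1 => <-.
by rewrite addbF.
Qed.

Lemma undotted_caps_add (j : 'I_n.+1) : j \in undotted_caps D -> 
  exists2 E', E = add_cap j.+1 E' & represents (cap_removed D j) E'.
Proof.
rewrite inE => /andP[/eqP c d]; have [h1 h2 h3] := rD.
have e1 : mate E j = j.+1 by move: c; rewrite h1 bottom_val.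
have e2 : dotted E j = false by move: d; rewrite h2 bottom_val e1 ltnSn => /negbTE.
have [E1 hE1] := insert_cap_ex e1 e2; exists E1 => //.
have -> : cap_removed D j = remove_cap D j.
  by rewrite /cap_removed inE (negPf d) !andbF.
by apply: represents_remove => x; rewrite hE1 /= insert_capE.
Qed.

Lemma add_dotted_caps E' : E = add_cap 0 E' -> ord0 \in dotted_caps D.
Proof.
move=> e; have [h1 h2 h3] := rD; rewrite inE eqxx /innermost_cap h1 h2 bottom_val /= e.
by rewrite /add_cap /= /toggle_dotted /= ?insert_capE.
Qed.
Lemma add_undotted_caps (j : 'I_n.+1) E' : E = add_cap j.+1 E' -> j \in undotted_caps D.
Proof.
move=> e; have [h1 h2 h3] := rD; rewrite inE /innermost_cap h1 h2 bottom_val e.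
by rewrite /add_cap /= !insert_capE eqxx andbF.
Qed.

Lemma cap_removed_typeD (j : 'I_n.+1) : even_typeD n.+1 E -> j \in caps D ->
  typeD (cap_removed D j) && ~~ odd #|dots (cap_removed D j)|.
Proof.
have jn := ltn_ord j; have cl := represents_closed rD.
move=> gE; rewrite inE => /orP[/dotted_caps_add[_ [E' e r]]|/undotted_caps_add[E' e r]];
  apply: (typeD_of_even r); rewrite e in gE cl; apply: even_typeD_add_cap gE => //=; lia.
Qed.
End Cap.

(** The first point r at which a chord closes is the end of an inner-most cap;
    all points before r open chords, so r <= N. If the cap is dotted, hence
    outer, no chord opens before it. *)
Lemma innermost_ex N E : 0 < N -> closed_below N E -> even_typeD N E ->
  exists2 k, k < N & mate E k = k.+1 /\ (dotted E k -> k = 0).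
Proof.
move=> N0 cE [nc out _].
have ex : exists r, mate E r < r.
  by exists (mate E 0); rewrite mateK; have := mate_neq E 0; lia.
have [r rr rmin] := ex_minnP ex.
have op y : y < r -> y < mate E y.
  move=> yr; have ne := mate_neq E y; case: (ltngtP y (mate E y)) => // h; last by lia.
  have := rmin y h; lia.
have op2 y : y < r -> r <= mate E y.
  move=> yr; rewrite leqNgt; apply/negP => h.
  have a1 := op _ h; have a2 := op _ yr; rewrite mateK in a1; lia.
have r0 : 0 < r by lia.
have rN : r < 2 * N.
  have p0 : mate E 0 < 2 * N by apply: cE; lia.
  have : r <= mate E 0 by apply: rmin; rewrite mateK; have := mate_neq E 0; lia.
  by lia.
exists r.-1.
  have : size (map (mate E) (iota 0 r)) <= size (iota r (2 * N - r)).
    apply: uniq_leq_size; first by rewrite map_inj_uniq ?iota_uniq //; exact: mate_inj.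
    move=> y /mapP[x]; rewrite mem_iota => /andP[_ xr] ->; rewrite mem_iota op2 //=.
    by have := cE x; lia.
  by rewrite size_map !size_iota; lia.
have pr1 : mate E r = r.-1.
  apply/eqP; rewrite eqn_leq; apply/andP; split; first by lia.
  rewrite leqNgt; apply/negP => h.
  have o1 : r <= mate E r.-1 by apply: op2; lia.
  have o2 : mate E r.-1 <> r by move=> e; have := mateK E r.-1; rewrite e; lia.
  apply: (nc (mate E r) r.-1) => //; rewrite ?mateK; lia.
have pr2 : mate E r.-1 = r.-1.+1 by rewrite -pr1 mateK pr1; lia.
split=> // d; apply/eqP; rewrite -leqn0 leqNgt; apply/negP => h.
have o1 : r <= mate E 0 by apply: op2.
have o2 : mate E 0 <> r by move=> e; have := mateK E 0; rewrite e pr1; lia.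
by apply: (out r.-1 0) => //; rewrite ?pr2; lia.
Qed.

Lemma caps_ex n (D : diagram n.+1) E : represents D E -> even_typeD n.+1 E -> exists j,
  j \in caps D.
Proof.
move=> r gE; have [k kN [pk dk]] := innermost_ex (ltn0Sn n) (represents_closed r) gE.
have [h1 h2 h3] := r; exists (Ordinal kN); rewrite !inE /innermost_cap h1 h2 bottom_val /= pk.
rewrite eqxx ltnSn /=; case: (dotted E k) dk => /= h; rewrite ?orbT // orbF andbT.
by apply/eqP/val_inj; rewrite /= h.
Qed.

Lemma represents_one (D : diagram 1) E : represents D E -> even_typeD 1 E -> E = id_pairing 1.
Proof.
move=> r [_ _ pE]; have [h1 h2 h3] := r; have cl := represents_closed r.
have c0 := cl 0 isT; have n0 := mate_neq E 0.
have e0 : mate E 0 = 1 by lia.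
have e1 : mate E 1 = 0 by rewrite -e0 mateK.
have d0 : dotted E 0 = false.
  by move: pE; rewrite /dot_parity muln1 /= !big_cons big_nil e0 e1 /= addbF.
have d1 : dotted E 1 = false by rewrite -e0 dotted_mate.
apply: dpairing_ext => -[|[|x]] //=; last by rewrite (h3 x.+2 _).2.
by rewrite (h3 x.+2 _).1 // /id_mate.
Qed.

(** Caps are removed until one strand is left, which is undotted by parity. *)
Lemma even_typeD_normal n (D : diagram n.+1) E : represents D E -> even_typeD n.+1 E -> exists
  v, normal n.+1 E v.
Proof.
elim: n D E => [|n IH] D E r gE; first by exists [::]; rewrite (represents_one r gE);
  exact: normal1.
have [j] := caps_ex r gE; have jn := ltn_ord j; have cl := represents_closed r.
rewrite inE => /orP[/(dotted_caps_add (ltn0Sn n) r)[_ [E' e r']]|/(undotted_caps_add (ltn0Sn n)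
  r)[E' e r']].
  have g' : even_typeD n.+1 E' by rewrite e in gE cl; apply: even_typeD_add_cap gE.
  have [v hv] := IH _ _ r' g'; exists (v ++ capword n.+1 0); rewrite e; exact: normalS.
have g' : even_typeD n.+1 E' by rewrite e in gE cl; apply: even_typeD_add_cap gE => //=; lia.
have [v hv] := IH _ _ r' g'; exists (v ++ capword n.+1 j.+1); rewrite e; exact: normalS.
Qed.

(** * The recursion for the coefficients *)

Local Open Scope ring_scope.

(** The indeterminate is transcendental. *)
Lemma Cq_generic (R : realType) : generic (Cq_q R).
Proof.
split=> [|k k0].
  by rewrite /Cq_q tofrac_eq0 polyX_eq0.
rewrite /Cq_q -tofracXn -[1 in X in _ != X]tofrac1 tofrac_eq.
apply/eqP => /(congr1 (fun p : {poly _} => size p)).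
by rewrite size_polyXn size_poly1 => -[]; lia.
Qed.

Section Bridge.
Variables (K : fieldType) (q : K).
Hypothesis qg : generic q.
Variable n : nat.
Hypothesis n0 : (0 < n)%N.
Notation I := (id_pairing n.+1).

Lemma word_wordN (w : seq 'I_n.+1) : word q w = wordN q n (map val w).
Proof. by rewrite /word /wordN big_map; apply: eq_bigr => i _; rewrite genE_genN. Qed.
Lemma letters_val (w : seq 'I_n.+1) : all (leq^~ n) (map val w).
Proof. by apply/allP => _ /mapP[i _ ->]; rewrite /= -ltnS ltn_ord. Qed.
Lemma val_inordK w : all (leq^~ n) w -> map val (map (@inord n) w) = w.
Proof.
move=> wn; rewrite -map_comp -[RHS]map_id; apply/eq_in_map => i /(allP wn) /= h.
by rewrite inordK.
Qed.
Lemma reduced_reducedN (w : seq 'I_n.+1) : reduced q w <-> reducedN q n (map val w).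
Proof.
split=> [h|[_ h]].
  split; first exact: letters_val.
  case=> v [c [vn sv E]]; apply: h; exists (map (@inord n) v), c.
  by rewrite size_map !word_wordN val_inordK // E; split=> //; rewrite size_map in sv.
case=> v [c [sv E]]; apply: h; exists (map val v), c.
by rewrite !size_map -!word_wordN; split=> //; exact: letters_val.
Qed.

(** A basis element with diagram D is the normal word for D, by
    [reducedN_dichotomy] and parity; and a reduced multiple of that word shows
    that one exists. *)
Lemma projector_coefE (D : diagram n.+1) E v : represents D E -> ~~ odd #|dots D| -> normal
  n.+1 E v ->
  projector_coef q D = fun_act (projector q n) (indicator K E) I.
Proof.
move=> r even hv; have N1 : (1 < n.+1)%N by [].
rewrite /projector_coef; case: classical_sets.xgetP => [c _ [b [w [rw -> wD]] [s [f [us hs xE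
  ->]]]]|no].
  have rw' := (reduced_reducedN w).1 rw.
  have rr := represents_word N1 (letters_val w : all (ltn^~ n.+1) _).
  have bv : word q w = wordN q n v.
    rewrite word_wordN; move: wD; rewrite /word_diagram /move_dot (represents_dot_parity rr).
    case: (reducedN_dichotomy qg n0 rw') => [[_ -> [v' hv' ->]] wD|[_ ->] wD].
      by rewrite wD in rr; rewrite (represents_fun rr r) in hv'; apply: normal_uniq hv' hv.
    move: even; rewrite -wD /=; have z : (0 < 2 * n.+1)%N by [].
    rewrite (_ : [set x : 'I_(2 * n.+1) | x == 0%N :> nat] = [set (Ordinal z)]) ?cards1 //.
    by apply/setP => x; rewrite !inE.
  rewrite bv; apply: (expansion_coefE qg n0 us _ xE hv).
  by move=> y /hs[w' /reduced_reducedN rw1 ->]; exists (map val w') => //; rewrite word_wordN.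
have vn := normal_letters hv; rewrite /= in vn.
have [v' [c [rv vE]]] := reducedN_ex q vn; have v'n := rv.1.
have e1 : fun_act (wordN q n v) (indicator K E) I = 1 by rewrite (fun_act_normal q _ hv)
  /indicator asboolT.
have rE : run v' I = E.
  apply: contrapT => ne; move: e1.
  by rewrite vE fun_actZ fun_act_wordN // /indicator asboolF // !mulr0 => /esym/eqP;
    rewrite oner_eq0.
exfalso; have [s [f [us hs xE]]] := reducedN_expansion (projector q n).
pose b := wordN q n v'.
apply: (no (if b \in s then f b else 0)); exists b.
  exists (map (@inord n) v'); split.
  - by apply/reduced_reducedN; rewrite val_inordK.
  - by rewrite word_wordN val_inordK.
  - rewrite val_inordK // /word_diagram.
    have := represents_word N1 (v'n : all (ltn^~ n.+1) _); rewrite rE => rr.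
    by rewrite (represents_inj rr r) /move_dot (negPf even).
exists s, f; split=> // y /hs[w' rw ->]; exists (map (@inord n) w').
  by apply/reduced_reducedN; rewrite val_inordK //; case: rw.
by rewrite word_wordN val_inordK //; case: rw.
Qed.
End Bridge.

Theorem proposition3p7 (R : realType) (n : nat) (D : diagram n.+1) :
  (1 <= n)%N -> typeD D -> ~~ odd #|dots D| ->
  coef (Cq_q R) D
    = \sum_(i in caps D) coef_g (Cq_q R) n i.+1 * coef (Cq_q R) (cap_removed D i)
  /\ (forall i, i \in caps D ->
        typeD (cap_removed D i) && ~~ odd #|dots (cap_removed D i)|).
Proof.
case: n D => // n D _ tD even.
have qg := Cq_generic R; set q := Cq_q R in qg *.
have [E rD] : exists E, represents D E.
  by case/and3P: (tD) => cD /forall_inP dD _; exact: represents_ex.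
have gE := even_typeD_of rD tD even.
split; last by move=> j; apply: (cap_removed_typeD (ltn0Sn n) rD gE).
have [v hv] := even_typeD_normal rD gE.
have [Q' iQ' cQ'] : exists2 Q' : TLD q n, is_proj Q' &
    forall (C : diagram n.+1) F, represents C F -> even_typeD n.+1 F -> fun_act Q' (indicator _
      F) (id_pairing n.+1) = coef q C.
  case: n {D tD even E rD gE v hv} => [|n].
    exists 1; first by split; rewrite ?eps1.
    move=> C F rC gF; have e := represents_one rC gF; rewrite e in rC *.
    by rewrite fun_act1 /indicator asboolT //= (represents_inj rC (represents_id 1)) eqxx.
  exists (projector q n.+1); first exact: is_proj_projector.
  move=> C F rC gF; have [u hu] := even_typeD_normal rC gF.
  rewrite -(projector_coefE qg _ rC _ hu) //.
  by have /andP[] := typeD_of_even rC gF.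
rewrite [LHS](projector_coefE qg _ rD even hv) //.
rewrite (fun_act_proj_rec qg _ (is_proj_projector qg (ltn0Sn n)) iQ').
have cc (j : 'I_n.+2) i E' : j \in caps D -> E = add_cap i E' -> represents (cap_removed D j)
  E' ->
    removed_coef Q' E i = coef q (cap_removed D j).
  move=> jc -> rj; rewrite removed_coef_add_cap; apply: cQ' (rj) _.
  have /andP[t o] := cap_removed_typeD (ltn0Sn n) rD gE jc.
  exact: even_typeD_of rj t o.
have cu (j : 'I_n.+2) : removed_coef Q' E j.+1 =
    if j \in undotted_caps D then coef q (cap_removed D j) else 0.
  case: ifP => ju.
    have [E' e rj] := undotted_caps_add (ltn0Sn n) rD ju.
    by apply: cc e rj; rewrite inE ju orbT.
  by apply: removed_coef_eq0 => E' e; rewrite (add_undotted_caps rD e) in ju.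
have cd : removed_coef Q' E 0 =
    if ord0 \in dotted_caps D then coef q (cap_removed D ord0) else 0.
  case: ifP => ju.
    have [_ [E' e rj]] := dotted_caps_add (ltn0Sn n) rD ju.
    by apply: cc e rj; rewrite inE ju.
  by apply: removed_coef_eq0 => E' e; rewrite (add_dotted_caps rD e) in ju.
rewrite big_nat_recl // big_mkord cd [RHS]big_mkcond /=.
rewrite [RHS](bigD1 ord0) //= [X in _ + X](bigD1 ord0) //= addrA; congr (_ + _); last first.
  apply: eq_bigr => j j0; rewrite cu /cap_weight (_ : maxn j.+1 1 = j.+1)%N; last by lia.
  have -> : (j \in caps D) = (j \in undotted_caps D).
    by rewrite inE [j \in dotted_caps D]inE (negPf j0).
  by case: ifP; rewrite ?mulr0.
rewrite (cu ord0) /cap_weight /=.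
have -> : (ord0 \in caps D) = (ord0 \in dotted_caps D) || (ord0 \in undotted_caps D).
  by rewrite inE.
case: (boolP (ord0 \in dotted_caps D)) => hd; last by case: ifP; rewrite ?mulr0 add0r.
rewrite ifF ?mulr0 ?addr0 //.
by move: hd; rewrite !inE => /and3P[_ _ ->]; rewrite andbF.
Qed.
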